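(* Let $f\in H_{k,\chi,\rho}$ be a vector-valued harmonic weak Maass form. Then for every $\varphi$ such that $\varphi$ and $\varphi|_{2-k,\chi^{-1}}S$ lie in $\mathcal{F}_f$, \[L_f(\varphi)=i^k\rho(S)\,L_f(\varphi|_{2-k,\chi^{-1}}S),\] and for every $\varphi$ such that $\varphi$ and $\varphi|_{2-k,\chi^{-1}}S$ lie in $\mathcal{F}_{\delta_kf}$, \[L_{\delta_kf}(\varphi)=-i^k\rho(S)\,L_{\delta_kf}(\varphi|_{2-k,\chi^{-1}}S),\] where $(\varphi|_{2-k,\chi^{-1}}S)(x):=x^{k-2}\chi(S)\varphi(1/x)$.
   Context: Let $\Gamma=\mathrm{SL}_2(\mathbb{Z})$, $S=\left(\begin{smallmatrix}0&-1\\1&0\end{smallmatrix}\right)$, $k\in\frac12\mathbb{Z}$, $\chi$ a unitary multiplier system of weight $k$ on $\Gamma$ ($|\chi|=1$ and $\chi(\gamma_1\gamma_2)(c_3\tau+d_3)^k=\chi(\gamma_1)\chi(\gamma_2)(c_1\gamma_2\tau+d_1)^k(c_2\tau+d_2)^k$, where $\gamma_1\gamma_2=\left(\begin{smallmatrix}a_3&b_3\\c_3&d_3\end{smallmatrix}\right)$), $\rho:\Gamma\to\mathrm{GL}(m,\mathbb{C})$ a unitary representation, $\mathbf{e}_j$ the standard basis of $\mathbb{C}^m$, $(f|_{k,\chi,\rho}\gamma)(\tau):=(c\tau+d)^{-k}\chi(\gamma)^{-1}\rho(\gamma)^{-1}f(\gamma\tau)$, and $\kappa_1,\dots,\kappa_m\in[0,1)$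 fixed. With $\tau=u+iv$, $H_{k,\chi,\rho}$ is the space of real-analytic $f=\sum_jf_j\mathbf{e}_j:\mathbb{H}\to\mathbb{C}^m$ with $f|_{k,\chi,\rho}\gamma=f$ for all $\gamma\in\Gamma$, $\Delta_kf=0$ where $\Delta_k=-4v^2\partial_\tau\partial_{\bar\tau}+2kiv\partial_{\bar\tau}$, and having a Fourier expansion $f(\tau)=\sum_j\sum_{n\gg-\infty}c^+_{f,j}(n)e^{2\pi i(n+\kappa_j)\tau}\mathbf{e}_j+\sum_j\sum_{n+\kappa_j<0}c^-_{f,j}(n)\Gamma(1-k,-4\pi(n+\kappa_j)v)e^{2\pi i(n+\kappa_j)\tau}\mathbf{e}_j$, $\Gamma(a,w)$ the incomplete gamma function. Let $n_0\in\mathbb{N}$ with $f_j=O(e^{2\pi n_0v})$ as $v\to\infty$. $\mathcal{L}$ is the Laplace transform, $\varphi_s(x):=\varphi(x)x^{s-1}$. $\mathcal{F}_f$ is the space of piecewise smooth $\varphi$ with: $(\mathcal{L}\varphi)(s)$ absolutely convergent for $\mathrm{Re}(s)\ge-2\pi n_0$; $(\mathcal{L}\varphi_{2-k})(s)$ absolutely convergent for $\mathrm{Re}(s)>0$; and for each $j$ convergence of $\sum_n|c^+_{f,j}(n)|(\mathcal{L}|\varphi|)(2\pi(n+\kappa_j))+\sum_{n+\kappa_j<0}|c^-_{f,j}(n)|(4\pi|n+\kappa_j|)^{1-k}\int_0^\infty\frac{(\mathcal{L}|\varphi_{2-k}|)(-2\pi(n+\kappa_j)(2t+1))}{(1+t)^k}dt$.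 For such $\varphi$, $L_f(\varphi):=\sum_j\sum_nc^+_{f,j}(n)(\mathcal{L}\varphi)(2\pi(n+\kappa_j))\mathbf{e}_j+\sum_j\sum_{n+\kappa_j<0}c^-_{f,j}(n)(-4\pi(n+\kappa_j))^{1-k}\int_0^\infty\frac{(\mathcal{L}\varphi_{2-k})(-2\pi(n+\kappa_j)(2t+1))}{(1+t)^k}dt\,\mathbf{e}_j$. Let $(\delta_kf)(\tau):=\tau\frac{\partial f}{\partial u}+\frac k2f$. $\mathcal{F}_{\delta_kf}$ is the space of piecewise smooth $\varphi$ with: $(\mathcal{L}\varphi)(s)$ absolutely convergent for $\mathrm{Re}(s)\ge-2\pi n_0$; $(\mathcal{L}\varphi_{3-k})(s)$ absolutely convergent for $\mathrm{Re}(s)>0$; and for each $j$ convergence of $\sum_n|c^+_{f,j}(n)(n+\kappa_j)|(\mathcal{L}|\varphi_2|)(2\pi(n+\kappa_j))+\sum_{n+\kappa_j<0}|c^-_{f,j}(n)(n+\kappa_j)|(4\pi|n+\kappa_j|)^{1-k}\int_0^\infty\frac{(\mathcal{L}|\varphi_{3-k}|)(-2\pi(n+\kappa_j)(2t+1))}{(1+t)^k}dt$. For such $\varphi$, $L_{\delta_kf}(\varphi):=\frac k2L_f(\varphi)-2\pi\sum_j\sum_nc^+_{f,j}(n)(n+\kappa_j)(\mathcal{L}\varphi_2)(2\pi(n+\kappa_j))\mathbf{e}_j-2\pi\sum_j\sum_{n+\kappa_j<0}c^-_{f,j}(n)(n+\kappa_j)(-4\pi(n+\kappa_j))^{1-k}\int_0^\infty\frac{(\mathcal{L}\varphi_{3-k})(-2\pi(n+\kappa_j)(2t+1))}{(1+t)^k}dt\,\mathbf{e}_j$.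 *)

(* Defs.v *)
From mathcomp Require Import all_boot all_order all_algebra.
From mathcomp Require Import complex.
From mathcomp Require Import all_classical all_reals all_analysis.

Set Implicit Arguments.
Unset Strict Implicit.
Unset Printing Implicit Defensive.

Import Order.TTheory GRing.Theory Num.Theory.
Import numFieldNormedType.Exports.
Import ComplexField.Normc.

Local Open Scope classical_set_scope.
Local Open Scope ring_scope.
Local Open Scope complex_scope.

Local Notation Re := complex.Re.
Local Notation Im := complex.Im.

Section Complex.
Variable R : realType.
Implicit Types (z : R[i]) (g : R -> R[i]) (u : nat -> R[i]) (v : int -> R[i]).

Definition cexp z : R[i] :=
  (expR (Re z) * cos (Im z)) +i* (expR (Re z) * sin (Im z)).

(* Principal branch, with values in ]-pi, pi]. *)
Definition carg z : R :=
  let t := acos (Re z / normc z) in if 0 <= Im z then t else - t.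

Definition cpow z (a : R) : R[i] :=
  (normc z `^ a)%:C * cexp ((a * carg z) *i).

Definition Rpos : set R := `]0, +oo[%classic.

Definition cint g : R[i] :=
  (\int[lebesgue_measure]_(x in Rpos) Re (g x)) +i*
  (\int[lebesgue_measure]_(x in Rpos) Im (g x)).

Definition ccvg_series u : Prop :=
  cvgn (series (fun n => Re (u n))) /\ cvgn (series (fun n => Im (u n))).

Definition csum u : R[i] :=
  limn (series (fun n => Re (u n))) +i* limn (series (fun n => Im (u n))).

(* Sums over {n : int | P n}, as the sum over n >= 0 plus the sum over n < 0
   (Negz n is - (n + 1)). *)
Definition restrZ (P : pred int) v (n : int) : R[i] := if P n then v n else 0.

Definition ccvg_sumZ (P : pred int) v : Prop :=
  ccvg_series (fun n => restrZ P v (Posz n)) /\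
  ccvg_series (fun n => restrZ P v (Negz n)).

Definition csumZ (P : pred int) v : R[i] :=
  csum (fun n => restrZ P v (Posz n)) + csum (fun n => restrZ P v (Negz n)).

Definition inc_gamma (a w : R) : R :=
  \int[lebesgue_measure]_(t in `]w, +oo[) (t `^ (a - 1) * expR (- t)).

Definition smooth (h : R -> R) : Prop :=
  forall (n : nat) (x : R), derivable (derive1n n h) x 1.

(* Piecewise smooth on ]0, +oo[: every compact subinterval has a finite
   subdivision on whose open pieces phi coincides with a function that is
   smooth up to and beyond the end points (so that all one-sided derivatives
   exist there); the values at the break points are arbitrary. *)
Definition piecewise_smooth (phi : R -> R[i]) : Prop :=
  forall a b : R, 0 < a -> a < b ->
  exists (N : nat) (t : nat -> R),
    [/\ t 0%N = a, t N = b &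
        forall i, (i < N)%N -> t i < t i.+1 /\
          exists g : R -> R[i],
            [/\ smooth (fun x => Re (g x)), smooth (fun x => Im (g x)) &
                forall x, t i < x < t i.+1 -> phi x = g x]].

Definition laplace g (s : R[i]) : R[i] :=
  cint (fun x => cexp (- (s * x%:C)) * g x).

Definition laplace_acvg g (s : R[i]) : Prop :=
  (\int[lebesgue_measure]_(x in Rpos)
     (normc (cexp (- (s * x%:C)) * g x))%:E < +oo)%E.

(* (L |g|)(s) for real s, possibly +oo. *)
Definition laplace_abs g (s : R) : \bar R :=
  (\int[lebesgue_measure]_(x in Rpos) (expR (- (s * x)) * normc (g x))%:E)%E.

Definition twist (phi : R -> R[i]) (s : R) : R -> R[i] :=
  fun x => phi x * (x `^ (s - 1))%:C.

End Complex.

Section UpperHalfPlane.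
Variable R : realType.
Implicit Types (tau : R[i]) (g : R[i] -> R[i]).

Definition upper tau : Prop := 0 < Im tau.

Definition real_analytic g : Prop :=
  forall tau0, upper tau0 ->
  exists (r : R) (a : nat -> nat -> R[i]),
    [/\ 0 < r,
        exists B : R, forall n,
          \sum_(p < n) \sum_(q < n) normc (a p q) * r ^+ (p + q) <= B &
        forall tau, upper tau ->
          `|Re tau - Re tau0| < r -> `|Im tau - Im tau0| < r ->
          let part n : R[i] := \sum_(p < n) \sum_(q < n)
            a p q * ((Re tau - Re tau0) ^+ p * (Im tau - Im tau0) ^+ q)%:C in
          ((fun n => Re (part n)) @ \oo --> Re (g tau)) /\
          ((fun n => Im (part n)) @ \oo --> Im (g tau))].

Definition partial_u g tau : R[i] :=
  derive1 (fun x : R => Re (g (x +i* Im tau))) (Re tau) +i*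
  derive1 (fun x : R => Im (g (x +i* Im tau))) (Re tau).

Definition partial_v g tau : R[i] :=
  derive1 (fun y : R => Re (g (Re tau +i* y))) (Im tau) +i*
  derive1 (fun y : R => Im (g (Re tau +i* y))) (Im tau).

Definition partial_tau g tau : R[i] :=
  (partial_u g tau - 'i * partial_v g tau) / 2.

Definition partial_taubar g tau : R[i] :=
  (partial_u g tau + 'i * partial_v g tau) / 2.

Definition Delta (k : R) g tau : R[i] :=
  - 4 * (Im tau ^+ 2)%:C * partial_tau (partial_taubar g) tau
  + 2 * k%:C * 'i * (Im tau)%:C * partial_taubar g tau.

End UpperHalfPlane.

Section Modular.
Variable R : realType.
Implicit Types (tau : R[i]) (gam : 'M[int]_2).

(* Functions on the modular group are represented by functions on all integer
   matrices, constrained and evaluated on SL2Z only. *)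
Definition SL2Z gam : Prop := \det gam = 1.

(* The matrix (0, -1; 1, 0). *)
Definition matS : 'M[int]_2 := delta_mx 1 0 - delta_mx 0 1.

Definition autj gam tau : R[i] := (gam 1 0)%:~R * tau + (gam 1 1)%:~R.

Definition mobius gam tau : R[i] :=
  ((gam 0 0)%:~R * tau + (gam 0 1)%:~R) / autj gam tau.

Definition half_integer (k : R) : Prop := exists p : int, k = p%:~R / 2.

Definition multiplier_system (k : R) (chi : 'M[int]_2 -> R[i]) : Prop :=
  (forall gam, SL2Z gam -> normc (chi gam) = 1) /\
  (forall gam1 gam2 tau, SL2Z gam1 -> SL2Z gam2 -> upper tau ->
     chi (gam1 *m gam2) * cpow (autj (gam1 *m gam2) tau) k =
     chi gam1 * chi gam2 *
       cpow (autj gam1 (mobius gam2 tau)) k * cpow (autj gam2 tau) k).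

Definition unitary_representation (m : nat) (rho : 'M[int]_2 -> 'M[R[i]]_m) :
    Prop :=
  [/\ rho 1%:M = 1%:M,
      forall gam1 gam2, SL2Z gam1 -> SL2Z gam2 ->
        rho (gam1 *m gam2) = rho gam1 *m rho gam2 &
      forall gam, SL2Z gam -> rho gam \is unitarymx].

Variables (m : nat) (k : R) (chi : 'M[int]_2 -> R[i]).
Variables (rho : 'M[int]_2 -> 'M[R[i]]_m) (kappa : 'I_m -> R).
Implicit Types (f : R[i] -> 'cV[R[i]]_m) (cp cm : 'I_m -> int -> R[i]).
Implicit Types (phi : R -> R[i]) (j : 'I_m) (n : int).

Definition slash f gam tau : 'cV[R[i]]_m :=
  (cpow (autj gam tau) (- k) * (chi gam)^-1) *:
    (invmx (rho gam) *m f (mobius gam tau)).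

Definition freq j n : R := n%:~R + kappa j.

Definition negfreq j : pred int := fun n => freq j n < 0.

Definition qexp j n tau : R[i] :=
  cexp ((2 * pi * freq j n)%:C * 'i * tau).

Definition plus_term cp j tau n : R[i] := cp j n * qexp j n tau.

Definition minus_term cm j tau n : R[i] :=
  cm j n * (inc_gamma (1 - k) (- (4 * pi * freq j n * Im tau)))%:C
  * qexp j n tau.

Definition fourier_expansion f cp cm : Prop :=
  (exists n1 : int, forall j n, n < n1 -> cp j n = 0) /\
  (forall tau j, upper tau ->
     [/\ ccvg_sumZ xpredT (plus_term cp j tau),
         ccvg_sumZ (negfreq j) (minus_term cm j tau) &
         f tau j 0 = csumZ xpredT (plus_term cp j tau)
                     + csumZ (negfreq j) (minus_term cm j tau)]).

Definition harmonic_maass_form f : Prop :=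
  [/\ forall j, real_analytic (fun tau => f tau j 0),
      forall gam tau, SL2Z gam -> upper tau -> slash f gam tau = f tau,
      forall j tau, upper tau -> Delta k (fun t => f t j 0) tau = 0 &
      exists cp cm, fourier_expansion f cp cm].

Definition exp_growth f (n0 : nat) : Prop :=
  forall j, exists C V : R, forall tau, upper tau -> V <= Im tau ->
    normc (f tau j 0) <= C * expR (2 * pi * n0%:R * Im tau).

(* The integral over t > 0 of (L |g|)(- 2 pi (n + kappa_j) (2 t + 1)) /
   (1 + t) ^ k, resp. of the same expression with L g. *)
Definition nonhol_abs g j n : \bar R :=
  (\int[lebesgue_measure]_(t in @Rpos R)
     (laplace_abs g (- (2 * pi * freq j n * (2 * t + 1)))%R
      * (((1 + t) `^ k)^-1)%:E))%E.

Definition nonhol (g : R -> R[i]) j n : R[i] :=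
  cint (fun t => laplace g (- (2 * pi * freq j n * (2 * t + 1)))%:C
                 / ((1 + t) `^ k)%:C).

Definition test_space (n0 : nat) cp cm phi : Prop :=
  [/\ piecewise_smooth phi,
      forall s : R[i], - (2 * pi * n0%:R) <= Re s -> laplace_acvg phi s,
      forall s : R[i], 0 < Re s -> laplace_acvg (twist phi (2 - k)) s &
      forall j,
        (\esum_(n in [set: int])
           ((normc (cp j n))%:E * laplace_abs phi (2 * pi * freq j n)%R)
         + \esum_(n in [set n | negfreq j n])
           ((normc (cm j n) * (4 * pi * `|freq j n|) `^ (1 - k))%:E
            * nonhol_abs (twist phi (2 - k)) j n) < +oo)%E].

Definition Lseries cp cm phi : 'cV[R[i]]_m :=
  \col_j
    (csumZ xpredT (fun n => cp j n * laplace phi (2 * pi * freq j n)%:C)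
     + csumZ (negfreq j) (fun n =>
         cm j n * ((- (4 * pi * freq j n)) `^ (1 - k))%:C
         * nonhol (twist phi (2 - k)) j n)).

Definition test_space_delta (n0 : nat) cp cm phi : Prop :=
  [/\ piecewise_smooth phi,
      forall s : R[i], - (2 * pi * n0%:R) <= Re s -> laplace_acvg phi s,
      forall s : R[i], 0 < Re s -> laplace_acvg (twist phi (3 - k)) s &
      forall j,
        (\esum_(n in [set: int])
           ((normc (cp j n * (freq j n)%:C))%:E
            * laplace_abs (twist phi 2) (2 * pi * freq j n)%R)
         + \esum_(n in [set n | negfreq j n])
           ((normc (cm j n * (freq j n)%:C)
             * (4 * pi * `|freq j n|) `^ (1 - k))%:E
            * nonhol_abs (twist phi (3 - k)) j n) < +oo)%E].

Definition Lseries_delta cp cm phi : 'cV[R[i]]_m :=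
  (k / 2)%:C *: Lseries cp cm phi
  - (2 * pi)%:C *: \col_j
      csumZ xpredT (fun n =>
        cp j n * (freq j n)%:C
        * laplace (twist phi 2) (2 * pi * freq j n)%:C)
  - (2 * pi)%:C *: \col_j
      csumZ (negfreq j) (fun n =>
        cm j n * (freq j n)%:C * ((- (4 * pi * freq j n)) `^ (1 - k))%:C
        * nonhol (twist phi (3 - k)) j n).

Definition slashS phi : R -> R[i] :=
  fun x => (x `^ (k - 2))%:C * chi matS * phi x^-1.

End Modular.

(* Main.v *)
Require Import Defs.
From mathcomp Require Import all_boot all_order all_algebra.
From mathcomp Require Import complex.
From mathcomp Require Import all_classical all_reals all_analysis.
From mathcomp Require Import measurable_realfun ring lra zify.

(* On the imaginary axis the terms of f are real kernels times coefficients,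
   and Gamma(1 - k, w) = w ^ (1 - k) e ^ -w K(w), where K is the Laplace
   transform of (1 + t) ^ -k. By Fubini and dominated convergence L_f(phi) is
   therefore the integral of f(i y) phi(y) over y > 0, and likewise L_(delta f)
   is the integral of (delta_k f)(i y) phi(y), where y (d f / d u)(i y) is
   computed term by term. The theorem is the substitution y |-> 1 / y together
   with f(i / y) = chi(S) (i y) ^ k rho(S) f(i y) and the same relation, with a
   minus sign, for delta_k f. The latter comes from comparing the first order
   terms in s of f(- 1 / tau) = chi(S) tau ^ k rho(S) f(tau) along
   tau = y e ^ (i (pi / 2 + s)).

   The condition defining F_(delta f) does not mention the series L_f, which
   nevertheless occurs in L_(delta f). Its absolute convergence follows from
   n0 > 0: the Laplace transform of phi|S converges at - 2 pi n0, so phi decays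
   like e ^ (- 2 pi n0 / x) at 0 in the mean, while the Fourier coefficients
   grow more slowly than any e ^ (c n). *)

Set Implicit Arguments.
Unset Strict Implicit.
Unset Printing Implicit Defensive.

Import Order.TTheory GRing.Theory Num.Theory.
Import numFieldNormedType.Exports.
Import ComplexField.Normc.

Local Open Scope classical_set_scope.
Local Open Scope ring_scope.
Local Open Scope complex_scope.

Local Notation Re := complex.Re.
Local Notation Im := complex.Im.

(** * Complex-valued integrals *)

Section ComplexNumbers.
Variable R : realType.
Implicit Types (x y : R) (z w : R[i]).

(** The expansion of f converges as an ordinary series at each point, whereas the test spaces bound
    sums of absolute values. Interchanging sum and integral uses both: the expansion supplies the
    pointwise limit, the test condition an integrable majorant. Since 0 * +oo = 0 in the extended
    reals, a term with zero coefficient may carry a divergent Laplace transform; hence the case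
    splits on zero coefficients.

    For delta_k f the obstacle is that S does not preserve horizontal lines, along which the
    expansion is differentiated. On the arcs the horizontal displacement from i y is of first order
    in s and the vertical one of second order, so the derivative along the arc is - y times the
    derivative in u. Differentiating e ^ (i k s) produces a multiple of f, which the summand k / 2
    of delta_k balances.

    In the reduction of L_f to F_(delta f), the terms with |nu| y < 1 are compared with the weight e
    ^ (2 / y). For the minus terms one factor e ^ (1 / y) pays for the coefficient and for
    summability in n, the other for the kernel near 0. The weight is integrable against phi because
    2 pi n0 exceeds 3, where the extra 1 absorbs a power of y. *)

Lemma complexP z w : Re z = Re w -> Im z = Im w -> z = w.
Proof. by case: z w => [a b] [c d] /= -> ->. Qed.

Lemma creD z w : Re (z + w) = Re z + Re w.
Proof. by case: z; case: w. Qed.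

Lemma cimD z w : Im (z + w) = Im z + Im w.
Proof. by case: z; case: w. Qed.

Lemma creM z w : Re (z * w) = Re z * Re w - Im z * Im w.
Proof. by case: z; case: w. Qed.

Lemma cimM z w : Im (z * w) = Re z * Im w + Im z * Re w.
Proof. by case: z; case: w. Qed.

Lemma Re_realM x z : Re (x%:C * z) = x * Re z.
Proof. by rewrite creM /= mul0r subr0. Qed.

Lemma Im_realM x z : Im (x%:C * z) = x * Im z.
Proof. by rewrite cimM /= mul0r addr0. Qed.

Lemma creN z : Re (- z) = - Re z. Proof. by case: z. Qed.
Lemma cimN z : Im (- z) = - Im z. Proof. by case: z. Qed.

Lemma normc_sqrt z : normc z = Num.sqrt (Re z ^+ 2 + Im z ^+ 2).
Proof. by case: z. Qed.

Lemma normc_ge0 z : 0 <= normc z.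
Proof. by rewrite normc_sqrt sqrtr_ge0. Qed.

Lemma normc_real x : normc x%:C = `|x|.
Proof. by rewrite normc_sqrt /= expr0n addr0 sqrtr_sqr. Qed.

Lemma normc_sqr z : normc z ^+ 2 = Re z ^+ 2 + Im z ^+ 2.
Proof. by rewrite normc_sqrt sqr_sqrtr// addr_ge0// sqr_ge0. Qed.

Lemma normr_Re_le z : `|Re z| <= normc z.
Proof.
rewrite -(ler_pXn2r (n := 2)) ?nnegrE ?normc_ge0//.
by rewrite normc_sqr real_normK ?num_real// lerDl sqr_ge0.
Qed.

Lemma normr_Im_le z : `|Im z| <= normc z.
Proof.
rewrite -(ler_pXn2r (n := 2)) ?nnegrE ?normc_ge0//.
by rewrite normc_sqr real_normK ?num_real// lerDr sqr_ge0.
Qed.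

Lemma normc_le_ReIm z : normc z <= `|Re z| + `|Im z|.
Proof.
rewrite -(ler_pXn2r (n := 2)) ?nnegrE ?normc_ge0 ?addr_ge0//.
rewrite normc_sqr sqrrD !real_normK ?num_real//.
by rewrite addrAC lerDl mulrn_wge0// mulr_ge0.
Qed.

Lemma normc_triangle z w : normc (z + w) <= normc z + normc w.
Proof. exact: le_normcD. Qed.

Lemma normcB_triangle z w : normc (z - w) <= normc z + normc w.
Proof. by rewrite (le_trans (normc_triangle _ _))// normcN. Qed.

Lemma normc_sum_le (I : Type) (r : seq I) (P : pred I) (F : I -> R[i]) :
  normc (\sum_(i <- r | P i) F i) <= \sum_(i <- r | P i) normc (F i).
Proof.
elim/big_rec2: _ => [|i a b _ ba]; first by rewrite normc0.
by rewrite (le_trans (normc_triangle _ _))// lerD2l.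
Qed.

Lemma cexp_real x : cexp x%:C = (expR x)%:C.
Proof. by rewrite /cexp /= cos0 sin0 mulr1 mulr0. Qed.

Lemma cexpD z w : cexp (z + w) = cexp z * cexp w.
Proof.
rewrite /cexp creD cimD expRD cosD sinD.
by apply: complexP; rewrite ?creM ?cimM /=; ring.
Qed.

End ComplexNumbers.

Lemma nneseries_ge_term (R : realType) (u : nat -> \bar R) n :
  (forall k, (0 <= u k)%E) -> (u n <= \sum_(k <oo) u k)%E.
Proof.
move=> u0; apply: le_trans (nneseries_lim_ge n.+1 (fun k _ _ => u0 k)).
by rewrite big_nat_recr//= leeDr// sume_ge0.
Qed.

Section ComplexIntegral.
Variable R : realType.
Implicit Types (g h : R -> R[i]) (c : R[i]).
Local Notation mu := (@lebesgue_measure R).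
Local Notation Rpos := (@Rpos R).

Lemma measurable_Rpos : measurable Rpos.
Proof. exact: measurable_itv. Qed.
Hint Resolve measurable_Rpos : core.

Lemma Rpos_gt0 x : Rpos x -> 0 < x.
Proof. by rewrite /Rpos /= in_itv /= andbT. Qed.

Definition cmeasurable g :=
  measurable_fun Rpos (fun x => Re (g x)) /\
  measurable_fun Rpos (fun x => Im (g x)).

(** Extended-valued, so that norms of functions not yet known to be integrable can be summed and
    compared. *)
Definition cnorm1 g : \bar R := (\int[mu]_(x in Rpos) (normc (g x))%:E)%E.

Definition cintegrable g := cmeasurable g /\ (cnorm1 g < +oo)%E.

Lemma cmeasurable_ext g h :
  (forall x, 0 < x -> g x = h x) -> cmeasurable g -> cmeasurable h.
Proof.
by move=> gh [m1 m2]; split; [apply: eq_measurable_fun m1|apply: eq_measurable_fun m2];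
  move=> x /set_mem/Rpos_gt0 x0; rewrite gh.
Qed.

Lemma cmeasurableM g h : cmeasurable g -> cmeasurable h ->
  cmeasurable (fun x => g x * h x).
Proof.
move=> [g1 g2] [h1 h2]; split.
  under eq_fun do rewrite creM.
  by apply: measurable_funB; exact: measurable_funM.
under eq_fun do rewrite cimM.
by apply: measurable_funD; exact: measurable_funM.
Qed.

Lemma cmeasurableD g h : cmeasurable g -> cmeasurable h ->
  cmeasurable (fun x => g x + h x).
Proof.
move=> [g1 g2] [h1 h2]; split.
  by under eq_fun do rewrite creD; exact: measurable_funD.
by under eq_fun do rewrite cimD; exact: measurable_funD.
Qed.

Lemma cmeasurable_cst c : cmeasurable (fun=> c).
Proof. by split. Qed.

Lemma cmeasurable_real (f : R -> R) :
  measurable_fun Rpos f -> cmeasurable (fun x => (f x)%:C).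
Proof. by move=> mf; split => //=. Qed.

Lemma measurable_normc g : cmeasurable g ->
  measurable_fun Rpos (fun x => normc (g x)).
Proof.
move=> [g1 g2]; under eq_fun do rewrite normc_sqrt.
apply: (@measurableT_comp _ _ _ _ _ _ (@Num.sqrt R)).
  by apply: continuous_measurable_fun; exact: sqrt_continuous.
by apply: measurable_funD; exact: measurable_funX.
Qed.

Lemma measurable_EFin_normc g : cmeasurable g ->
  measurable_fun Rpos (fun x => (normc (g x))%:E).
Proof. by move=> mg; apply/measurable_EFinP; exact: measurable_normc. Qed.

Lemma cnorm1_ge0 g : (0 <= cnorm1 g)%E.
Proof. by apply: integral_ge0 => x _; rewrite lee_fin normc_ge0. Qed.

Lemma cnorm1_ext g h : (forall x, 0 < x -> g x = h x) -> cnorm1 g = cnorm1 h.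
Proof.
by move=> gh; apply: eq_integral => x /set_mem/Rpos_gt0 x0; rewrite gh.
Qed.

Lemma cintegrable_ext g h :
  (forall x, 0 < x -> g x = h x) -> cintegrable g -> cintegrable h.
Proof.
move=> gh [mg ig]; split; first exact: cmeasurable_ext mg.
by rewrite -(cnorm1_ext gh).
Qed.

Lemma cint_ext g h : (forall x, 0 < x -> g x = h x) -> cint g = cint h.
Proof.
move=> gh; rewrite /cint; congr (_ +i* _); apply: eq_Rintegral => x;
  by move=> /set_mem/Rpos_gt0 x0; rewrite gh.
Qed.

Lemma cintegrable_Re g : cintegrable g ->
  mu.-integrable Rpos (EFin \o (fun x => Re (g x))).
Proof.
move=> [[m1 m2] ig]; apply/integrableP; split; first exact/measurable_EFinP.
apply: le_lt_trans ig; apply: ge0_le_integral => //.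
- by apply/measurable_EFinP; exact: measurableT_comp.
- exact: measurable_EFin_normc.
- by move=> x _; rewrite lee_fin normr_Re_le.
Qed.

Lemma cintegrable_Im g : cintegrable g ->
  mu.-integrable Rpos (EFin \o (fun x => Im (g x))).
Proof.
move=> [[m1 m2] ig]; apply/integrableP; split; first exact/measurable_EFinP.
apply: le_lt_trans ig; apply: ge0_le_integral => //.
- by apply/measurable_EFinP; exact: measurableT_comp.
- exact: measurable_EFin_normc.
- by move=> x _; rewrite lee_fin normr_Im_le.
Qed.

Lemma cintegrableP g :
  mu.-integrable Rpos (EFin \o (fun x => Re (g x))) ->
  mu.-integrable Rpos (EFin \o (fun x => Im (g x))) -> cintegrable g.
Proof.
move=> i1 i2; have m1 := measurable_int _ i1; have m2 := measurable_int _ i2.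
have mg : cmeasurable g by split; exact/measurable_EFinP.
split => //.
have : mu.-integrable Rpos ((abse \o (EFin \o (fun x => Re (g x)))) \+
    (abse \o (EFin \o (fun x => Im (g x)))))%E.
  by apply: integrableD; [exact: measurable_Rpos|exact: integrable_abse..].
move=> /integrableP[_]; apply: le_lt_trans.
apply: ge0_le_integral => //.
- by move=> x _; rewrite lee_fin normc_ge0.
- exact: measurable_EFin_normc.
- apply: measurableT_comp => //; apply: emeasurable_funD; exact: measurableT_comp.
- move=> x _ /=; rewrite lee_fin (le_trans (normc_le_ReIm _))//.
  exact: ler_norm.
Qed.

Lemma cnorm1Z c g : cmeasurable g ->
  cnorm1 (fun x => c * g x) = ((normc c)%:E * cnorm1 g)%E.
Proof.
move=> mg; rewrite /cnorm1; under eq_integral do rewrite normcM EFinM.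
apply: ge0_integralZl_EFin => //; rewrite ?normc_ge0//.
- by move=> x _; rewrite lee_fin normc_ge0.
- exact: measurable_EFin_normc.
Qed.

Lemma cnorm1D g h : cmeasurable g -> cmeasurable h ->
  (cnorm1 (fun x => (g x + h x)%R) <= cnorm1 g + cnorm1 h)%E.
Proof.
move=> mg mh; rewrite /cnorm1 -ge0_integralD//; last 4 first.
- by move=> x _; rewrite lee_fin normc_ge0.
- exact: measurable_EFin_normc.
- by move=> x _; rewrite lee_fin normc_ge0.
- exact: measurable_EFin_normc.
apply: ge0_le_integral => //.
- by move=> x _; rewrite lee_fin normc_ge0.
- by apply: measurable_EFin_normc; exact: cmeasurableD.
- by apply: emeasurable_funD; exact: measurable_EFin_normc.
- by move=> x _; rewrite -EFinD lee_fin normc_triangle.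
Qed.

Lemma cintegrableZ c g : cintegrable g -> cintegrable (fun x => c * g x).
Proof.
move=> [mg ig]; split; first exact: cmeasurableM (cmeasurable_cst c) mg.
rewrite cnorm1Z// lte_mul_pinfty// ?lee_fin ?normc_ge0//.
Qed.

Lemma cintegrableD g h : cintegrable g -> cintegrable h ->
  cintegrable (fun x => g x + h x).
Proof.
move=> [mg ig] [mh ih]; split; first exact: cmeasurableD.
by rewrite (le_lt_trans (cnorm1D mg mh))// lte_add_pinfty.
Qed.

Lemma cintZ c g : cintegrable g -> cint (fun x => c * g x) = c * cint g.
Proof.
move=> ig; have i1 := cintegrable_Re ig; have i2 := cintegrable_Im ig.
have iM a (f : R -> R) : mu.-integrable Rpos (EFin \o f) ->
    mu.-integrable Rpos (EFin \o (fun x => a * f x)).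
  by move=> fi; apply: (integrableZl _ a fi); exact: measurable_Rpos.
apply: complexP; rewrite ?creM ?cimM /cint/=.
  under eq_Rintegral do rewrite creM.
  by rewrite RintegralB ?RintegralZl//; exact: iM.
under eq_Rintegral do rewrite cimM.
by rewrite RintegralD ?RintegralZl//; exact: iM.
Qed.

Lemma cintD g h : cintegrable g -> cintegrable h ->
  cint (fun x => g x + h x) = cint g + cint h.
Proof.
move=> ig ih; apply: complexP; rewrite ?creD ?cimD /cint/=.
  under eq_Rintegral do rewrite creD.
  by rewrite RintegralD//; exact: cintegrable_Re.
under eq_Rintegral do rewrite cimD.
by rewrite RintegralD//; exact: cintegrable_Im.
Qed.

Lemma cintegrable0 : cintegrable (fun=> 0).
Proof.
split; first exact: cmeasurable_cst.
by rewrite /cnorm1; under eq_integral do rewrite normc0; rewrite integral0.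
Qed.

Lemma cint0 : cint (fun=> 0 : R[i]) = 0.
Proof.
rewrite -[RHS](mul0r (cint (fun=> 0))) -(cintZ 0 cintegrable0).
by apply: cint_ext => x _; rewrite mul0r.
Qed.

Lemma cintegrable_sum (I : Type) (r : seq I) (F : I -> R -> R[i]) :
  (forall i, cintegrable (F i)) ->
  cintegrable (fun x => \sum_(i <- r) F i x) /\
  cint (fun x => \sum_(i <- r) F i x) = \sum_(i <- r) cint (F i).
Proof.
move=> iF; elim: r => [|i r [IH1 IH2]].
  rewrite big_nil; split.
    by apply: cintegrable_ext cintegrable0 => x _; rewrite big_nil.
  by rewrite -[RHS]cint0; apply: cint_ext => x _; rewrite big_nil.
have E x : 0 < x -> F i x + \sum_(j <- r) F j x = \sum_(j <- i :: r) F j x.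
  by rewrite big_cons.
split; first exact: cintegrable_ext E (cintegrableD (iF i) IH1).
by rewrite -(cint_ext E) cintD// IH2 big_cons.
Qed.

(** Dominated convergence with the sum of the norms as majorant, integrable by Tonelli. Convergence
    at every point is a separate hypothesis because summable norms give it only almost
    everywhere. *)
Lemma csum_cint (w : nat -> R -> R[i]) :
  (forall n, cmeasurable (w n)) ->
  (\sum_(n <oo) cnorm1 (w n) < +oo)%E ->
  (forall x, 0 < x -> ccvg_series (fun n => w n x)) ->
  cintegrable (fun x => csum (fun n => w n x)) /\
  csum (fun n => cint (w n)) = cint (fun x => csum (fun n => w n x)).
Proof.
move=> mw sw cw.
pose G x := (\sum_(n <oo) (normc (w n x))%:E)%E.
have mN n : measurable_fun Rpos (fun x => (normc (w n x))%:E).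
  exact: measurable_EFin_normc.
have N0 n x : (0 <= (normc (w n x))%:E)%E by rewrite lee_fin normc_ge0.
have iG : mu.-integrable Rpos G.
  apply/integrableP; split.
    by apply: ge0_emeasurable_sum => // k _; exact: mN.
  have -> : (\int[mu]_(x in Rpos) `|G x| = \int[mu]_(x in Rpos) G x)%E.
    by apply: eq_integral => x _; rewrite gee0_abs// nneseries_ge0.
  rewrite /G integral_nneseries//; exact: measurable_Rpos.
have wi n : cintegrable (w n).
  split => //; rewrite (le_lt_trans _ sw)//.
  by apply: (@nneseries_ge_term R (fun n => cnorm1 (w n))) => k; exact: cnorm1_ge0.
(* One real argument, with [P] standing for the real or the imaginary part. *)
have key (P : R[i] -> R) : (P = @Re R \/ P = @Im R) ->
  mu.-integrable Rpos (EFin \o (fun x => limn (series (fun n => P (w n x))))) /\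
  (series (fun n => \int[mu]_(x in Rpos) P (w n x)) @ \oo -->
    \int[mu]_(x in Rpos) limn (series (fun n => P (w n x))))%R.
  move=> PE.
  have Pn z : `|P z| <= normc z.
    by case: PE => ->; [exact: normr_Re_le|exact: normr_Im_le].
  have Pi n : mu.-integrable Rpos (EFin \o (fun x => P (w n x))).
    by case: PE => ->; [exact: cintegrable_Re|exact: cintegrable_Im].
  have Pm n : measurable_fun Rpos (fun x => P (w n x)).
    by have /measurable_EFinP := measurable_int _ (Pi n).
  have Pc x : Rpos x -> cvgn (series (fun n => P (w n x))).
    by move=> /Rpos_gt0/cw[]; case: PE => ->.
  have Sm n : measurable_fun Rpos (fun x => series (fun n => P (w n x)) n).
    under eq_fun do rewrite seriesEord/=.
    exact: measurable_sum.
  have Lm : measurable_fun Rpos (fun x => limn (series (fun n => P (w n x)))).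
    by apply: (measurable_fun_cvg Sm) => x /Pc.
  have SE n : EFin \o (fun x => series (fun n0 => P (w n0 x)) n) =
      (fun x => \sum_(i < n) (P (w i x))%:E)%E.
    by apply/funext => x /=; rewrite seriesEord/= sumEFin.
  have [|||||ok _ cv] := @dominated_convergence _ _ R mu Rpos (measurable_itv _)
    (fun n => EFin \o (fun x => series (fun n => P (w n x)) n))
    (EFin \o (fun x => limn (series (fun n => P (w n x))))) G.
  - by move=> n; apply/measurable_EFinP; exact: Sm.
  - by apply/measurable_EFinP; exact: Lm.
  - apply: aeW => x Dx; apply: cvg_EFin; first exact: nearW.
    exact: Pc.
  - exact: iG.
  - apply: aeW => x n Dx /=.
    rewrite seriesEord/= (le_trans (y := (\sum_(0 <= i < n) (normc (w i x))%:E)%E))//.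
      rewrite sumEFin lee_fin big_mkord (le_trans (ler_norm_sum _ _ _))//.
      by apply: ler_sum.
    exact: nneseries_lim_ge.
  - split => //.
    have /fine_cvgP[_] :
      (fun n => \int[mu]_(x in Rpos) (series (fun n => P (w n x)) n)%:E)%E @ \oo -->
      (fine (\int[mu]_(x in Rpos) (limn (series (fun n => P (w n x))))%:E)%E)%:E.
      by rewrite fineK//; exact: integrable_fin_num ok.
    apply: cvg_trans; apply: near_eq_cvg; apply: nearW => n /=.
    have -> : (\int[mu]_(x in Rpos) (series (fun n => P (w n x)) n)%:E)%E =
       (\int[mu]_(x in Rpos) (\sum_(i < n) (P (w i x))%:E))%E.
      by apply: eq_integral => x _; rewrite -(congr1 (fun f => f x) (SE n)).
    have -> : (\int[mu]_(x in Rpos) (\sum_(i < n) (P (w i x))%:E) =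
        \sum_(i < n) \int[mu]_(x in Rpos) (P (w i x))%:E)%E.
      apply: (@integral_sum _ _ _ mu); first exact: measurable_Rpos.
      by move=> i; exact: Pi.
    rewrite -EFin_sum_fine; first by rewrite seriesEord.
    by move=> i _; apply: integrable_fin_num (Pi i); exact: measurable_Rpos.
have [i1 c1] := key _ (or_introl erefl); have [i2 c2] := key _ (or_intror erefl).
split; first exact: cintegrableP.
by rewrite /csum /cint; congr (_ +i* _); exact/cvg_lim.
Qed.

End ComplexIntegral.

(** * The substitution of 1 / x for x *)

Section Inversion.
Variable R : realType.
Local Notation mu := (@lebesgue_measure R).
Local Notation Rpos := (@Rpos R).
Local Notation TR := (measurableTypeR R).

(* The density 1 / x ^ 2 is realised as the length of the sections of this
   set, so that its image under x ^-1 is a plain push-forward of a product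
   measure. *)
Definition inv_region : set (TR * TR) :=
  [set p : R * R | [&& 0 < p.1, 0 < p.2 & p.2 * p.1 ^+ 2 < 1]].

(** Off [inv_region] the value is 0, which lies outside [Rpos], so the preimage of [Rpos] is exactly
    the region. The real power ^ (-1) makes the map measurable on the whole plane. *)
Definition inv_map (p : TR * TR) : TR := (p.1 : R) `^ (-1) * \1_inv_region p.

Lemma measurable_inv_region : measurable inv_region.
Proof.
have m2 : measurable_fun [set: TR * TR]
    (fun p : R * R => p.2 * p.1 ^+ 2).
  by apply: measurable_funM => //; exact: measurable_funX.
have : measurable_fun [set: TR * TR]
    (fun p : R * R => [&& 0 < p.1, 0 < p.2 & p.2 * p.1 ^+ 2 < 1]).
  apply: measurable_and; first exact: measurable_fun_ltr.
  by apply: measurable_and; exact: measurable_fun_ltr.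
move=> /(_ measurableT [set true] I); rewrite setTI.
by congr (measurable _); apply/seteqP; split.
Qed.

Lemma measurable_inv_map :
  measurable_fun setT inv_map.
Proof.
apply: measurable_funM.
  by apply: (@measurableT_comp _ _ _ _ _ _ (@powR R ^~ (-1))) => //;
    exact: measurable_powR.
by apply: measurable_indic; exact: measurable_inv_region.
Qed.

Local Notation m := (measure_function_pushforward__canonical__measure_function_Measure
  (mu \x mu)%E measurable_inv_map).

Lemma inv_map_in (p : R * R) : inv_region p -> inv_map p = p.1^-1.
Proof.
move=> pE; rewrite /inv_map indicE mem_set// mulr1 powR_inv1//.
by case/and3P : pE => /ltW.
Qed.

Lemma preimage_inv_map : inv_map @^-1` Rpos = inv_region.
Proof.
apply/seteqP; split => /= p.
  rewrite /Rpos/= in_itv/= andbT /inv_map indicE.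
  by case: (boolP (p \in inv_region)) => [/set_mem//|]; rewrite mulr0 ltxx.
move=> pE; change (Rpos (inv_map p)).
rewrite inv_map_in// /Rpos/= in_itv/= andbT invr_gt0.
by case/and3P : pE.
Qed.

(** Change of variables for the push-forward, then Tonelli: the section of [inv_region] at x > 0 is
    ]0, x ^ -2[, on which the integrand is constant. *)
Lemma integral_inv_measure (f : R -> \bar R) : measurable_fun Rpos f ->
  (forall x, 0 < x -> (0 <= f x)%E) ->
  (\int[m]_(x in Rpos) f x =
   \int[mu]_(x in Rpos) (f (x^-1)%R * ((x ^- 2)%R)%:E))%E.
Proof.
move=> mf f0.
transitivity (\int[mu \x mu]_(p in inv_map @^-1` Rpos) (f \o inv_map) p)%E.
  have mP : measurable (Rpos : set (measurableTypeR R)) by exact: measurable_itv.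
  have f0' : {in (Rpos : set (measurableTypeR R)), forall x, 0 <= f x}%E.
    by move=> x /set_mem/Rpos_gt0/f0.
  exact: (@ge0_integral_pushforward _ _ _ (measurableTypeR R) R inv_map
    measurable_inv_map (mu \x mu)%E Rpos f mP mf f0').
rewrite preimage_inv_map integral_mkcond.
have g0 p : (0 <= ((f \o inv_map) \_ inv_region) p)%E.
  rewrite /patch; case: ifPn => // /set_mem pE; apply: f0.
  by rewrite inv_map_in// invr_gt0; case/and3P : pE.
have mg : measurable_fun setT ((f \o inv_map) \_ inv_region).
  apply/(measurable_restrictT _ measurable_inv_region).
  apply: (measurable_comp (F := Rpos)) => //.
  - exact: measurable_Rpos.
  - by move=> _ [p pE <-]; rewrite -[Rpos _]/((inv_map @^-1` Rpos) p) preimage_inv_map.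
  - exact: measurable_funS measurable_inv_map.
rewrite fubini_tonelli1// [RHS]integral_mkcond.
apply: eq_integral => x _; rewrite /fubini_F {2}/patch.
case: ifPn => [/set_mem/Rpos_gt0 x0|xn].
  transitivity (\int[mu]_(z in `]0%R, (x ^- 2)%R[) f (x^-1)%R)%E.
    rewrite [RHS]integral_mkcond; apply: eq_integral => z _; rewrite /patch.
    have xz : ((x, z) \in inv_region) = (z \in `]0, (x ^- 2)[%classic).
      apply/idP/idP => [/set_mem/and3P[/= _ z0 zx]|/set_mem].
        rewrite inE/= in_itv/= z0/= -(ltr_pM2r (x := x ^+ 2)) ?exprn_gt0//.
        by rewrite mulVf// gt_eqF// exprn_gt0.
      rewrite /= in_itv/= => /andP[z0 zx]; rewrite inE.
      apply/and3P; split => //=.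
      move: zx; rewrite -(ltr_pM2r (x := x ^+ 2)) ?exprn_gt0//.
      by rewrite mulVf// gt_eqF// exprn_gt0.
    rewrite xz; case: ifPn => // zi.
    by rewrite /comp inv_map_in//; apply/set_mem; rewrite xz.
  rewrite integral_cst//= lebesgue_measure_itv/= lte_fin invr_gt0 exprn_gt0//.
  by rewrite oppr0 adde0.
apply: integral0_eq => z _; rewrite /patch; case: ifPn => // /set_mem/and3P[/= x0 _ _].
by move: xn; rewrite notin_setE /Rpos/= in_itv/= x0.
Qed.

(** By the preceding formula this is the integral of x ^ -2 over [1 / b, +oo[, with antiderivative -
    1 / x. *)
Lemma inv_measure_0c (b : R) : 0 < b -> m `]0, b]%classic = b%:E.
Proof.
move=> b0.
have -> : m `]0, b]%classic = (\int[m]_(x in Rpos) (\1_(`]0, b]%classic : set R) x)%:E)%E.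
  rewrite integral_indic//; last exact: measurable_Rpos.
  congr (m _); apply/seteqP; split => x /=; rewrite /Rpos/= !in_itv/= ?andbT.
    by move=> /andP[x0 xb]; rewrite x0 xb.
  by move=> [/andP[-> ->]].
rewrite integral_inv_measure//; last first.
  by apply/measurable_EFinP; exact: measurable_indic.
have -> : (\int[mu]_(x in Rpos)
    ((\1_(`]0%R, b]%classic : set R) (x^-1)%R)%:E * ((x ^- 2)%R)%:E) =
  \int[mu]_(x in `[(b^-1)%R, +oo[) ((x ^- 2)%R)%:E)%E.
  rewrite integral_mkcond [RHS]integral_mkcond.
  apply: eq_integral => x _; rewrite /patch.
  case: ifPn => [/set_mem/Rpos_gt0 x0|].
    rewrite indicE; case: (boolP (x \in `[b^-1, +oo[)) => xb.
      rewrite mem_set/= ?mem_set/= ?mul1e//; last first.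
      rewrite in_itv/= invr_gt0 x0/= invf_ple// ?posrE//.
      by move: xb; rewrite in_itv/= andbT.
    rewrite memNset ?memNset ?mul0e//=.
      by rewrite (negbTE xb).
    rewrite in_itv/= invr_gt0 x0/= invf_ple// ?posrE//.
    by move: xb; rewrite in_itv/= andbT => /negP.
  move=> xn; rewrite memNset//= in_itv/= andbT => bx.
  by move: xn; rewrite notin_setE /Rpos/= in_itv/= andbT (lt_le_trans _ bx)// invr_gt0.
rewrite (@ge0_continuous_FTC2y R _ (fun x => - x^-1) _ 0).
- by rewrite invrK -EFinB sub0r opprK.
- by move=> x bx; rewrite invr_ge0 sqr_ge0.
- apply: continuous_in_subspaceT => x.
  rewrite inE/= in_itv/= andbT => bx.
  have x0 : x != 0 by rewrite gt_eqF// (lt_le_trans _ bx)// invr_gt0.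
  apply: cvgV; first by rewrite expf_neq0.
  exact: exprn_continuous.
- rewrite -oppr0; apply: cvgN.
  by apply/gtr0_cvgV0; [exact: nbhs_pinfty_gt|exact: cvg_id].
- move=> x bx; apply: derivableN; apply: derivableV => //.
  by rewrite gt_eqF// (lt_trans _ bx)// invr_gt0.
- apply: cvg_at_right_filter; apply: cvgN; apply: cvgV => //.
  by rewrite gt_eqF// invr_gt0.
- move=> x; rewrite in_itv/= andbT => bx.
  have x0 : x != 0 by rewrite gt_eqF// (lt_trans _ bx)// invr_gt0.
  rewrite derive1E deriveN ?deriveV//; last exact: derivableV.
  by rewrite derive_id /GRing.scale/= mulr1 opprK.
Qed.

(** Uniqueness of Lebesgue measure concerns the whole line, so the push-forward on [Rpos] is glued
    to Lebesgue measure on ]-oo, 0] and compared on the intervals ]a, b]. For 0 < a, the value on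
    ]a, b] is a difference of values on ]0, b] and ]0, a]. *)
Lemma lebesgue_inv_measure (A : set (measurableTypeR R)) :
  measurable A -> A `<=` Rpos -> mu A = m A.
Proof.
move=> mA AR.
have mN : measurable (`]-oo, 0]%classic : set (measurableTypeR R)).
  exact: measurable_itv.
have mP : measurable (Rpos : set (measurableTypeR R)) by exact: measurable_itv.
suff h : forall X, ocitv X ->
    mu X = measure_add (mrestr m mP) (mrestr mu mN) X.
  have -> : mu A = (m (A `&` Rpos) + mu (A `&` `]-oo, 0%R]))%E.
    rewrite -[RHS](measure_addE (mrestr m mP) (mrestr mu mN)).
    exact: lebesgue_measure_unique.
  have -> : A `&` `]-oo, 0] = set0.
    apply/seteqP; split => // x [/AR/Rpos_gt0 x0]/=.
    by rewrite in_itv/= leNgt x0.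
  by rewrite measure0 adde0 (setIidl AR).
move=> X /ocitvP[->|[[a b] /= ab ->]]; first by rewrite !measure0.
rewrite measure_addE.
change (mu `]a, b] = m (`]a, b] `&` Rpos) + mu (`]a, b] `&` `]-oo, 0%R]))%E.
have [b0|b0] := leP b 0.
  have -> : `]a, b] `&` Rpos = set0.
    apply/seteqP; split => // x [/=]; rewrite in_itv/= => /andP[_ xb] /Rpos_gt0.
    by rewrite ltNge (le_trans xb).
  rewrite measure0 add0e; congr (mu _); rewrite setIidl// => x/=.
  by rewrite !in_itv/= => /andP[_ /le_trans]; exact.
have [a0|a0] := leP 0 a.
  have -> : `]a, b] `&` `]-oo, 0] = set0.
    apply/seteqP; split => // x [/=]; rewrite !in_itv/= => /andP[ax _].
    by rewrite leNgt (le_lt_trans a0).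
  rewrite measure0 adde0 setIidl; last first.
    by move=> x/=; rewrite /Rpos/= !in_itv/= andbT => /andP[/(le_lt_trans a0)].
  rewrite lebesgue_measure_itv/= lte_fin ab.
  have [a0'|a0'] := eqVneq a 0.
    by rewrite a0' oppr0 adde0 inv_measure_0c.
  have {a0 a0'} a0 : 0 < a by rewrite lt_neqAle eq_sym a0'.
  have -> : b%:E = m (`]0%R, a] `|` `]a, b]).
    rewrite -itv_bndbnd_setU ?bnd_simp ?ltW//.
    by rewrite inv_measure_0c.
  rewrite measureU//=.
    by rewrite inv_measure_0c// addeAC -EFinB subrr add0e.
  apply/seteqP; split => // x [/=]; rewrite !in_itv/= => /andP[_ xa] /andP[].
  by rewrite ltNge xa.
have -> : `]a, b] `&` Rpos = `]0, b]%classic.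
  apply/seteqP; split => x/=; rewrite /Rpos/= !in_itv/= ?andbT.
    by move=> [/andP[_ ->] ->].
  by move=> /andP[x0 ->]; rewrite x0 (lt_trans a0).
have -> : `]a, b] `&` `]-oo, 0] = `]a, 0]%classic.
  apply/seteqP; split => x/=; rewrite /Rpos/= !in_itv/= ?andbT.
    by move=> [/andP[-> _] ->].
  by move=> /andP[-> x0]; rewrite x0 (le_trans x0)// ltW.
rewrite inv_measure_0c// !lebesgue_measure_itv/= !lte_fin ab a0.
by rewrite add0e.
Qed.

Lemma integral_Rpos_inv (f : R -> \bar R) : measurable_fun Rpos f ->
  (forall x, 0 < x -> (0 <= f x)%E) ->
  (\int[mu]_(x in Rpos) f x =
   \int[mu]_(x in Rpos) (f (x^-1)%R * ((x ^- 2)%R)%:E))%E.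
Proof.
move=> mf f0; rewrite -integral_inv_measure//.
by apply: eq_measure_integral => A mA AR; exact: lebesgue_inv_measure.
Qed.

End Inversion.

(** * Fubini and Tonelli on the positive quadrant *)

Section Exchange.
Variable R : realType.
Local Notation mu := (@lebesgue_measure R).
Local Notation Rpos := (@Rpos R).
Local Notation TR := (measurableTypeR R).

(** Covers non-integrable [f], since [fine] sends infinite values to 0. This matters in [nonholE],
    where the inner Laplace transform is rescaled at every t although Fubini controls it only for
    almost every t. *)
Lemma RintegralZl_ge0 (f : R -> R) (c : R) : measurable_fun Rpos f -> 0 <= c ->
  \int[mu]_(x in Rpos) (c * f x) = c * \int[mu]_(x in Rpos) f x.
Proof.
move=> mf c0; rewrite /Rintegral.
have E1 : (\int[mu]_(x in Rpos) (c * f x)%:E)%E =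
    (c%:E * \int[mu]_(x in Rpos) ((EFin \o f)^\+ x) -
     c%:E * \int[mu]_(x in Rpos) ((EFin \o f)^\- x))%E.
  rewrite integralE -!ge0_integralZl_EFin//; last 4 first.
  - exact: measurable_Rpos.
  - by apply: measurable_funeneg; exact/measurable_EFinP.
  - exact: measurable_Rpos.
  - by apply: measurable_funepos; exact/measurable_EFinP.
  congr (_ - _)%E; apply: eq_integral => x _.
    rewrite (_ : (fun x => (c * f x)%:E) = (fun x => c%:E * (EFin \o f) x)%E)//.
    by rewrite ge0_funeposM.
  rewrite (_ : (fun x => (c * f x)%:E) = (fun x => c%:E * (EFin \o f) x)%E)//.
  by rewrite ge0_funenegM.
rewrite E1 [X in c * fine X]integralE.
have : (0 <= \int[mu]_(x in Rpos) ((EFin \o f)^\+ x))%E by exact: integral_ge0.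
have : (0 <= \int[mu]_(x in Rpos) ((EFin \o f)^\- x))%E by exact: integral_ge0.
move: (integral _ _ _) (integral _ _ _) => A B.
have [->|cn] := eqVneq c 0; first by rewrite !mul0e sube0 mul0r.
have {cn} c1 : (0 < c%:E)%E by rewrite lte_fin lt_neqAle eq_sym cn.
case: A => [a| |]; case: B => [b| |] //= _ _; rewrite ?gt0_mulye ?gt0_muley//=.
- by rewrite mulrBr.
- by rewrite mulr0.
- by rewrite mulr0.
- by rewrite mulr0.
Qed.

Variable q : R -> R -> R.
Hypothesis mq : measurable_fun ((Rpos : set TR) `*` (Rpos : set TR))
  (fun p : TR * TR => q p.1 p.2).

Let f : TR * TR -> \bar R :=
  (fun p : TR * TR => (q p.1 p.2)%:E) \_ ((Rpos : set TR) `*` (Rpos : set TR)).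

Let mP : measurable (Rpos : set TR).
Proof. exact: measurable_itv. Qed.

Let mf : measurable_fun setT f.
Proof.
apply/(measurable_restrictT _ (measurableX mP mP)).
by apply/measurable_EFinP; exact: mq.
Qed.

Let fE t y : f (t, y) = if (t \in Rpos) && (y \in Rpos) then (q t y)%:E else 0%E.
Proof. by rewrite /f /patch in_setX. Qed.

Let int1 (g : \bar R -> \bar R) t : g 0%E = 0%E -> (\int[mu]_y (g (f (t, y))))%E =
  if t \in Rpos then (\int[mu]_(y in Rpos) g (q t y)%:E)%E else 0%E.
Proof.
move=> g0; case: ifPn => tR.
  rewrite [RHS]integral_mkcond; apply: eq_integral => y _.
  by rewrite fE tR /patch/=; case: ifPn.
by apply: integral0_eq => y _; rewrite fE (negbTE tR).
Qed.

Let int2 (g : \bar R -> \bar R) y : g 0%E = 0%E -> (\int[mu]_t (g (f (t, y))))%E =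
  if y \in Rpos then (\int[mu]_(t in Rpos) g (q t y)%:E)%E else 0%E.
Proof.
move=> g0; case: ifPn => tR.
  rewrite [RHS]integral_mkcond; apply: eq_integral => t _.
  by rewrite fE tR /patch/= andbT; case: ifPn.
by apply: integral0_eq => t _; rewrite fE (negbTE tR) andbF.
Qed.

Lemma integral_exchange : (forall t y, 0 < t -> 0 < y -> 0 <= q t y) ->
  (\int[mu]_(t in Rpos) \int[mu]_(y in Rpos) (q t y)%:E =
   \int[mu]_(y in Rpos) \int[mu]_(t in Rpos) (q t y)%:E)%E.
Proof.
move=> q0.
have f0 p : (0 <= f p)%E.
  case: p => t y; rewrite fE; case: ifPn => // /andP[/set_mem/Rpos_gt0 t0].
  by move=> /set_mem/Rpos_gt0 y0; rewrite lee_fin q0.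
have := @fubini_tonelli _ _ _ _ _ mu mu f mf f0.
under eq_integral do rewrite (int1 (g := id))//.
under [in RHS]eq_integral do rewrite (int2 (g := id))//.
by rewrite -!integral_mkcond.
Qed.

Lemma measurable_integral_param : (forall t y, 0 < t -> 0 < y -> 0 <= q t y) ->
  measurable_fun Rpos (fun y => \int[mu]_(t in Rpos) (q t y)%:E)%E.
Proof.
move=> q0.
have f0 p : (0 <= f p)%E.
  case: p => t y; rewrite fE; case: ifPn => // /andP[/set_mem/Rpos_gt0 t0].
  by move=> /set_mem/Rpos_gt0 y0; rewrite lee_fin q0.
apply/(measurable_restrictT _ mP).
have := @measurable_fun_fubini_tonelli_G _ _ _ _ R mu f mf f0.
by congr (measurable_fun _ _); apply/funext => y; rewrite /fubini_G (int2 (g := id)).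
Qed.

Lemma Rintegral_exchange :
  (\int[mu]_(y in Rpos) \int[mu]_(t in Rpos) (`|q t y|)%:E < +oo)%E ->
  \int[mu]_(t in Rpos) \int[mu]_(y in Rpos) q t y =
  \int[mu]_(y in Rpos) \int[mu]_(t in Rpos) q t y.
Proof.
move=> qfin.
have fi : ((mu \x mu)%E).-integrable setT f.
  apply/integrable21ltyP => //.
  under eq_integral do rewrite (int2 (g := abse)) ?abse0//.
  by rewrite -integral_mkcond.
(* [fine] changes the inner integral only where it is infinite, which by integrability is a null
   set. *)
have aux (F : R -> \bar R) : mu.-integrable setT (F \_ Rpos) ->
    \int[mu]_(t in Rpos) fine (F t) = fine (\int[mu]_t (F \_ Rpos) t)%E.
  move=> Fi; rewrite -integral_mkcond /Rintegral; congr fine.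
  have Fi' : mu.-integrable Rpos F.
    by apply/integrable_mkcond => //; exact: measurable_Rpos.
  have mF := measurable_int _ Fi'.
  apply: ae_eq_integral => //.
  - by apply/measurable_EFinP; apply: measurableT_comp.
  - have := integrable_ae mP Fi'.
    by apply: filterS => t ft /ft tf; rewrite fineK.
have e1 : fubini_F mu f = (fun t => \int[mu]_(y in Rpos) (q t y)%:E)%E \_ Rpos.
  by apply/funext => t; rewrite /fubini_F (int1 (g := id)).
have e2 : fubini_G mu f = (fun y => \int[mu]_(t in Rpos) (q t y)%:E)%E \_ Rpos.
  by apply/funext => t; rewrite /fubini_G (int2 (g := id)).
have mfa : measurable_fun setT (abse \o f) by exact: measurableT_comp.
have i1 := integrable_fubini_F fi.
have mG : measurable_fun setT (fubini_G mu f) := measurable_fubini_G fi.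
have i2 : mu.-integrable setT (fubini_G mu f).
  apply/integrableP; split => //.
  have /integrable21ltyP := fi; move=> /(_ mf); apply: le_lt_trans.
  apply: ge0_le_integral => //.
  - exact: measurableT_comp.
  - exact: (@measurable_fun_fubini_tonelli_G _ _ _ _ R mu (abse \o f) mfa
      (fun p => abse_ge0 _)).
  - move=> y _; apply: le_abse_integral => //.
    exact: measurableT_comp.
rewrite e1 in i1; rewrite e2 in i2.
have := Fubini fi.
rewrite -/(fubini_F mu f) -/(fubini_G mu f) => FG.
rewrite [LHS](aux (fun t => \int[mu]_(y in Rpos) (q t y)%:E)%E)//.
rewrite [RHS](aux (fun y => \int[mu]_(t in Rpos) (q t y)%:E)%E)//.
by rewrite -e1 -e2 FG.
Qed.

End Exchange.

(** * Inversion in complex-valued integrals *)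

Section ComplexInversion.
Variable R : realType.
Implicit Types (g : R -> R[i]).
Local Notation mu := (@lebesgue_measure R).
Local Notation Rpos := (@Rpos R).

Lemma measurable_inv_Rpos : measurable_fun Rpos (fun x : R => x^-1).
Proof.
apply: (@eq_measurable_fun _ _ _ _ _ (fun x : R => x `^ (-1))).
  by move=> x /set_mem/Rpos_gt0 x0; rewrite powR_inv1// ltW.
by apply: measurable_funS (@measurable_powR R (-1)).
Qed.

Lemma Rintegral_inv (f : R -> R) : measurable_fun Rpos f ->
  \int[mu]_(x in Rpos) f x = \int[mu]_(x in Rpos) (x ^- 2 * f x^-1).
Proof.
move=> mf; rewrite /Rintegral; congr fine; rewrite integralE [RHS]integralE.
have mF : measurable_fun Rpos (EFin \o f) by exact/measurable_EFinP.
rewrite integral_Rpos_inv//; last exact: measurable_funepos.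
rewrite [X in (_ - X)%E = _]integral_Rpos_inv//; last exact: measurable_funeneg.
have h (x : R) : 0 <= x ^- 2 by rewrite invr_ge0 sqr_ge0.
congr (_ - _)%E; apply: eq_integral => x _.
  by rewrite !funeposE/= muleC maxe_pMr ?mule0 -?EFinM// lee_fin.
by rewrite !funenegE/= muleC maxe_pMr ?mule0 -?EFinM ?mulrN// lee_fin.
Qed.

Lemma cnorm1_inv g : cmeasurable g ->
  cnorm1 g = cnorm1 (fun x => (x ^- 2)%:C * g x^-1).
Proof.
move=> mg; rewrite /cnorm1 integral_Rpos_inv//; last 2 first.
- exact: measurable_EFin_normc.
- by move=> x _; rewrite lee_fin normc_ge0.
apply: eq_integral => x _; rewrite normcM normc_real EFinM muleC.
by rewrite ger0_norm// invr_ge0 sqr_ge0.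
Qed.

Lemma cint_inv g : cmeasurable g ->
  cint g = cint (fun x => (x ^- 2)%:C * g x^-1).
Proof.
move=> [m1 m2]; rewrite /cint (Rintegral_inv m1) (Rintegral_inv m2).
congr (_ +i* _); apply: eq_Rintegral => x _; apply/esym.
  exact: Re_realM.
exact: Im_realM.
Qed.

End ComplexInversion.

Section ExponentialIntegral.
Variable R : realType.
Local Notation mu := (@lebesgue_measure R).
Local Notation Rpos := (@Rpos R).

Lemma measurable_expRM (c : R) (D : set R) : measurable_fun D (fun x => expR (c * x)).
Proof.
apply: measurable_funS (measurableT) (@subsetT _ D) _.
by apply: measurableT_comp => //; exact: mulrl_measurable.
Qed.

Lemma integral_expR (c : R) : 0 < c ->
  (\int[mu]_(t in Rpos) (expR (- c * t))%:E = (c^-1)%:E)%E.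
Proof.
move=> c0; rewrite /Rpos integral_itv_obnd_cbnd; last first.
  by apply/measurable_EFinP; exact: measurable_expRM.
rewrite (@ge0_continuous_FTC2y R _ (fun x => - c^-1 * expR (- c * x)) _ 0).
- by rewrite mulr0 expR0 mulr1 -EFinB sub0r opprK.
- by move=> x _; exact: expR_ge0.
- apply: continuous_subspaceT => x; apply: continuous_comp; last exact: continuous_expR.
  exact: mulrl_continuous.
- rewrite -[X in _ --> X](mulr0 (- c^-1)); apply: cvgMr.
  have : (fun x => c * x) @ +oo%R --> +oo%R.
    exact: gt0_cvgMry.
  move=> h; have := cvg_comp _ _ h (@cvgr_expR R).
  by apply: cvg_trans; apply: near_eq_cvg; apply: nearW => x /=; rewrite mulNr.
- by move=> x _; apply: derivableM => //; apply: ex_derive.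
- apply: cvg_at_right_filter; apply: cvgMr.
  apply: continuous_comp; last exact: continuous_expR.
  exact: mulrl_continuous.
- move=> x _; rewrite derive1Ml; last exact: ex_derive.
  rewrite derive1_comp// derive1E; have /funeqP -> := @derive_expR R.
  rewrite derive1Ml// derive1_id mulr1.
  by rewrite mulrCA mulrNN mulVf ?mulr1// gt_eqF.
Qed.

End ExponentialIntegral.

(** * The incomplete Gamma function *)

Section Kernel.
Variables (R : realType) (k : R).
Local Notation mu := (@lebesgue_measure R).
Local Notation Rpos := (@Rpos R).
Local Notation TR := (measurableTypeR R).

Lemma expr_le_expR n (y : R) : 0 <= y -> y ^+ n.+1 <= (n.+1)`!%:R * expR y.
Proof.
move=> y0; have f0 : 0 < (n.+1)`!%:R :> R by rewrite ltr0n fact_gt0.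
rewrite mulrC -ler_pdivrMr// (le_trans _ (expR_ge1Dxn n y0))//.
by rewrite lerDr.
Qed.

Lemma powR_le_expr (a : R) : exists n, forall y, 1 <= y -> y `^ a <= y ^+ n.+1.
Proof.
exists (Num.bound `|a|) => y y1.
rewrite -powR_mulrn ?(le_trans ler01)//; apply: ler_powR => //.
rewrite (le_trans (ler_norm _))// ltW// (lt_le_trans (archi_boundP _))//.
by rewrite ler_nat.
Qed.

Definition gker (w t : R) : R := expR (- w * t) * ((1 + t) `^ k)^-1.

(** This is e ^ w E_k(w), with E_k the generalised exponential integral; equivalently Tricomi's U(1,
    2 - k, w). *)
Definition Kfun (w : R) : R := \int[mu]_(t in Rpos) gker w t.

Lemma gker_ge0 w t : 0 <= gker w t.
Proof. by rewrite mulr_ge0 ?expR_ge0// invr_ge0 powR_ge0. Qed.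

Lemma measurable_1DpowR (a : R) (D : set R) :
  measurable_fun D (fun t => (1 + t) `^ a).
Proof.
apply: measurable_funS (measurableT) (@subsetT _ D) _.
apply: (@measurableT_comp _ _ _ _ _ _ (@powR R ^~ a)).
  exact: measurable_powR.
exact: measurable_funD.
Qed.

Lemma measurable_gker w D : measurable_fun D (gker w).
Proof.
apply: measurable_funM; first exact: measurable_expRM.
under eq_fun do rewrite -powRN.
exact: measurable_1DpowR.
Qed.

(** Half of the exponential decay is spent on (1 + t) ^ -k, which may grow: it is at most (1 + t) ^
    (n + 1), and y ^ (n + 1) <= (n + 1)! e ^ y is applied at y = w (1 + t) / 2. *)
Lemma gker_bound : exists n, forall w t, 0 < w -> 0 < t ->
  gker w t <=
  (n.+1)`!%:R * (2 / w) ^+ n.+1 * expR (w / 2) * expR (- (w / 2) * t).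
Proof.
have [n hn] := powR_le_expr (- k); exists n => w t w0 t0.
rewrite /gker -powRN.
have t1 : 1 <= 1 + t by rewrite lerDl ltW.
apply: (@le_trans _ _ (expR (- w * t) *
    ((n.+1)`!%:R * (2 / w) ^+ n.+1 * expR (w / 2 * (1 + t))))).
  rewrite ler_wpM2l ?expR_ge0// (le_trans (hn _ t1))//.
  have w20 : 0 <= w / 2 * (1 + t) by rewrite mulr_ge0 ?divr_ge0 ?ltW// addr_gt0.
  have := expr_le_expR n w20.
  rewrite exprMn => h.
  have -> : (1 + t) ^+ n.+1 = (2 / w) ^+ n.+1 * ((w / 2) ^+ n.+1 * (1 + t) ^+ n.+1).
    rewrite mulrA -exprMn (_ : 2 / w * (w / 2) = 1) ?expr1n ?mul1r//.
    by field; rewrite gt_eqF.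
  set P := (2 / w) ^+ n.+1; set E := expR _ in h *.
  have -> : (n.+1)`!%:R * P * E = P * ((n.+1)`!%:R * E) by ring.
  rewrite ler_wpM2l//.
  by rewrite exprn_ge0// divr_ge0// ltW.
rewrite le_eqVlt; apply/orP; left; apply/eqP.
rewrite mulrCA -!mulrA; congr (_ * (_ * _)); rewrite -!expRD; congr expR.
by field.
Qed.

Lemma integral_gker_le : exists n, forall w, 0 < w ->
  (\int[mu]_(t in Rpos) (gker w t)%:E <=
   ((n.+1)`!%:R * (2 / w) ^+ n.+2 * expR (w / 2))%:E)%E.
Proof.
have [n hn] := gker_bound; exists n => w w0.
have w2 : 0 < w / 2 by rewrite divr_gt0.
set M := (n.+1)`!%:R * (2 / w) ^+ n.+1 * expR (w / 2).
have M0 : 0 <= M by rewrite !mulr_ge0 ?expR_ge0 ?exprn_ge0 ?divr_ge0 ?ltW.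
apply: (@le_trans _ _ (\int[mu]_(t in Rpos) (M%:E * (expR (- (w / 2) * t))%:E)))%E.
  apply: ge0_le_integral => //.
  - exact: measurable_Rpos.
  - by move=> t _; rewrite lee_fin gker_ge0.
  - by apply/measurable_EFinP; exact: measurable_gker.
  - by apply/measurable_EFinP; apply: measurable_funM => //; exact: measurable_expRM.
  - by move=> t /Rpos_gt0 t0; rewrite -EFinM lee_fin hn.
rewrite ge0_integralZl_EFin//; last 2 first.
- exact: measurable_Rpos.
- by apply/measurable_EFinP; exact: measurable_expRM.
rewrite integral_expR// -EFinM lee_fin le_eqVlt; apply/orP; left; apply/eqP.
by rewrite /M invf_div [in RHS]exprSr; ring.
Qed.

Lemma integral_gker w : 0 < w ->
  (\int[mu]_(t in Rpos) (gker w t)%:E = (Kfun w)%:E)%E.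
Proof.
move=> w0; rewrite /Kfun /Rintegral fineK// ge0_fin_numE.
  by have [n /(_ _ w0)/le_lt_trans] := integral_gker_le; apply; exact: ltry.
by apply: integral_ge0 => t _; rewrite lee_fin gker_ge0.
Qed.

Lemma Kfun_ge0 w : 0 <= Kfun w.
Proof. by apply: Rintegral_ge0 => t _; exact: gker_ge0. Qed.

Lemma Kfun_le : exists n, exists2 C, 0 <= C & forall w, 0 < w ->
  Kfun w <= C * w^-1 ^+ n * expR (w / 2).
Proof.
have [n hn] := integral_gker_le.
exists n.+2, ((n.+1)`!%:R * 2 ^+ n.+2); first by rewrite mulr_ge0// exprn_ge0.
move=> w w0; have := hn w w0; rewrite integral_gker// lee_fin.
by rewrite exprMn mulrA.
Qed.

Lemma Kfun_nonincreasing w w' : 0 < w -> w <= w' -> Kfun w' <= Kfun w.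
Proof.
move=> w0 ww'; have w'0 := lt_le_trans w0 ww'.
rewrite -lee_fin -!integral_gker//; apply: ge0_le_integral => //.
- exact: measurable_Rpos.
- by move=> t _; rewrite lee_fin gker_ge0.
- by apply/measurable_EFinP; exact: measurable_gker.
- by apply/measurable_EFinP; exact: measurable_gker.
- move=> t /Rpos_gt0 t0; rewrite lee_fin ler_wpM2r ?invr_ge0 ?powR_ge0//.
  by rewrite ler_expR ler_pM2r// lerN2.
Qed.

(** On ]0, 1[ one has 1 + t <= 2, so the integrand is at least a constant times e ^ -w. This lower
    bound turns bounds on the minus terms into bounds on their coefficients. *)
Lemma Kfun_ge : exists2 c, 0 < c & forall w, 0 < w -> c * expR (- w) <= Kfun w.
Proof.
have [n hn] := powR_le_expr k.
exists (2 ^- n.+1); first by rewrite invr_gt0 exprn_gt0.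
move=> w w0; rewrite -lee_fin -integral_gker//.
apply: (@le_trans _ _ (\int[mu]_(t in `]0%R, 1%R[) (gker w t)%:E)%E); last first.
  apply: ge0_subset_integral => //.
  - exact: measurable_Rpos.
  - by apply/measurable_EFinP; exact: measurable_gker.
  - by move=> t _; rewrite lee_fin gker_ge0.
  - by move=> t/=; rewrite /Rpos/= !in_itv/= andbT => /andP[].
apply: (@le_trans _ _ (\int[mu]_(t in `]0%R, 1%R[) (2 ^- n.+1 * expR (- w))%:E)%E).
  by rewrite integral_cst//= lebesgue_measure_itv/= lte01 oppr0 adde0 mule1.
apply: ge0_le_integral => //.
- by apply/measurable_EFinP; exact: measurable_gker.
- move=> t /=; rewrite in_itv/= => /andP[t0 t1].
  rewrite lee_fin mulrC; apply: ler_pM; rewrite ?expR_ge0 ?invr_ge0 ?exprn_ge0//.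
    by rewrite ler_expR mulNr lerN2 ger_pMr// ltW.
  have h : (1 + t) `^ k <= 2 ^+ n.+1.
    rewrite (le_trans (hn _ _))//; first by rewrite lerDl ltW.
    by rewrite lerXn2r ?nnegrE ?addr_ge0 ?(ltW t0)//; lra.
  by rewrite lef_pV2 ?posrE// ?exprn_gt0// powR_gt0// addr_gt0.
Qed.

Lemma measurable_snd_comp (h : R -> R) : measurable_fun Rpos h ->
  measurable_fun ((Rpos : set TR) `*` (Rpos : set TR))
    (fun p : TR * TR => h p.2).
Proof.
move=> mh; apply: (@measurable_comp _ _ _ _ _ _ (Rpos : set TR) h) => //.
- exact: measurable_itv.
- by move=> _ [p [_ ?] <-].
- by apply: measurable_funS measurable_snd.
Qed.

(* The integrand of the inner double integral of L_f, with s = -2 pi freq. *)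
Definition dker (s t y : R) : R := expR (- (s * (2 * t + 1)) * y) * ((1 + t) `^ k)^-1.

Lemma dkerE s t y : dker s t y = expR (- s * y) * gker (2 * s * y) t.
Proof.
by rewrite /dker /gker mulrA -expRD; congr (expR _ * _); ring.
Qed.

Lemma dker_ge0 s t y : 0 <= dker s t y.
Proof. by rewrite mulr_ge0 ?expR_ge0// invr_ge0 powR_ge0. Qed.

Lemma measurable_dker s (h : R -> R) : measurable_fun Rpos h ->
  measurable_fun ((Rpos : set TR) `*` (Rpos : set TR))
    (fun p : TR * TR => dker s p.1 p.2 * h p.2).
Proof.
move=> mh; apply: measurable_funM; last exact: measurable_snd_comp.
apply: measurable_funS (measurableT) (@subsetT _ _) _.
have m1 : measurable_fun setT (fun p : TR * TR => p.1 : R) by exact: measurable_fst.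
have m2 : measurable_fun setT (fun p : TR * TR => p.2 : R) by exact: measurable_snd.
apply: measurable_funM.
  apply: measurableT_comp => //; apply: measurable_funM => //.
  apply: measurableT_comp => //; apply: measurable_funM => //.
  by apply: measurable_funD => //; apply: measurable_funM.
under eq_fun do rewrite -powRN.
apply: (@measurableT_comp _ _ _ _ _ _ (fun t : R => (1 + t) `^ (- k))) => //.
exact: measurable_1DpowR.
Qed.

Lemma integral_dker s y (c : R) : 0 < s -> 0 < y -> 0 <= c ->
  (\int[mu]_(t in Rpos) (dker s t y * c)%:E =
   (expR (- s * y) * Kfun (2 * s * y) * c)%:E)%E.
Proof.
move=> s0 y0 c0.
have -> : (\int[mu]_(t in Rpos) (dker s t y * c)%:E =
    \int[mu]_(t in Rpos) ((c * expR (- s * y))%:E * (gker (2 * s * y) t)%:E))%E.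
  by apply: eq_integral => t _; rewrite dkerE -EFinM; congr EFin; ring.
rewrite ge0_integralZl_EFin//; last 4 first.
- exact: measurable_Rpos.
- by move=> t _; rewrite lee_fin gker_ge0.
- by apply/measurable_EFinP; exact: measurable_gker.
- by rewrite mulr_ge0// expR_ge0.
by rewrite integral_gker ?mulr_gt0// -EFinM; congr EFin; ring.
Qed.

(** Obtained from Tonelli, as an integral depending on a parameter. *)
Lemma measurable_Kfun s : 0 < s ->
  measurable_fun Rpos (fun y => expR (- s * y) * Kfun (2 * s * y)).
Proof.
move=> s0.
have := @measurable_integral_param R (fun t y => dker s t y * 1)
  (measurable_dker s (@measurable_cst _ _ _ _ _ (1 : R))).
move=> /(_ (fun t y _ _ => mulr_ge0 (dker_ge0 s t y) ler01)) h.
apply/measurable_EFinP; apply: eq_measurable_fun h => y /set_mem/Rpos_gt0 y0.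
by rewrite (integral_dker s0 y0 ler01) mulr1.
Qed.

(** The substitution t = w (1 + r) moves the half-line of integration to r > 0; e ^ -w splits off
    and the power of 1 + r becomes - k. *)
Lemma inc_gammaE (w : R) : 0 < w ->
  inc_gamma (1 - k) w = w `^ (1 - k) * expR (- w) * Kfun w.
Proof.
move=> w0; rewrite /inc_gamma /Rintegral.
pose G (t : R) := t `^ (1 - k - 1) * expR (- t).
pose F (r : R) : R := w * (1 + r).
have cG t : 0 < t -> {for t, continuous G}.
  move=> t0; apply: continuousM; last first.
    by apply: continuous_comp; [exact: opp_continuous|exact: continuous_expR].
  apply: differentiable_continuous; apply/derivable1_diffP.
  by apply: derivable_powR; rewrite in_itv/= t0.
have mG : measurable_fun (`]w, +oo[%classic : set R) (EFin \o G).
  apply/measurable_EFinP; apply: measurable_funM.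
    by apply: measurable_funS (@measurable_powR R _).
  by apply: measurableT_comp.
have F0 : F 0 = w by rewrite /F addr0 mulr1.
have dF (x : R) : derivable F x 1 by apply: derivableM => //; exact: derivableD.
have F'E : derive1 F = cst w.
  apply/funext => x; rewrite derive1Ml; last exact: derivableD.
  by rewrite derive1E deriveD// derive_cst derive_id add0r mulr1.
have -> : (\int[mu]_(t in `]w, +oo[) (t `^ (1 - k - 1) * expR (- t))%:E =
           \int[mu]_(x in `[0%R, +oo[) (((G \o F) * derive1 F) x)%:E)%E.
  rewrite integral_itv_obnd_cbnd// -[in LHS]F0.
  apply: (@increasing_ge0_integration_by_substitutiony R F G 0).
  - by move=> x y _ _ xy; rewrite /F ltr_pM2l// ltrD2l.
  - by rewrite F'E => x _; exact: cst_continuous.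
  - by rewrite F'E; exact: is_cvg_cst.
  - by rewrite F'E; exact: is_cvg_cst.
  - split; first by move=> x _.
    apply: cvg_at_right_filter; apply: differentiable_continuous.
    by apply/derivable1_diffP.
  - apply: gt0_cvgMry => //.
    exact: cvg_addrl.
  - apply: continuous_in_subspaceT => t; rewrite inE/= in_itv/= andbT F0 => wt.
    by apply: cG; exact: lt_le_trans wt.
  - by move=> x _; rewrite mulr_ge0 ?powR_ge0 ?expR_ge0.
have -> : (\int[mu]_(x in `[0%R, +oo[) (((G \o F) * derive1 F) x)%:E =
  \int[mu]_(x in `[0%R, +oo[)
    ((w `^ (1 - k) * expR (- w))%:E * (gker w x)%:E))%E.
  apply: eq_integral => x; rewrite inE/= in_itv/= andbT => x0.
  rewrite -EFinM; congr EFin.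
  rewrite /G /F/= F'E /gker.
  have x1 : 0 < 1 + x by rewrite ltr_pwDl.
  change ((w * (1 + x)) `^ (1 - k - 1) * expR (- (w * (1 + x))) * w =
    w `^ (1 - k) * expR (- w) * (expR (- w * x) / (1 + x) `^ k)).
  rewrite -[X in _ * X = _](@powRr1 R w) ?ltW// powRM ?ltW//.
  have -> : w `^ (1 - k) = w `^ (1 - k - 1) * w `^ 1.
    by rewrite -powRD ?subrK ?(gt_eqF w0) ?implybT.
  have -> : (1 + x) `^ (1 - k - 1) = ((1 + x) `^ k)^-1.
    by rewrite -powRN; congr (_ `^ _); ring.
  have -> : - (w * (1 + x)) = - w + - w * x by ring.
  by rewrite expRD /cst; ring.
rewrite -integral_itv_obnd_cbnd; last first.
  by apply/measurable_EFinP; apply: measurable_funM => //; exact: measurable_gker.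
rewrite ge0_integralZl_EFin//; last 3 first.
- by move=> t _; rewrite lee_fin gker_ge0.
- by apply/measurable_EFinP; exact: measurable_gker.
- by rewrite mulr_ge0 ?powR_ge0 ?expR_ge0.
by rewrite -/Rpos integral_gker.
Qed.

End Kernel.

(** * Laplace transforms as integrals along the imaginary axis *)

Section LaplaceTerms.
Variables (R : realType) (k : R).
Implicit Types (g psi : R -> R[i]) (c : R[i]).
Local Notation mu := (@lebesgue_measure R).
Local Notation Rpos := (@Rpos R).

(** A finite product forces [g] to be integrable unless c = 0, in which case both sides vanish
    whatever the norm of [g]. *)
Lemma cintZ_fin c g : cmeasurable g -> ((normc c)%:E * cnorm1 g < +oo)%E ->
  cintegrable (fun x => c * g x) /\ cint (fun x => c * g x) = c * cint g.
Proof.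
move=> mg; have [->|c0] := eqVneq c 0 => h.
  rewrite mul0r -[X in _ = X](@cint0 R); split.
    by apply: cintegrable_ext (@cintegrable0 R) => x _; rewrite mul0r.
  by apply: cint_ext => x _; rewrite mul0r.
have ig : cintegrable g.
  split => //; rewrite ltNge leye_eq; apply/negP => /eqP gy.
  move: h; rewrite gy gt0_muley// lte_fin lt_neqAle normc_ge0 andbT eq_sym.
  by apply: contra c0 => /eqP/eq0_normc ->.
by split; [exact: cintegrableZ|exact: cintZ].
Qed.

Lemma laplace_realE g (s : R) :
  laplace g s%:C = cint (fun x => (expR (- s * x))%:C * g x).
Proof.
apply: cint_ext => x _; congr (_ * _).
by rewrite -cexp_real; congr cexp; rewrite mulNr rmorphN rmorphM.
Qed.

Lemma laplace_absE g (s : R) :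
  laplace_abs g s = cnorm1 (fun x => (expR (- s * x))%:C * g x).
Proof.
apply: eq_integral => x _.
by rewrite normcM normc_real ger0_norm ?expR_ge0// mulNr.
Qed.

Lemma laplace_acvgE g (s : R) : laplace_acvg g s%:C <->
  (cnorm1 (fun x => ((expR (- s * x))%:C * g x)%R) < +oo)%E.
Proof.
rewrite /laplace_acvg (_ : integral _ _ _ =
  cnorm1 (fun x => (expR (- s * x))%:C * g x))//.
apply: eq_integral => x _; congr ((normc (_ * _))%:E).
by rewrite -cexp_real; congr cexp; rewrite mulNr rmorphN rmorphM.
Qed.

Lemma cmeasurable_kerM (f : R -> R) psi : measurable_fun Rpos f ->
  cmeasurable psi -> cmeasurable (fun y => (f y)%:C * psi y).
Proof. by move=> mf; apply: cmeasurableM; exact: cmeasurable_real. Qed.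

Lemma cmeasurable_twist psi a : cmeasurable psi -> cmeasurable (twist psi a).
Proof.
move=> mpsi; apply: cmeasurableM => //; apply: cmeasurable_real.
by apply: measurable_funS (@measurable_powR R _).
Qed.

(** The kernel [dker k s t y] after integration over t > 0. *)
Definition nker (s y : R) : R := expR (- s * y) * Kfun k (2 * s * y).

Lemma nker_ge0 s y : 0 <= nker s y.
Proof. by rewrite mulr_ge0 ?expR_ge0// Kfun_ge0. Qed.

Lemma measurable_nker s : 0 < s -> measurable_fun Rpos (nker s).
Proof. exact: measurable_Kfun. Qed.

Lemma Rintegral_dker s y (c : R) : 0 < s -> 0 < y ->
  \int[mu]_(t in Rpos) (dker k s t y * c) = nker s y * c.
Proof.
move=> s0 y0.
have md : measurable_fun Rpos (fun t => dker k s t y).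
  under eq_fun do rewrite dkerE.
  by apply: measurable_funM => //; exact: measurable_gker.
have E : (\int[mu]_(t in Rpos) (dker k s t y)%:E = (nker s y)%:E)%E.
  have := integral_dker k s0 y0 (@ler01 R); rewrite mulr1 => <-.
  by apply: eq_integral => t _; rewrite mulr1.
rewrite RintegralZr//.
- by rewrite /Rintegral E.
- exact: measurable_Rpos.
- apply/integrableP; split; first exact/measurable_EFinP.
  rewrite (_ : (\int[mu]_(t in Rpos) `|(EFin \o (fun t => dker k s t y)) t|)%E =
    (\int[mu]_(t in Rpos) (dker k s t y)%:E)%E); first by rewrite E ltry.
  by apply: eq_integral => t _; rewrite /= ger0_norm// dker_ge0.
Qed.

Section Nonhol.
Variables (m : nat) (kappa : 'I_m -> R) (j : 'I_m) (n : int).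
Hypothesis nu0 : freq kappa j n < 0.
Let s := - (2 * pi * freq kappa j n).

Let s0 : 0 < s.
Proof. by rewrite /s oppr_gt0 pmulr_rlt0// mulr_gt0// pi_gt0. Qed.

Let sE t : - (2 * pi * freq kappa j n * (2 * t + 1)) = s * (2 * t + 1).
Proof. by rewrite /s mulNr. Qed.

Lemma nonhol_absE g : cmeasurable g ->
  nonhol_abs k kappa g j n = cnorm1 (fun y => (nker s y)%:C * g y).
Proof.
move=> mg; have mN := measurable_normc mg.
transitivity (\int[mu]_(t in Rpos) \int[mu]_(y in Rpos)
    (dker k s t y * normc (g y))%:E)%E.
  apply: eq_integral => t _.
  rewrite -ge0_integralZr//; last 4 first.
  - exact: measurable_Rpos.
  - apply/measurable_EFinP; apply: measurable_funM => //.
    by under eq_fun do rewrite -mulNr; exact: measurable_expRM.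
  - by move=> y _; rewrite lee_fin mulr_ge0 ?expR_ge0// normc_ge0.
  - by rewrite lee_fin invr_ge0 powR_ge0.
  apply: eq_integral => y _; rewrite -EFinM; congr EFin.
  by rewrite sE /dker [- (s * _) * y]mulNr; ring.
rewrite (integral_exchange (measurable_dker k s mN)); last first.
  by move=> t y _ _; rewrite mulr_ge0 ?dker_ge0// normc_ge0.
apply: eq_integral => y /set_mem/Rpos_gt0 y0.
by rewrite integral_dker ?normc_ge0// normcM normc_real ger0_norm// nker_ge0.
Qed.

(** Fubini on real and imaginary parts: since [dker] is nonnegative, integrating the absolute values
    over t first gives at most the norm of [nker] times [g], which is finite by hypothesis. *)
Lemma nonholE g : cintegrable (fun y => (nker s y)%:C * g y) -> cmeasurable g ->
  nonhol k kappa g j n = cint (fun y => (nker s y)%:C * g y).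
Proof.
move=> ig mg.
have key (P : R[i] -> R) : (P = @Re R \/ P = @Im R) ->
  \int[mu]_(t in Rpos) P (laplace g (- (2 * pi * freq kappa j n * (2 * t + 1)))%:C
                 / ((1 + t) `^ k)%:C) =
  \int[mu]_(y in Rpos) P ((nker s y)%:C * g y).
  move=> PE.
  have Pr (a : R) z : P (a%:C * z) = a * P z.
    by case: PE => ->; [exact: Re_realM|exact: Im_realM].
  have PI (h : R -> R[i]) : P (cint h) = \int[mu]_(y in Rpos) P (h y).
    by case: PE => ->.
  have Pn z : `|P z| <= normc z.
    by case: PE => ->; [exact: normr_Re_le|exact: normr_Im_le].
  have mP : measurable_fun Rpos (fun y => P (g y)).
    by case: mg => m1 m2; case: PE => ->.
  transitivity (\int[mu]_(t in Rpos) \int[mu]_(y in Rpos) (dker k s t y * P (g y))).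
    apply: eq_Rintegral => t _.
    rewrite sE mulrC -fmorphV Pr.
    rewrite laplace_realE PI -RintegralZl_ge0; last 2 first.
    - under eq_fun do rewrite Pr.
      by apply: measurable_funM => //; exact: measurable_expRM.
    - by rewrite invr_ge0 powR_ge0.
    apply: eq_Rintegral => y _; rewrite Pr /dker; ring.
  rewrite (Rintegral_exchange (measurable_dker k s mP)); last first.
    apply: le_lt_trans (ig.2); rewrite /cnorm1.
    have E y : 0 < y -> (\int[mu]_(t in Rpos) (`|dker k s t y * P (g y)|)%:E =
        (nker s y * `|P (g y)|)%:E)%E.
      move=> y0; rewrite -integral_dker//; apply: eq_integral => t _.
      by rewrite normrM (ger0_norm (dker_ge0 _ _ _ _)).
    rewrite (_ : (\int[mu]_(y in Rpos) _)%E =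
      (\int[mu]_(y in Rpos) (nker s y * `|P (g y)|)%:E)%E); last first.
      by apply: eq_integral => y /set_mem/Rpos_gt0 y0; rewrite E.
    apply: ge0_le_integral => //.
    - exact: measurable_Rpos.
    - by move=> y _; rewrite lee_fin mulr_ge0 ?nker_ge0.
    - apply/measurable_EFinP; apply: measurable_funM; first exact: measurable_nker.
      exact: measurableT_comp.
    - exact: measurable_EFin_normc ig.1.
    - move=> y _; rewrite lee_fin normcM normc_real (ger0_norm (nker_ge0 _ _)).
      by rewrite ler_wpM2l ?nker_ge0.
  apply: eq_Rintegral => y /set_mem/Rpos_gt0 y0.
  by rewrite Rintegral_dker// Pr.
rewrite /nonhol [LHS]/cint [RHS]/cint.
by congr (_ +i* _); apply: key; [left|right].
Qed.

(* [mker s y] is Gamma(1 - k, 2 s y) e ^ (s y): the minus term at tau = i y. *)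
Definition mker (s y : R) : R := (2 * s) `^ (1 - k) * (y `^ (1 - k) * nker s y).

Lemma mker_ge0 a y : 0 <= mker a y.
Proof. by rewrite mulr_ge0 ?powR_ge0// mulr_ge0 ?powR_ge0// nker_ge0. Qed.

Lemma measurable_mker a : 0 < a -> measurable_fun Rpos (mker a).
Proof.
move=> a0; apply: measurable_funM => //; apply: measurable_funM.
  by apply: measurable_funS (@measurable_powR R _).
exact: measurable_nker.
Qed.

Lemma mkerE a y : 0 < a -> 0 < y ->
  mker a y = inc_gamma (1 - k) (2 * a * y) * expR (a * y).
Proof.
move=> a0 y0; rewrite inc_gammaE ?mulr_gt0// powRM ?mulr_ge0 ?(ltW a0) ?(ltW y0)//.
rewrite /mker /nker.
have -> : expR (- a * y) = expR (- (2 * a * y)) * expR (a * y).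
  by rewrite -expRD; congr expR; ring.
by ring.
Qed.

Let E psi y : (mker s y)%:C * psi y =
  ((2 * s) `^ (1 - k))%:C * ((nker s y)%:C * twist psi (2 - k) y).
Proof.
rewrite /twist (_ : 2 - k - 1 = 1 - k); last by ring.
by rewrite /mker !rmorphM/=; ring.
Qed.

Let s2 : - (4 * pi * freq kappa j n) = 2 * s.
Proof. by rewrite /s; ring. Qed.

Let s2' : 4 * pi * `|freq kappa j n| = 2 * s.
Proof. by rewrite ltr0_norm// /s; ring. Qed.

(** The two powers in [mker] account for the two normalisations of the nonholomorphic terms: y ^ (1
    - k) is the twist by 2 - k, and (2 s) ^ (1 - k) is the constant factor. *)
Lemma cnorm1_mker psi : cmeasurable psi ->
  cnorm1 (fun y => (mker s y)%:C * psi y) =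
  (((4 * pi * `|freq kappa j n|) `^ (1 - k))%:E *
   nonhol_abs k kappa (twist psi (2 - k)) j n)%E.
Proof.
move=> mpsi; have mt := cmeasurable_twist (2 - k) mpsi.
rewrite nonhol_absE// (cnorm1_ext (fun y _ => E psi y)) cnorm1Z.
  by rewrite normc_real ger0_norm ?powR_ge0// s2'.
by apply: cmeasurable_kerM => //; exact: measurable_nker.
Qed.

Lemma mker_cint c psi : cmeasurable psi ->
  ((normc c)%:E * cnorm1 (fun y => ((mker s y)%:C * psi y)%R) < +oo)%E ->
  c * ((- (4 * pi * freq kappa j n)) `^ (1 - k))%:C *
    nonhol k kappa (twist psi (2 - k)) j n =
  c * cint (fun y => (mker s y)%:C * psi y).
Proof.
move=> mpsi; have [->|c0] := eqVneq c 0; first by rewrite !mul0r.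
have mt := cmeasurable_twist (2 - k) mpsi.
have mn : cmeasurable (fun y => (nker s y)%:C * twist psi (2 - k) y).
  by apply: cmeasurable_kerM => //; exact: measurable_nker.
rewrite (cnorm1_ext (fun y _ => E psi y)) cnorm1Z// => h.
have ig : cintegrable (fun y => (nker s y)%:C * twist psi (2 - k) y).
  split => //; rewrite ltNge leye_eq; apply/negP => /eqP gy.
  move: h; rewrite gy gt0_muley ?gt0_muley//.
    rewrite lte_fin lt_neqAle normc_ge0 andbT eq_sym.
    by apply: contra c0 => /eqP/eq0_normc ->.
  by rewrite lte_fin normc_real normr_gt0 gt_eqF// powR_gt0// mulr_gt0.
rewrite nonholE// (cint_ext (fun y _ => E psi y)) cintZ// s2.
by rewrite mulrA.
Qed.

End Nonhol.
End LaplaceTerms.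

(** * Interchange of sums over the integers with integrals *)

Section Sums.
Variable R : realType.
Implicit Types (u : nat -> R[i]) (z : R[i]) (psi : R -> R[i]).
Local Notation Rpos := (@Rpos R).

Lemma ccvg_seriesP u z :
  (series (fun n => Re (u n)) @ \oo --> Re z) ->
  (series (fun n => Im (u n)) @ \oo --> Im z) ->
  ccvg_series u /\ csum u = z.
Proof.
move=> h1 h2; split; first by split; apply/cvg_ex; eexists; [exact: h1|exact: h2].
by apply: complexP; rewrite /csum /=; exact/cvg_lim.
Qed.

Lemma csumMr u z : ccvg_series u ->
  ccvg_series (fun n => u n * z) /\ csum (fun n => u n * z) = csum u * z.
Proof.
move=> [c1 c2].
have E a b (c d : R) : series (fun n => a n * c + b n * d) =
    (fun N => series a N * c + series b N * d).
  by apply/funext => N; rewrite !seriesEord/= !mulr_suml -big_split.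
apply: ccvg_seriesP.
  rewrite creM /csum/= -mulrN.
  rewrite (_ : (fun n => Re (u n * z)) =
     (fun n => Re (u n) * Re z + Im (u n) * - Im z)); last first.
    by apply/funext => n; rewrite creM mulrN.
  by rewrite E; apply: cvgD; apply: cvgMr_tmp.
rewrite cimM /csum/=.
rewrite (_ : (fun n => Im (u n * z)) =
     (fun n => Re (u n) * Im z + Im (u n) * Re z)); last first.
  by apply/funext => n; rewrite cimM.
by rewrite E; apply: cvgD; apply: cvgMr_tmp.
Qed.

Lemma csum_ext u (u' : nat -> R[i]) : u =1 u' -> csum u = csum u'.
Proof. by move=> /funext ->. Qed.

Lemma csumZ_ext (P : pred int) (v v' : int -> R[i]) :
  (forall n, P n -> v n = v' n) -> csumZ P v = csumZ P v'.
Proof.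
by move=> vv; congr (_ + _); apply: csum_ext => n; rewrite /restrZ; case: ifPn => // /vv.
Qed.

Lemma ccvg_sumZ_ext (P : pred int) (v v' : int -> R[i]) :
  (forall n, P n -> v n = v' n) -> ccvg_sumZ P v -> ccvg_sumZ P v'.
Proof.
move=> vv; rewrite /ccvg_sumZ; suff -> : restrZ P v = restrZ P v' by [].
by apply/funext => n; rewrite /restrZ; case: ifPn => // /vv.
Qed.

(** The sum over the range of [h] is part of the sum over all integers; indices outside [P]
    contribute 0. *)
Lemma esum_reindex_fin (P : pred int) (a : int -> \bar R) (h : nat -> int) :
  injective h -> (forall n, (0 <= a n)%E) ->
  (\esum_(n in [set n | P n]) a n < +oo)%E ->
  (\sum_(n <oo) (if P (h n) then a (h n) else 0%E) < +oo)%E.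
Proof.
move=> hi a0.
rewrite nneseries_esumT; last by move=> n; case: ifP.
rewrite esum_mkcond (esumID (h @` setT)); last by move=> n _; case: ifP.
apply: le_lt_trans; rewrite setTI.
rewrite esum_image; last by move=> x y _ _; exact: hi.
rewrite (_ : (\esum_(i in [set: nat]) (if P (h i) then a (h i) else 0) =
  \esum_(i in [set: nat]) (if h i \in [set n | P n] then a (h i) else 0))%E).
  by rewrite leeDl// esum_ge0// => n _; case: ifP.
apply: eq_esum => n _; congr (if _ then _ else _).
by apply/idP/idP => [Pn|/set_mem//]; rewrite inE.
Qed.

(** The two halves into which [csumZ] splits the integers. *)
Definition half_index (h : nat -> int) := h = Posz \/ h = Negz.

Lemma half_index_inj h : half_index h -> injective h.
Proof. by case=> -> x y []. Qed.

Definition abs_summable (P : pred int) (c : int -> R[i]) (ker : int -> R -> R)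
    psi : Prop :=
  forall h, half_index h -> (\sum_(n <oo) ((normc (restrZ P c (h n)))%:E *
     cnorm1 (fun y => ((ker (h n) y)%:C * psi y)%R)) < +oo)%E.

Lemma abs_summable_esum (P : pred int) (c : int -> R[i]) (ker : int -> R -> R)
    psi :
  (\esum_(n in [set n | P n]) ((normc (c n))%:E *
     cnorm1 (fun y => ((ker n y)%:C * psi y)%R)) < +oo)%E ->
  abs_summable P c ker psi.
Proof.
move=> hs h /half_index_inj hi.
have := esum_reindex_fin hi _ hs.
have a0 n : (0 <= (normc (c n))%:E * cnorm1 (fun y => ((ker n y)%:C * psi y)%R))%E.
  by rewrite mule_ge0 ?cnorm1_ge0// lee_fin normc_ge0.
move=> /(_ a0).
apply: le_lt_trans; apply: lee_nneseries => n _.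
  by move=> _; rewrite mule_ge0 ?cnorm1_ge0// lee_fin normc_ge0.
by rewrite /restrZ; case: ifP => _ //; rewrite normc0 mul0e.
Qed.

Lemma abs_summable_term (P : pred int) (c : int -> R[i]) (ker : int -> R -> R)
    psi n :
  abs_summable P c ker psi -> P n ->
  ((normc (c n))%:E * cnorm1 (fun y => ((ker n y)%:C * psi y)%R) < +oo)%E.
Proof.
move=> hs Pn; have [h hh [i hi]] : exists2 h, half_index h & exists i, h i = n.
  by case: n Pn => i _; [exists Posz|exists Negz]; [left|exists i|right|exists i].
apply: le_lt_trans (hs h hh).
have -> : c n = restrZ P c (h i) by rewrite /restrZ hi Pn.
rewrite -hi; apply: (@nneseries_ge_term R (fun n => (normc (restrZ P c (h n)))%:E *
     cnorm1 (fun y => ((ker (h n) y)%:C * psi y)%R))%E i) => l.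
by rewrite mule_ge0 ?cnorm1_ge0// lee_fin normc_ge0.
Qed.

(** Each half of the integers is an instance of [csum_cint], with summable norms from [abs_summable]
    and pointwise convergence as a hypothesis. *)
Lemma csumZ_cint (P : pred int) (c : int -> R[i]) (ker : int -> R -> R) psi :
  cmeasurable psi -> (forall n, P n -> measurable_fun Rpos (ker n)) ->
  abs_summable P c ker psi ->
  (forall y, 0 < y -> ccvg_sumZ P (fun n => c n * (ker n y)%:C)) ->
  let F y := csumZ P (fun n => c n * (ker n y)%:C) in
  cintegrable (fun y => F y * psi y) /\
  csumZ P (fun n => c n * cint (fun y => (ker n y)%:C * psi y)) =
  cint (fun y => F y * psi y).
Proof.
move=> mpsi mker hs hc F.
(* Indices outside [P] are kept as zero functions, so that both halves are series over all natural
   numbers. *)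
pose w (h : nat -> int) n y := restrZ P (fun n => c n * (ker n y)%:C) (h n) * psi y.
have wE h n y : w h n y = restrZ P c (h n) * ((ker (h n) y)%:C * psi y).
  by rewrite /w /restrZ; case: ifPn => _; rewrite ?mul0r// mulrA.
have mw (h : nat -> int) n : P (h n) -> cmeasurable (fun y => (ker (h n) y)%:C * psi y).
  by move=> Ph; apply: cmeasurable_kerM => //; exact: mker.
have mw' h n : cmeasurable (w h n).
  have [Ph|nP] := boolP (P (h n)).
    have := cmeasurableM (cmeasurable_cst (c (h n))) (mw _ _ Ph).
    by apply: cmeasurable_ext => y _; rewrite wE /restrZ Ph.
  have := @cmeasurable_cst R 0; apply: cmeasurable_ext => y _.
  by rewrite wE /restrZ (negbTE nP) mul0r.
have nw h n : cnorm1 (w h n) = ((normc (restrZ P c (h n)))%:E *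
     cnorm1 (fun y => ((ker (h n) y)%:C * psi y)%R))%E.
  rewrite (cnorm1_ext (fun y _ => wE h n y)).
  have [Ph|nP] := boolP (P (h n)); first by rewrite cnorm1Z//; exact: mw.
  rewrite /restrZ (negbTE nP) normc0 mul0e.
  rewrite (cnorm1_ext (h := fun=> 0)); last by move=> y _; rewrite mul0r.
  by rewrite /cnorm1 normc0 integral0.
have cf h y : half_index h -> 0 < y ->
    ccvg_series (fun n => restrZ P (fun n => c n * (ker n y)%:C) (h n)).
  by case=> -> /hc[].
have main h : half_index h ->
   cintegrable (fun y => csum (fun n => w h n y)) /\
   csum (fun n => cint (w h n)) = cint (fun y => csum (fun n => w h n y)).
  move=> hh; apply: csum_cint => //.
  - by have := hs h hh; congr (_ < _)%E; apply: eq_eseriesr => n _; rewrite nw.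
  - by move=> y y0; exact: (csumMr (psi y) (cf h y hh y0)).1.
have sw h y : half_index h -> 0 < y -> csum (fun n => w h n y) =
    csum (fun n => restrZ P (fun n => c n * (ker n y)%:C) (h n)) * psi y.
  by move=> hh y0; exact: (csumMr (psi y) (cf h y hh y0)).2.
have cw h n : half_index h -> cint (w h n) =
    restrZ P (fun n => c n * cint (fun y => (ker n y)%:C * psi y)) (h n).
  move=> hh; rewrite (cint_ext (fun y _ => wE h n y)) /restrZ.
  case: ifPn => Ph; last first.
    by rewrite -[RHS](@cint0 R); apply: cint_ext => y _; rewrite mul0r.
  by apply: (cintZ_fin (mw _ _ Ph) _).2; exact: abs_summable_term hs Ph.
have [i1 e1] := main Posz (or_introl erefl).
have [i2 e2] := main Negz (or_intror erefl).
have FE y : 0 < y -> csum (fun n => w Posz n y) + csum (fun n => w Negz n y) =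
    F y * psi y.
  by move=> y0; rewrite !sw//; [rewrite -mulrDl|right|left].
split; first exact: cintegrable_ext FE (cintegrableD i1 i2).
rewrite -(cint_ext FE) cintD// -e1 -e2.
by congr (_ + _); apply: csum_ext => n; rewrite cw//; [left|right].
Qed.

End Sums.

(** * Measurability of piecewise smooth functions *)

Section PiecewiseSmooth.
Variable R : realType.
Local Notation Rpos := (@Rpos R).

Lemma smooth_measurable (h : R -> R) (D : set R) : smooth h -> measurable_fun D h.
Proof.
move=> sh; apply: measurable_funS (measurableT) (@subsetT _ D) _.
apply: continuous_measurable_fun => x.
by apply: differentiable_continuous; apply/derivable1_diffP; exact: (sh 0%N x).
Qed.

(** Induction on the pieces; break points are singletons, so arbitrary values there do no harm. *)
Lemma piecewise_measurable (f : R -> R) (t : nat -> R) N :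
  (forall i, (i < N)%N -> t i < t i.+1 /\ exists2 g : R -> R,
     smooth g & forall x, t i < x < t i.+1 -> f x = g x) ->
  t 0%N <= t N /\ measurable_fun `[t 0%N, t N]%classic f.
Proof.
elim: N => [|N IH] ht.
  by rewrite set_itv1; split => //; exact: measurable_fun_set1.
have [|t0N mN] := IH; first by move=> i iN; apply: ht; rewrite ltnS ltnW.
have [tN [g sg fg]] := ht N (ltnSn N).
split; first by rewrite (le_trans t0N)// ltW.
have -> : `[t 0%N, t N.+1]%classic = `[t 0%N, t N]%classic `|`
    (`]t N, t N.+1[%classic `|` [set t N.+1]).
  apply/seteqP; split => x/=; rewrite !in_itv/=.
    move=> /andP[x0 x1]; have [xN|xN] := leP x (t N); first by left; rewrite x0.
    right; move: x1; rewrite le_eqVlt => /predU1P[->|x1]; first by right.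
    by left; apply/andP.
  move=> [/andP[-> xN]|[/andP[xN x1]|->]].
  - by rewrite (le_trans xN)// ltW.
  - by rewrite (le_trans t0N (ltW xN)) ltW.
  - by rewrite (le_trans t0N (ltW tN)) lexx.
apply/measurable_funU => //; first exact: measurableU.
split => //; apply/measurable_funU => //; split; last exact: measurable_fun_set1.
have := @smooth_measurable g `]t N, t N.+1[%classic sg.
by apply: eq_measurable_fun => x; rewrite inE/= in_itv/= => /fg.
Qed.

(** [Rpos] is exhausted by the intervals [1 / (n + 2), n + 2]; the shift by 2 keeps the end points
    distinct, as [piecewise_smooth] requires. *)
Lemma piecewise_smooth_cmeasurable (phi : R -> R[i]) :
  piecewise_smooth phi -> cmeasurable phi.
Proof.
move=> hphi.
have RposE : Rpos = \bigcup_n `[n.+2%:R^-1, n.+2%:R]%classic.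
  apply/seteqP; split => [x /Rpos_gt0 x0|x [n _]]/=; last first.
    rewrite /Rpos/= !in_itv/= andbT => /andP[nx _].
    by rewrite (lt_le_trans _ nx)// invr_gt0.
  pose n := maxn (Num.bound x) (Num.bound x^-1).
  exists n => //=; rewrite in_itv/=; apply/andP; split.
    rewrite invf_ple ?posrE// ltW// (lt_le_trans (archi_boundP _)) ?invr_ge0 ?ltW//.
    by rewrite ltr_nat ltnS /n (leq_trans (leq_maxr (Num.bound x) _)).
  rewrite ltW// (lt_le_trans (archi_boundP _)) ?ltW//.
  by rewrite ltr_nat ltnS /n (leq_trans (leq_maxl _ (Num.bound x^-1))).
have key (P : R[i] -> R) : (P = @Re R \/ P = @Im R) ->
    measurable_fun Rpos (fun x => P (phi x)).
  move=> PE; rewrite RposE; apply/measurable_fun_bigcup => n; first exact: measurable_itv.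
  have n0 : 0 < n.+2%:R^-1 :> R by rewrite invr_gt0.
  have n1 : n.+2%:R^-1 < n.+2%:R :> R.
    by rewrite (@lt_trans _ _ 1)// ?invf_lt1 ?ltr1n.
  have [N [t [t0 tN ht]]] := hphi _ _ n0 n1.
  rewrite -t0 -tN; apply: (piecewise_measurable _).2 => i iN.
  have [ti [g [g1 g2 gE]]] := ht i iN; split => //.
  exists (fun x => P (g x)); first by case: PE => ->.
  by move=> x /gE ->.
by split; apply: key; [left|right].
Qed.

End PiecewiseSmooth.

(** * L-series as integrals along the imaginary axis *)

Section IntegralRepresentation.
Variables (R : realType) (m : nat) (k : R) (kappa : 'I_m -> R).
Implicit Types (psi phi : R -> R[i]) (j : 'I_m) (n : int).
Local Notation Rpos := (@Rpos R).
Local Notation nu := (freq kappa).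

Definition pkern j n (y : R) : R := expR (- (2 * pi * nu j n) * y).
Definition mkern j n (y : R) : R := mker k (- (2 * pi * nu j n)) y.

Definition cis (x : R) : R[i] := cexp (x *i).

Lemma cis0 : cis 0 = 1.
Proof. by rewrite /cis (cexp_real 0) expR0. Qed.

Lemma cisD x y : cis (x + y) = cis x * cis y.
Proof.
rewrite /cis -cexpD; congr cexp.
by apply: complexP; rewrite ?creD ?cimD/= ?addr0.
Qed.

Lemma negfreq_arg_gt0 j n : negfreq kappa j n -> 0 < - (2 * pi * nu j n).
Proof.
by rewrite /negfreq => nu0; rewrite oppr_gt0 pmulr_rlt0// mulr_gt0// pi_gt0.
Qed.

Lemma qexpE j n u y :
  qexp kappa j n (u +i* y) = (pkern j n y)%:C * cis (2 * pi * nu j n * u).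
Proof.
rewrite /qexp /pkern /cis -cexp_real -cexpD; congr cexp.
by apply: complexP; rewrite ?creM ?cimM ?creD ?cimD/= ?creM ?cimM/=; ring.
Qed.

Lemma plus_termE cp j u y n : plus_term kappa cp j (u +i* y) n =
  cp j n * (pkern j n y)%:C * cis (2 * pi * nu j n * u).
Proof. by rewrite /plus_term qexpE mulrA. Qed.

Lemma minus_termE cm j u y n : 0 < y -> negfreq kappa j n ->
  minus_term k kappa cm j (u +i* y) n =
  cm j n * (mkern j n y)%:C * cis (2 * pi * nu j n * u).
Proof.
move=> y0 nn; rewrite /minus_term qexpE /mkern mkerE ?negfreq_arg_gt0//.
rewrite (_ : - (4 * pi * nu j n * Im (u +i* y)) = 2 * - (2 * pi * nu j n) * y);
  last by rewrite /=; ring.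
by rewrite rmorphM/= /pkern !mulrA.
Qed.

Lemma nonhol_abs_ext g g' j n : (forall y, 0 < y -> g y = g' y) ->
  nonhol_abs k kappa g j n = nonhol_abs k kappa g' j n.
Proof.
move=> gg; apply: eq_integral => t _; congr (_ * _)%E.
by apply: eq_integral => y /set_mem/Rpos_gt0 y0; rewrite gg.
Qed.

Lemma nonhol_ext g g' j n : (forall y, 0 < y -> g y = g' y) ->
  nonhol k kappa g j n = nonhol k kappa g' j n.
Proof.
move=> gg; apply: cint_ext => t _; congr (_ / _).
by apply: cint_ext => y y0; rewrite gg.
Qed.

(** Through this identity the nonholomorphic part of L_(delta f) at phi is that of an ordinary
    L-series at y phi(y), so one integral formula serves both. *)
Lemma twist_twist phi y : 0 < y ->
  twist (twist phi 2) (2 - k) y = twist phi (3 - k) y.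
Proof.
move=> y0; rewrite /twist -mulrA -rmorphM/= -powRD; last by rewrite (gt_eqF y0) implybT.
by congr (_ * (_ `^ _)%:C); ring.
Qed.

(** The coefficients are parameters: [cp j] and [cm j] give f(i y), and their products with the
    frequencies give the derivative in u up to 2 pi i. *)
Definition kernel_sum (a b : int -> R[i]) j (y : R) : R[i] :=
  csumZ xpredT (fun n => a n * (pkern j n y)%:C)
  + csumZ (negfreq kappa j) (fun n => b n * (mkern j n y)%:C).

Lemma kernel_sum_cint (a b : int -> R[i]) j psi :
  cmeasurable psi ->
  abs_summable xpredT a (pkern j) psi ->
  abs_summable (negfreq kappa j) b (mkern j) psi ->
  (forall y, 0 < y -> ccvg_sumZ xpredT (fun n => a n * (pkern j n y)%:C)) ->
  (forall y, 0 < y ->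
     ccvg_sumZ (negfreq kappa j) (fun n => b n * (mkern j n y)%:C)) ->
  cintegrable (fun y => kernel_sum a b j y * psi y) /\
  csumZ xpredT (fun n => a n * laplace psi (2 * pi * nu j n)%:C)
  + csumZ (negfreq kappa j) (fun n =>
      b n * ((- (4 * pi * nu j n)) `^ (1 - k))%:C
      * nonhol k kappa (twist psi (2 - k)) j n)
  = cint (fun y => kernel_sum a b j y * psi y).
Proof.
move=> mpsi sa sb ca cb.
have [i1 e1] : _ /\ _ := csumZ_cint mpsi (fun n _ => @measurable_expRM R _ _) sa ca.
have mm n : negfreq kappa j n -> measurable_fun Rpos (mkern j n).
  by move=> nn; apply: measurable_mker; exact: negfreq_arg_gt0.
have [i2 e2] : _ /\ _ := csumZ_cint mpsi mm sb cb.
have E y : 0 < y -> csumZ xpredT (fun n => a n * (pkern j n y)%:C) * psi y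
  + csumZ (negfreq kappa j) (fun n => b n * (mkern j n y)%:C) * psi y
  = kernel_sum a b j y * psi y.
  by move=> _; rewrite /kernel_sum [RHS]mulrDl.
split; first exact: cintegrable_ext E (cintegrableD i1 i2).
rewrite -(cint_ext E) (cintD i1 i2) -e1 -e2; apply: (f_equal2 +%R).
  by apply: csumZ_ext => n _; rewrite laplace_realE.
apply: csumZ_ext => n nn; apply: mker_cint => //.
exact: abs_summable_term sb nn.
Qed.

Lemma csumZ_terms_at_iy f cp cm : fourier_expansion k kappa f cp cm ->
  forall j y, 0 < y ->
  [/\ ccvg_sumZ xpredT (fun n => cp j n * (pkern j n y)%:C),
      ccvg_sumZ (negfreq kappa j) (fun n => cm j n * (mkern j n y)%:C) &
      f (0 +i* y) j 0 = kernel_sum (cp j) (cm j) j y].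
Proof.
move=> [_ hf] j y y0.
have [c1 c2 e] := hf (0 +i* y) j y0.
have E1 n : true -> plus_term kappa cp j (0 +i* y) n = cp j n * (pkern j n y)%:C.
  by move=> _; rewrite plus_termE mulr0 cis0 mulr1.
have E2 n : negfreq kappa j n ->
    minus_term k kappa cm j (0 +i* y) n = cm j n * (mkern j n y)%:C.
  by move=> nn; rewrite minus_termE// mulr0 cis0 mulr1.
split; [exact: ccvg_sumZ_ext E1 c1|exact: ccvg_sumZ_ext E2 c2|].
by rewrite e /kernel_sum (csumZ_ext E1) (csumZ_ext E2).
Qed.

(* Both [test_space] and [test_space_delta] bound such a sum: the latter with
   psi = twist phi 2 and the coefficients multiplied by the frequencies. *)
Lemma abs_summable_of_esum (a b : int -> R[i]) j psi (g : R -> R[i]) :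
  cmeasurable psi -> (forall y, 0 < y -> twist psi (2 - k) y = g y) ->
  (\esum_(n in [set: int])
           ((normc (a n))%:E * laplace_abs psi (2 * pi * nu j n)%R)
         + \esum_(n in [set n | negfreq kappa j n])
           ((normc (b n) * (4 * pi * `|nu j n|) `^ (1 - k))%:E
            * nonhol_abs k kappa g j n) < +oo)%E ->
  abs_summable xpredT a (pkern j) psi /\
  abs_summable (negfreq kappa j) b (mkern j) psi.
Proof.
move=> mpsi gE hfin.
have A0 : (0 <= \esum_(n in [set: int])
           ((normc (a n))%:E * laplace_abs psi (2 * pi * nu j n)%R))%E.
  apply: esum_ge0 => n _.
  by rewrite laplace_absE mule_ge0 ?cnorm1_ge0// lee_fin normc_ge0.
have E n : negfreq kappa j n -> ((normc (b n) * (4 * pi * `|nu j n|) `^ (1 - k))%:E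
            * nonhol_abs k kappa g j n = (normc (b n))%:E *
     cnorm1 (fun y => ((mkern j n y)%:C * psi y)%R))%E.
  move=> nn; rewrite /mkern (cnorm1_mker k nn mpsi) EFinM muleA.
  by congr (_ * _)%E; apply: nonhol_abs_ext => y y0; rewrite gE.
have B0 : (0 <= \esum_(n in [set n | negfreq kappa j n])
           ((normc (b n) * (4 * pi * `|nu j n|) `^ (1 - k))%:E
            * nonhol_abs k kappa g j n))%E.
  by apply: esum_ge0 => n nn; rewrite E// mule_ge0 ?cnorm1_ge0// lee_fin normc_ge0.
split; apply: abs_summable_esum.
  apply: le_lt_trans hfin; apply: (@le_trans _ _ (\esum_(n in [set: int])
           ((normc (a n))%:E * laplace_abs psi (2 * pi * nu j n)%R))%E).
    rewrite (_ : [set n : int | xpredT n] = [set: int]); last exact/seteqP.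
    by apply: le_esum => n _; rewrite laplace_absE.
  by rewrite leeDl.
apply: le_lt_trans hfin; apply: (@le_trans _ _ (\esum_(n in [set n | negfreq kappa j n])
           ((normc (b n) * (4 * pi * `|nu j n|) `^ (1 - k))%:E
            * nonhol_abs k kappa g j n))%E).
  by apply: le_esum => n nn; rewrite E.
by rewrite leeDr.
Qed.

End IntegralRepresentation.

(** * Expansions of first order *)

Section Jets.
Variable R : realType.
Implicit Types (g h : R -> R[i]) (a b z : R[i]).

(** First-order expansion at 0 with a quadratic remainder. Such expansions are stable under sums,
    products and dominated series with explicit constants, and determine their coefficients. *)
Definition jet g a0 a1 : Prop := exists C r, [/\ 0 <= C, 0 < r & forall s,
  `|s| < r -> normc (g s - (a0 + s%:C * a1)) <= C * s ^+ 2].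

Lemma jet_ext g h a0 a1 (r : R) : 0 < r -> (forall s, `|s| < r -> g s = h s) ->
  jet g a0 a1 -> jet h a0 a1.
Proof.
move=> r0 gh [C [r' [C0 r'0 hg]]]; exists C, (Num.min r r'); split => //.
  by rewrite lt_min r0.
by move=> s; rewrite lt_min => /andP[sr sr']; rewrite -gh// hg.
Qed.

Lemma jet_cst a : jet (fun=> a) a 0.
Proof.
exists 0, 1; split => // s _.
by rewrite mulr0 addr0 subrr normc0 mul0r.
Qed.

Lemma jetD g h a0 a1 b0 b1 : jet g a0 a1 -> jet h b0 b1 ->
  jet (fun s => g s + h s) (a0 + b0) (a1 + b1).
Proof.
move=> [C [r [C0 r0 hg]]] [D [r' [D0 r'0 hh]]].
exists (C + D), (Num.min r r'); split; rewrite ?addr_ge0// ?lt_min ?r0//.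
move=> s; rewrite lt_min => /andP[sr sr'].
have -> : g s + h s - (a0 + b0 + s%:C * (a1 + b1)) =
    (g s - (a0 + s%:C * a1)) + (h s - (b0 + s%:C * b1)) by ring.
by rewrite (le_trans (normc_triangle _ _))// mulrDl lerD ?hg ?hh.
Qed.

Lemma jetM g h a0 a1 b0 b1 : jet g a0 a1 -> jet h b0 b1 ->
  jet (fun s => g s * h s) (a0 * b0) (a0 * b1 + a1 * b0).
Proof.
move=> [C [r [C0 r0 hg]]] [D [r' [D0 r'0 hh]]].
pose B := normc b0 + normc b1 + D; pose A := normc a0 + normc a1.
exists (C * B + A * D + normc a1 * normc b1), (Num.min 1 (Num.min r r')); split.
- by rewrite !addr_ge0 ?mulr_ge0 ?addr_ge0 ?normc_ge0.
- by rewrite !lt_min ltr01 r0.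
move=> s; rewrite !lt_min => /and3P[s1 sr sr'].
have -> : g s * h s - (a0 * b0 + s%:C * (a0 * b1 + a1 * b0)) =
    (g s - (a0 + s%:C * a1)) * h s
    + (a0 + s%:C * a1) * (h s - (b0 + s%:C * b1))
    + s%:C * s%:C * (a1 * b1) by ring.
have lin c0 c1 : normc (c0 + s%:C * c1) <= normc c0 + normc c1.
  rewrite (le_trans (normc_triangle _ _))// lerD2l normcM normc_real.
  by rewrite ler_piMl ?normc_ge0// ltW.
have s2 : s ^+ 2 <= 1.
  by rewrite -real_normK ?num_real// exprn_ile1// ltW.
have hB : normc (h s) <= B.
  rewrite -[h s](subrK (b0 + s%:C * b1)) (le_trans (normc_triangle _ _))//.
  rewrite /B addrC lerD ?lin// (le_trans (hh _ sr'))//.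
  by rewrite ler_piMr.
rewrite (le_trans (normc_triangle _ _))// [leRHS]mulrDl lerD//; last first.
  rewrite !normcM !normc_real -normrM ger0_norm -?expr2 ?sqr_ge0//.
  by rewrite mulrC.
rewrite (le_trans (normc_triangle _ _))// [leRHS]mulrDl lerD// normcM.
  by rewrite mulrAC ler_pM ?normc_ge0// hg.
by rewrite -mulrA ler_pM ?normc_ge0 ?lin ?hh.
Qed.

Lemma jetZ c g a0 a1 : jet g a0 a1 -> jet (fun s => c * g s) (c * a0) (c * a1).
Proof. by move=> /(jetM (jet_cst c)); rewrite mul0r addr0. Qed.

Lemma jet_sum (I : Type) (r : seq I) (g : I -> R -> R[i]) (a0 a1 : I -> R[i]) :
  (forall i, jet (g i) (a0 i) (a1 i)) ->
  jet (fun s => \sum_(i <- r) g i s) (\sum_(i <- r) a0 i) (\sum_(i <- r) a1 i).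
Proof.
move=> hg; elim: r => [|i r IH].
  rewrite !big_nil; apply: jet_ext ltr01 _ (jet_cst 0) => s _.
  by rewrite big_nil.
rewrite !big_cons; apply: jet_ext ltr01 _ (jetD (hg i) IH) => s _.
by rewrite big_cons.
Qed.

(** Evaluation at 0 gives the constant terms; subtracting the two expansions then bounds |s| |a1 -
    b1| by a multiple of s ^ 2. *)
Lemma jet_uniq g a0 a1 b0 b1 : jet g a0 a1 -> jet g b0 b1 ->
  a0 = b0 /\ a1 = b1.
Proof.
move=> [C [r [C0 r0 hg]]] [D [r' [D0 r'0 hh]]].
have at0 c0 c1 E : normc (g 0 - (c0 + 0%:C * c1)) <= E * 0 ^+ 2 -> g 0 = c0.
  rewrite expr0n mulr0 mul0r addr0 => h.
  have /eq0_normc/eqP : normc (g 0 - c0) = 0 by apply/eqP; rewrite eq_le h normc_ge0.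
  by rewrite subr_eq0 => /eqP.
have ga : g 0 = a0 by apply: at0 (hg 0 _); rewrite normr0.
have gb : g 0 = b0 by apply: at0 (hh 0 _); rewrite normr0.
split; first by rewrite -ga -gb.
apply/eqP; rewrite -subr_eq0; apply/eqP/eq0_normc/eqP.
rewrite eq_le normc_ge0 andbT leNgt; apply/negP => d0.
set d := normc _ in d0; pose M := C + D + 1.
have M0 : 0 < M by rewrite ltr_wpDl// addr_ge0.
(* At this s the bound d <= (C + D) s gives d <= d / 2, contradicting d > 0. *)
pose s := Num.min (Num.min (r / 2) (r' / 2)) (d / (2 * M)).
have s0 : 0 < s by rewrite !lt_min !divr_gt0// mulr_gt0.
have sr : `|s| < r.
  rewrite gtr0_norm// (@le_lt_trans _ _ (r / 2))// ?ltr_pdivrMr ?ltr_pMr ?ltr1n//.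
  by rewrite /s !ge_min lexx.
have sr' : `|s| < r'.
  rewrite gtr0_norm// (@le_lt_trans _ _ (r' / 2))// ?ltr_pdivrMr ?ltr_pMr ?ltr1n//.
  by rewrite /s !ge_min lexx orbT.
have sd : s <= d / (2 * M) by rewrite /s ge_min lexx orbT.
have : s * d <= (C + D) * s ^+ 2.
  have -> : s * d = normc (s%:C * (a1 - b1)).
    by rewrite normcM normc_real gtr0_norm.
  have -> : s%:C * (a1 - b1) =
      (g s - (b0 + s%:C * b1)) - (g s - (a0 + s%:C * a1)).
    by rewrite -ga -gb; ring.
  by rewrite (le_trans (normcB_triangle _ _))// addrC mulrDl lerD ?hg ?hh.
rewrite expr2 mulrCA ler_pM2l// => h.
have : d <= M * (d / (2 * M)).
  apply: (le_trans h); apply: ler_pM => //; [exact: addr_ge0|exact: ltW|].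
  by rewrite /M lerDl.
have -> : M * (d / (2 * M)) = d / 2 by field; rewrite gt_eqF.
by move=> hd; move: d0; lra.
Qed.

(** The mean value theorem between 0 and x, on either side of 0. Applied repeatedly it yields the
    bounds on sin x, cos x - 1 and sin x - x, with constants that are not sharp. *)
Lemma mvt_bound (g dg : R -> R) n : (forall x : R, is_derive x (1 : R) g (dg x)) ->
  g 0 = 0 -> (forall x, `|dg x| <= `|x| ^+ n) -> forall x, `|g x| <= `|x| ^+ n.+1.
Proof.
move=> hd g0 hb x.
have cg (A : set R) : {within A, continuous g}.
  apply: continuous_subspaceT => y.
  by apply: differentiable_continuous; apply/derivable1_diffP.
have key (a b : R) : a < b -> g a = 0 \/ g b = 0 -> (forall c, a < c < b ->
    `|c| <= `|x|) -> b - a = `|x| -> `|g b - g a| <= `|x| ^+ n.+1.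
  move=> ab gab cx ba.
  have [c] := MVT ab (fun y _ => hd y) (cg _).
  rewrite in_itv/= => cab ->; rewrite normrM ba normr_id exprSr.
  rewrite ler_wpM2r// (le_trans (hb c))// lerXn2r ?nnegrE//.
  exact: cx.
have [x0|x0|->] := ltgtP x 0.
- rewrite -normrN -sub0r -g0; apply: (key x 0 x0 (or_intror g0)).
    by move=> c /andP[xc c0]; rewrite !ltr0_norm// lerN2 ltW.
  by rewrite sub0r ltr0_norm.
- rewrite -[g x]subr0 -g0; apply: (key 0 x x0 (or_introl g0)).
    by move=> c /andP[c0 cx]; rewrite !gtr0_norm// ltW.
  by rewrite subr0 gtr0_norm.
- by rewrite g0 normr0 exprn_ge0.
Qed.

Lemma sin_bound (x : R) : `|sin x| <= `|x|.
Proof.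
rewrite -[leRHS]expr1; apply: (@mvt_bound sin cos 0) => [|y].
  exact: sin0.
exact: cos_max.
Qed.

(** The case n = 0 feeds the bound on sin x - x, the case n = 1 gives the quadratic remainder of the
    cosine. *)
Lemma cosB1_bound n (x : R) : (n <= 1)%N -> `|cos x - 1| <= `|x| ^+ n.+1.
Proof.
move=> n1; apply: (@mvt_bound (fun x => cos x - 1) (fun x => - sin x) n) => [y||y].
- rewrite -[- sin y]subr0; exact: is_deriveB.
- by rewrite cos0 subrr.
- rewrite normrN; case: n n1 => [|[|//]] _; first exact: sin_max.
  exact: sin_bound.
Qed.

Lemma sinBx_bound (x : R) : `|sin x - x| <= `|x| ^+ 2.
Proof.
apply: (@mvt_bound (fun x => sin x - x) (fun x => cos x - 1) 1) => [|y].
- by rewrite sin0 subrr.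
- exact: (@cosB1_bound 0).
Qed.

Lemma cis_bound (x : R) : normc (cis x - (1 + x *i)) <= 2 * x ^+ 2.
Proof.
rewrite (le_trans (normc_le_ReIm _))// creD cimD creN cimN /cis /cexp /= expR0 !mul1r.
rewrite addr0 add0r mulr_natl mulr2n lerD//.
  by rewrite (le_trans (@cosB1_bound 1 x _))// real_normK ?num_real.
by rewrite (le_trans (sinBx_bound x))// real_normK ?num_real.
Qed.

Lemma jet_cis (c : R) : jet (fun s => cis (c * s)) 1 (c *i).
Proof.
exists (2 * c ^+ 2), 1; split => // [|s _]; first by rewrite mulr_ge0// sqr_ge0.
have -> : s%:C * c *i = (c * s) *i by apply: complexP; rewrite ?creM ?cimM/=; ring.
by rewrite (le_trans (cis_bound _))// exprMn mulrA.
Qed.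

End Jets.

(** * Series with exponentially decaying terms *)

Section DominatedSums.
Variable R : realType.
Implicit Types (u v w : nat -> R[i]) (b : nat -> R).

Lemma csumD u v : ccvg_series u -> ccvg_series v ->
  ccvg_series (fun n => u n + v n) /\ csum (fun n => u n + v n) = csum u + csum v.
Proof.
move=> [u1 u2] [v1 v2].
have E (x y : nat -> R) : series (fun n => x n + y n) =
    (fun N => series x N + series y N).
  by apply/funext => N; rewrite !seriesEord/= -big_split.
apply: ccvg_seriesP.
  under eq_fun do rewrite creD.
  by rewrite E creD /csum/=; apply: cvgD.
under eq_fun do rewrite cimD.
by rewrite E cimD /csum/=; apply: cvgD.
Qed.

(** The factor 2 comes from bounding real and imaginary parts separately. *)
Lemma ccvg_dominated w b : (forall n, normc (w n) <= b n) -> cvgn (series b) ->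
  ccvg_series w /\ normc (csum w) <= 2 * limn (series b).
Proof.
move=> wb cb.
have key (P : R[i] -> R) : (forall z, `|P z| <= normc z) ->
    cvgn (series (fun n => P (w n))) /\
    `|limn (series (fun n => P (w n)))| <= limn (series b).
  move=> hP; have le n : `|P (w n)| <= b n by exact: le_trans (wb n).
  have cn : cvgn [normed series (fun n => P (w n))].
    apply: (@series_le_cvg _ (fun n => `|P (w n)|) b) => //.
    by move=> n; exact: le_trans (normr_ge0 _) (le n).
  split; first exact: normed_cvg.
  by rewrite (le_trans (lim_series_norm cn))// lim_series_le.
have [c1 l1] := key _ (@normr_Re_le R); have [c2 l2] := key _ (@normr_Im_le R).
split; first by split.
by rewrite (le_trans (normc_le_ReIm _))// mulr_natl mulr2n lerD.
Qed.

Lemma cvg_series_expR (C d : R) : 0 < d ->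
  cvgn (series (fun n => C * expR (- d * n%:R))).
Proof.
move=> d0; have -> : (fun n => C * expR (- d * n%:R)) = geometric C (expR (- d)).
  by apply/funext => n; rewrite /= expRM_natr.
apply: is_cvg_geometric_series; rewrite ger0_norm ?expR_ge0//.
by rewrite expR_lt1 oppr_lt0.
Qed.

(** Half of the exponent absorbs the square, by y ^ 2 <= 2! e ^ y at y = d (n + 1) / 2. *)
Lemma sqr_expR_le (d : R) n : 0 < d ->
  n.+1%:R ^+ 2 * expR (- d * n%:R) <=
  2 * (2 / d) ^+ 2 * expR (d / 2) * expR (- (d / 2) * n%:R).
Proof.
move=> d0.
have x0 : 0 <= d / 2 * n.+1%:R by rewrite mulr_ge0// divr_ge0// ltW.
have := expr_le_expR 1 x0; rewrite exprMn => h.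
have -> : n.+1%:R ^+ 2 = (2 / d) ^+ 2 * ((d / 2) ^+ 2 * n.+1%:R ^+ 2) :> R.
  by field; rewrite gt_eqF.
have -> : 2 * (2 / d) ^+ 2 * expR (d / 2) * expR (- (d / 2) * n%:R) =
    (2 / d) ^+ 2 * (2 * expR (d / 2 * n.+1%:R)) * expR (- d * n%:R).
  have : expR (d / 2 * n.+1%:R) * expR (- d * n%:R) =
    expR (d / 2) * expR (- (d / 2) * n%:R).
    by rewrite -!expRD -natr1; congr expR; field.
  by move=> e; rewrite -[RHS]mulrA -[X in _ = _ * X]mulrA e; ring.
rewrite ler_wpM2r ?expR_ge0// ler_wpM2l ?sqr_ge0//.
Qed.

Definition exp_decay u := exists C d : R, [/\ 0 <= C, 0 < d &
  forall n, normc (u n) <= C * expR (- d * n%:R)].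

(** The remainder of e ^ (i th s) is at most 2 th ^ 2 s ^ 2, so the expansions add up termwise
    because (n + 1) ^ 2 times the exponential decay is summable. *)
Lemma csum_jet u (th : nat -> R) (A : R) : exp_decay u -> 0 <= A ->
  (forall n, `|th n| <= A * n.+1%:R) ->
  ccvg_series (fun n => u n * (th n)%:C) /\
  jet (fun s => csum (fun n => u n * cis (th n * s))) (csum u)
    ('i * csum (fun n => u n * (th n)%:C)).
Proof.
move=> [C [d [C0 d0 hu]]] A0 hth.
pose b n := n.+1%:R ^+ 2 * expR (- d * n%:R).
have b0 n : 0 <= b n by rewrite mulr_ge0 ?expR_ge0// sqr_ge0.
have cb c : 0 <= c -> cvgn (series (fun n => c * b n)).
  move=> c0; pose c' := c * (2 * (2 / d) ^+ 2 * expR (d / 2)).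
  have d20 : 0 < d / 2 by rewrite divr_gt0.
  have c'0 : 0 <= c' by rewrite /c' !mulr_ge0 ?expR_ge0 ?invr_ge0 ?(ltW d0).
  apply: (@series_le_cvg _ _ (fun n => c' * expR (- (d / 2) * n%:R))).
  - by move=> n; rewrite mulr_ge0.
  - by move=> n; rewrite mulr_ge0 ?expR_ge0.
  - by move=> n; rewrite -mulrA ler_wpM2l// sqr_expR_le.
  - exact: cvg_series_expR.
have n1 n : (1 : R) <= n.+1%:R by rewrite ler1n.
have ub n : normc (u n) <= C * b n.
  rewrite (le_trans (hu n))// ler_wpM2l// ler_peMl ?expR_ge0//.
  by rewrite exprn_ege1.
have [cu _] := ccvg_dominated ub (cb _ C0).
have utb n : normc (u n * (th n)%:C) <= C * A * b n.
  rewrite normcM normc_real.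
  have -> : C * A * b n = (C * expR (- d * n%:R)) * (A * n.+1%:R ^+ 2).
    by rewrite /b; ring.
  rewrite ler_pM ?normc_ge0// (le_trans (hth n))// ler_wpM2l//.
  by rewrite expr2 ler_peMl// ltW.
have [cut _] := ccvg_dominated utb (cb _ (mulr_ge0 C0 A0)).
split => //.
have D0 : 0 <= 2 * (C * A ^+ 2) by rewrite !mulr_ge0// sqr_ge0.
exists (2 * limn (series (fun n => 2 * (C * A ^+ 2) * b n))), 1.
have lim0 : 0 <= limn (series (fun n => 2 * (C * A ^+ 2) * b n)).
  rewrite (le_trans _ (nondecreasing_cvgn_le _ (cb _ D0) 0%N))//.
    by rewrite seriesEord/= big_ord0.
  by apply: nondecreasing_series => n _ _; rewrite mulr_ge0.
split => // [|s _]; first by rewrite mulr_ge0.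
pose w n := u n * (cis (th n * s) - (1 + (th n * s) *i)).
have wb n : normc (w n) <= s ^+ 2 * (2 * (C * A ^+ 2) * b n).
  rewrite normcM.
  have -> : s ^+ 2 * (2 * (C * A ^+ 2) * b n) =
    (C * expR (- d * n%:R)) * (2 * ((A * n.+1%:R) ^+ 2 * s ^+ 2)) by rewrite /b; ring.
  rewrite ler_pM ?normc_ge0// (le_trans (cis_bound _))// exprMn.
  rewrite ler_wpM2l// ler_wpM2r ?sqr_ge0//.
  by rewrite -real_normK ?num_real// lerXn2r ?nnegrE ?mulr_ge0.
have cs2 : cvgn (series (fun n => s ^+ 2 * (2 * (C * A ^+ 2) * b n))).
  exact: (@is_cvg_seriesZ _ _ (s ^+ 2) (cb _ D0)).
have [cw wl] := ccvg_dominated wb cs2.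
have [c1 e1] := csumMr (s%:C * 'i) cut.
have [c2 e2] := csumD cu c1.
have [c3 e3] := csumD cw c2.
have -> : csum (fun n => u n * cis (th n * s)) =
    csum (fun n => w n + (u n + u n * (th n)%:C * (s%:C * 'i))).
  apply: csum_ext => n; rewrite /w.
  have -> : (th n * s) *i = (th n)%:C * (s%:C * 'i).
    by apply: complexP; rewrite ?creM ?cimM/= ?creM ?cimM/=; ring.
  by ring.
rewrite e3 e2 e1 (_ : _ - _ = csum w); last by ring.
rewrite (le_trans wl)// (_ : limn _ =
  s ^+ 2 * limn (series (fun n => 2 * (C * A ^+ 2) * b n))).
  by rewrite mulrCA mulrC.
exact: (@lim_seriesZ _ _ (s ^+ 2) (cb _ D0)).
Qed.

End DominatedSums.

(** * First-order expansion of real-analytic functions *)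

Section AnalyticJet.
Variable R : realType.
Implicit Types (g : R[i] -> R[i]) (tau : R[i]).

(** The remainder is linear in dv but quadratic in du: on the arcs through i y, du is of first order
    in the angle and dv of second order, so this is a quadratic remainder in the angle. *)
Lemma real_analytic_expansion g (y : R) : real_analytic g -> 0 < y ->
  exists a10 B r, [/\ 0 <= B, 0 < r & forall du dv : R, `|du| < r -> `|dv| < r ->
    normc (g (du +i* (y + dv)) - (g (0 +i* y) + du%:C * a10))
    <= B * (`|dv| + du ^+ 2)].
Proof.
move=> hg y0.
have [r0 [a [r00 [B hB] ha]]] := hg (0 +i* y) y0.
(* Staying below y keeps y + dv positive. *)
pose r := Num.min r0 y.
have r_0 : 0 < r by rewrite lt_min r00.
have B0 : 0 <= B by apply: le_trans (hB 0%N); rewrite big_ord0.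
(* Extracting dv from a monomial costs a factor r0 ^ -1, extracting du ^ 2 a factor r0 ^ -2. *)
pose B1 := B * (r0^-1 + r0 ^- 2).
have B10 : 0 <= B1 by rewrite mulr_ge0// addr_ge0// ?invr_ge0 ?sqr_ge0// ltW.
pose pt n (du dv : R) : R[i] := \sum_(p < n) \sum_(q < n)
            a p q * (du ^+ p * dv ^+ q)%:C.
(* [n.+2] ensures that the monomial du is among the terms. *)
have bound n (du dv : R) : `|du| < r -> `|dv| < r ->
    normc (pt n.+2 du dv - (a 0%N 0%N + du%:C * a 1%N 0%N)) <= B1 * (`|dv| + du ^+ 2).
  move=> hu hv.
  have ur : `|du| <= r0 by rewrite ltW// (lt_le_trans hu)// ge_min lexx.
  have vr : `|dv| <= r0 by rewrite ltW// (lt_le_trans hv)// ge_min lexx.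
  (* Apart from the monomials 1 and du, each one is divisible by dv or by du ^ 2. *)
  pose low p q := ((p == 0%N) || (p == 1%N)) && (q == 0%N).
  pose t p q := a p q * (du ^+ p * dv ^+ q)%:C.
  pose c p q : R[i] := if low p q then 0 else t p q.
  pose e p q : R[i] := if low p q then t p q else 0.
  have -> : pt n.+2 du dv - (a 0%N 0%N + du%:C * a 1%N 0%N) =
      \sum_(p < n.+2) \sum_(q < n.+2) c p q.
    have inner p : \sum_(q < n.+2) e p q =
        if (p == 0%N) || (p == 1%N) then a p 0%N * (du ^+ p)%:C else 0.
      rewrite big_ord_recl big1 ?addr0.
        by rewrite /e /low/= andbT; case: ifP => // _; rewrite /t expr0 mulr1.
      by move=> q _; rewrite /e /low andbF.
    have -> : a 0%N 0%N + du%:C * a 1%N 0%N = \sum_(p < n.+2) \sum_(q < n.+2) e p q.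
      under eq_bigr do rewrite inner.
      rewrite 2!big_ord_recl big1//= !addr0 expr0 expr1 mulr1.
      by rewrite mulrC.
    rewrite /pt -sumrB; apply: eq_bigr => p _; rewrite -sumrB.
    apply: eq_bigr => q _; rewrite /e /c -/(t p q).
    by case: ifP => _; rewrite ?subrr ?subr0.
  rewrite (le_trans (normc_sum_le _ _ _))//.
  apply: (@le_trans _ _ (\sum_(p < n.+2) \sum_(q < n.+2)
      normc (a p q) * r0 ^+ (p + q) * ((r0^-1 + r0 ^- 2) * (`|dv| + du ^+ 2)))).
    apply: ler_sum => p _; rewrite (le_trans (normc_sum_le _ _ _))//.
    apply: ler_sum => q _; rewrite /c.
    have RHS0 : 0 <= normc (a p q) * r0 ^+ (p + q) *
        ((r0^-1 + r0 ^- 2) * (`|dv| + du ^+ 2)).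
      have rge := ltW r00.
      apply: mulr_ge0; first by rewrite mulr_ge0 ?normc_ge0// exprn_ge0.
      by apply: mulr_ge0; rewrite addr_ge0 ?invr_ge0 ?sqr_ge0.
    case: ifPn => lpq; first by rewrite normc0.
    rewrite /t normcM normc_real -mulrA ler_wpM2l ?normc_ge0// normrM !normrX.
    have i0 : 0 <= r0^-1 by rewrite invr_ge0 ltW.
    have [q0|q0] := posnP q; last first.
      apply: (@le_trans _ _ (r0 ^+ (p + q) * (r0^-1 * `|dv|))); last first.
        rewrite ler_wpM2l ?exprn_ge0 ?(ltW r00)//.
        by rewrite ler_pM// ?lerDl ?lerDl ?invr_ge0 ?sqr_ge0.
      rewrite -(prednK q0) exprD exprSr [_ ^+ q.-1.+1]exprSr.
      rewrite -!mulrA (mulrA r0 r0^-1) mulfV ?gt_eqF// mul1r.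
      rewrite ler_pM ?mulr_ge0 ?exprn_ge0 ?lerXn2r ?nnegrE ?(ltW r00)//.
      by rewrite ler_wpM2r// lerXn2r ?nnegrE ?(ltW r00).
    have p2 : (2 <= p)%N.
      by move: lpq; rewrite /low q0 eqxx andbT; case: (nat_of_ord p) => [|[|]].
    rewrite q0 expr0 mulr1 addn0.
    apply: (@le_trans _ _ (r0 ^+ p * (r0 ^- 2 * du ^+ 2))); last first.
      rewrite ler_wpM2l ?exprn_ge0 ?(ltW r00)//.
      by rewrite ler_pM// ?lerDr ?lerDr ?invr_ge0 ?sqr_ge0 ?(ltW r00).
    rewrite -(subnK p2) !exprD -[du ^+ 2]real_normK ?num_real//.
    have -> : r0 ^+ (p - 2) * r0 ^+ 2 * (r0 ^- 2 * `|du| ^+ 2) =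
        r0 ^+ (p - 2) * `|du| ^+ 2 by field; rewrite gt_eqF.
    by rewrite ler_wpM2r ?sqr_ge0// lerXn2r ?nnegrE ?(ltW r00).
  under eq_bigr do rewrite -mulr_suml.
  rewrite -mulr_suml /B1 -mulrA ler_wpM2r//.
  by rewrite mulr_ge0// addr_ge0// ?invr_ge0 ?sqr_ge0// ltW.
pose B2 := 2 * B1.
have conv du dv : `|du| < r -> `|dv| < r ->
    normc (g (du +i* (y + dv)) - (a 0%N 0%N + du%:C * a 1%N 0%N))
    <= B2 * (`|dv| + du ^+ 2).
  move=> hu hv.
  have up : upper (du +i* (y + dv)).
    rewrite /upper/=; move: hv; rewrite lt_min => /andP[_].
    by rewrite ltr_norml => /andP[h _]; rewrite -ltrBlDl sub0r.
  have := ha _ up; rewrite /= subr0 (addrC y) addrK.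
  move=> /(_ _ _)[||c1 c2].
  - by rewrite (lt_le_trans hu)// ge_min lexx.
  - by rewrite (lt_le_trans hv)// ge_min lexx.
  rewrite (le_trans (normc_le_ReIm _))// /B2 -mulrA mulr_natl mulr2n.
  set e := a 0%N 0%N + _.
  have key (P : R[i] -> R) : (P = @Re R \/ P = @Im R) ->
    ((fun n => P (pt n du dv)) @ \oo --> P (g (du +i* (dv + y)))) ->
    `|P (g (du +i* (dv + y)) - e)| <= B1 * (`|dv| + du ^+ 2).
    move=> PE cP.
    have PB z1 z2 : P (z1 - z2) = P z1 - P z2.
      by case: PE => ->; rewrite ?creD ?cimD ?creN ?cimN.
    have cP' : (fun n => `|P (pt n du dv) - P e|) @ \oo -->
        `|P (g (du +i* (dv + y))) - P e|.
      by apply: cvg_norm; apply: cvgB => //; exact: cvg_cst.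
    rewrite PB -(cvg_lim _ cP')//.
    apply: limr_le; first by apply/cvg_ex; eexists; exact: cP'.
    near=> n; rewrite -PB.
    have n2 : (2 <= n)%N by near: n; exact: nbhs_infty_ge.
    rewrite -(subnK n2) addn2.
    apply: le_trans (bound (n - 2)%N du dv hu hv).
    by case: PE => ->; [exact: normr_Re_le|exact: normr_Im_le].
  by rewrite lerD// key//; [left|right].
exists (a 1%N 0%N), B2, r; split => //; first by rewrite mulr_ge0.
(* At du = dv = 0 the remainder vanishes, which identifies the constant coefficient with the value
   at i y. *)
have := conv 0 0; rewrite normr0 addr0 => /(_ r_0 r_0).
rewrite mul0r addr0 add0r expr0n mulr0 => h.
have /eq0_normc/eqP : normc (g (0 +i* y) - a 0%N 0%N) = 0.
  by apply/eqP; rewrite eq_le h normc_ge0.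
by rewrite subr_eq0 => /eqP ->; exact: conv.
Unshelve. all: by end_near.
Qed.

End AnalyticJet.

(** * Decay of the Fourier terms and the derivative in u *)

Section Decay.
Variables (R : realType) (m : nat) (k : R) (kappa : 'I_m -> R).
Variables (f : R[i] -> 'cV[R[i]]_m) (cp cm : 'I_m -> int -> R[i]).
Hypothesis hkappa : forall j, 0 <= kappa j < 1.
Hypothesis hc : fourier_expansion k kappa f cp cm.
Implicit Types (j : 'I_m) (y : R).
Local Notation nu := (freq kappa).

Lemma freq_Posz j (n : nat) : n%:R <= nu j (Posz n).
Proof. by rewrite /freq lerDl; case/andP: (hkappa j). Qed.

Lemma freq_NegzE j (n : nat) : nu j (Negz n) = - n.+1%:R + kappa j.
Proof. by rewrite /freq NegzE mulrNz. Qed.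

Lemma freq_Negz j (n : nat) : n%:R < - nu j (Negz n).
Proof.
by rewrite freq_NegzE opprD opprK -natr1 -addrA ltrDl subr_gt0; case/andP: (hkappa j).
Qed.

Lemma negfreq_Negz j n : negfreq kappa j (Negz n).
Proof. by rewrite /negfreq -oppr_gt0 (le_lt_trans _ (freq_Negz j n)). Qed.

Lemma negfreq_Posz j (n : nat) : negfreq kappa j (Posz n) = false.
Proof.
by apply/negbTE; rewrite /negfreq -leNgt (le_trans _ (freq_Posz j n)).
Qed.

Lemma normr_freq_le j (n : nat) h : half_index h -> `|nu j (h n)| <= n.+1%:R.
Proof.
have /andP[k0 k1] := hkappa j.
case=> ->.
  rewrite ger0_norm ?(le_trans _ (freq_Posz j n))//.
  by rewrite /freq -natr1 lerD2l ltW.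
rewrite ltr0_norm; last exact: negfreq_Negz.
by rewrite freq_NegzE opprD opprK lerBlDr lerDl.
Qed.

Lemma ccvg_bounded (u : nat -> R[i]) : ccvg_series u ->
  exists2 B : R, 0 <= B & forall n, normc (u n) <= B.
Proof.
move=> [/cvg_series_bounded[M1 [_ h1]] /cvg_series_bounded[M2 [_ h2]]].
have b1 n := h1 (`|M1| + 1) (ltr_pwDr ltr01 (ler_norm M1)) n I.
have b2 n := h2 (`|M2| + 1) (ltr_pwDr ltr01 (ler_norm M2)) n I.
exists (`|M1| + 1 + (`|M2| + 1)); first by rewrite !addr_ge0.
by move=> n; rewrite (le_trans (normc_le_ReIm _))// lerD//; [exact: b1|exact: b2].
Qed.

Lemma exp_decay_finite (u : nat -> R[i]) N :
  (forall n, (N <= n)%N -> u n = 0) -> exp_decay u.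
Proof.
move=> hu; exists (\sum_(i < N) normc (u i) * expR i%:R), 1.
have t0 (i : nat) : 0 <= normc (u i) * expR i%:R.
  by rewrite mulr_ge0 ?normc_ge0// expR_ge0.
split => //; first exact: sumr_ge0.
move=> n; have [Nn|nN] := leqP N n.
  by rewrite hu// normc0 mulr_ge0 ?expR_ge0// sumr_ge0.
rewrite mulN1r expRN -[leLHS](mulfK (lt0r_neq0 (expR_gt0 n%:R))).
rewrite ler_wpM2r ?invr_ge0 ?expR_ge0//.
by rewrite (bigD1 (Ordinal nN))//= lerDl sumr_ge0.
Qed.

(** Terms of a convergent series are bounded, and the expansion converges at every height e > 0. *)
Lemma plus_coef_bound j (e : R) : 0 < e -> exists2 B : R, 0 <= B &
  forall n, normc (cp j (Posz n)) * pkern kappa j (Posz n) e <= B.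
Proof.
move=> e0; have [[c _] _ _] := csumZ_terms_at_iy hc j e0.
have [B B0 hB] := ccvg_bounded c; exists B => // n.
by have := hB n; rewrite /restrZ normcM normc_real ger0_norm// expR_ge0.
Qed.

Lemma minus_coef_bound j (e : R) : 0 < e -> exists2 B : R, 0 <= B &
  forall n, normc (cm j (Negz n)) * mkern k kappa j (Negz n) e <= B.
Proof.
move=> e0; have [_ [_ c] _] := csumZ_terms_at_iy hc j e0.
have [B B0 hB] := ccvg_bounded c; exists B => // n.
have := hB n; rewrite /restrZ negfreq_Negz normcM normc_real ger0_norm//.
exact: mker_ge0.
Qed.

Lemma plus_coef_Negz j : exists N, forall n, (N <= n)%N -> cp j (Negz n) = 0.
Proof.
have [[n1 h1] _] := hc; exists `|n1|%N => n hn; apply: h1.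
rewrite NegzE; lia.
Qed.

(** Passing from y to y / 2 only increases K and leaves half of the exponential as a gain, so
    boundedness at height y / 2 becomes exponential decay at height y. *)
Lemma mker_decay (s y : R) : 0 < s -> 0 < y ->
  mker k s y <= 2 `^ (1 - k) * expR (- s * (y / 2)) * mker k s (y / 2).
Proof.
move=> s0 y0; have y20 : 0 < y / 2 by rewrite divr_gt0.
rewrite /mker /nker.
have -> : y `^ (1 - k) = 2 `^ (1 - k) * (y / 2) `^ (1 - k).
  by rewrite -powRM ?ltW// mulrC divfK.
have -> : expR (- s * y) = expR (- s * (y / 2)) * expR (- s * (y / 2)).
  by rewrite -expRD -mulrDr; congr (expR (_ * _)); field.
have K : Kfun k (2 * s * y) <= Kfun k (2 * s * (y / 2)).
  apply: Kfun_nonincreasing; first by rewrite !mulr_gt0.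
  by rewrite ler_pM2l ?mulr_gt0// ler_pdivrMr// ler_peMr ?ltW// ltr1n.
rewrite [leRHS](_ : _ = (2 * s) `^ (1 - k) * (2 `^ (1 - k) * (y / 2) `^ (1 - k) *
  (expR (- s * (y / 2)) * expR (- s * (y / 2)) * Kfun k (2 * s * (y / 2))))); last by ring.
rewrite ler_wpM2l ?powR_ge0// ler_wpM2l ?mulr_ge0 ?powR_ge0//.
by rewrite ler_wpM2l ?mulr_ge0 ?expR_ge0.
Qed.

Lemma plus_decay j y h : half_index h -> 0 < y -> exp_decay
  (fun n => restrZ xpredT (fun n => cp j n * (pkern kappa j n y)%:C) (h n)).
Proof.
move=> hh y0; case: hh => ->; last first.
  have [N hN] := plus_coef_Negz j.
  by apply: (@exp_decay_finite _ N) => n /hN; rewrite /restrZ => ->; rewrite mul0r.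
have y20 : 0 < y / 2 by rewrite divr_gt0.
have [B B0 hB] := plus_coef_bound j y20.
(* Height y / 2 bounds the coefficient; the factor e ^ (- pi nu y) is left over. *)
exists B, (pi * y); split => //; first by rewrite mulr_gt0// pi_gt0.
move=> n; rewrite /restrZ normcM normc_real ger0_norm ?expR_ge0//.
have -> : pkern kappa j n y =
    pkern kappa j n (y / 2) * expR (- (pi * y) * nu j n).
  by rewrite /pkern -expRD; congr expR; field.
rewrite mulrA ler_pM ?mulr_ge0 ?normc_ge0 ?expR_ge0// ?hB//.
rewrite ler_expR !mulNr lerN2 ler_wpM2l ?freq_Posz//.
by rewrite mulr_ge0 ?ltW// pi_gt0.
Qed.

Lemma minus_decay j y h : half_index h -> 0 < y -> exp_decay
  (fun n => restrZ (negfreq kappa j)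
     (fun n => cm j n * (mkern k kappa j n y)%:C) (h n)).
Proof.
move=> hh y0; case: hh => ->.
  apply: (@exp_decay_finite _ 0%N) => n _.
  by rewrite /restrZ negfreq_Posz.
have y20 : 0 < y / 2 by rewrite divr_gt0.
have [B B0 hB] := minus_coef_bound j y20.
exists (B * 2 `^ (1 - k)), (pi * y); split => //.
- by rewrite mulr_ge0// powR_ge0.
- by rewrite mulr_gt0// pi_gt0.
move=> n; rewrite /restrZ negfreq_Negz normcM normc_real ger0_norm ?mker_ge0//.
have s0 := negfreq_arg_gt0 (negfreq_Negz j n).
set s := - (2 * pi * nu j (Negz n)) in s0.
apply: (@le_trans _ _ (normc (cm j (Negz n)) *
    (2 `^ (1 - k) * expR (- s * (y / 2)) * mkern k kappa j (Negz n) (y / 2)))).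
  by rewrite ler_wpM2l ?normc_ge0// mker_decay.
rewrite (_ : _ * _ = (normc (cm j (Negz n)) * mkern k kappa j (Negz n) (y / 2)) *
  2 `^ (1 - k) * expR (- s * (y / 2))); last by ring.
rewrite ler_pM ?mulr_ge0 ?normc_ge0 ?expR_ge0 ?mker_ge0 ?powR_ge0 ?Kfun_ge0//.
  by rewrite ler_wpM2r ?powR_ge0.
rewrite ler_expR /s (_ : - - (2 * pi * nu j (Negz n)) * (y / 2) =
  pi * y * nu j (Negz n)); last by field.
rewrite mulNr -mulrN ler_wpM2l//; first by rewrite mulr_ge0 ?ltW// pi_gt0.
by rewrite lerNr ltW// freq_Negz.
Qed.

(** This is (2 pi i) ^ -1 times the derivative of f in u at i y, as [fourier_jet] shows. *)
Definition freq_sum j y : R[i] :=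
  kernel_sum k kappa (fun n => cp j n * (nu j n)%:C)
    (fun n => cm j n * (nu j n)%:C) j y.

Lemma half_sum_jet (P : pred int) (c : int -> R[i]) (ker : int -> R) j h :
  half_index h -> exp_decay (fun n => restrZ P (fun n => c n * (ker n)%:C) (h n)) ->
  ccvg_series (fun n => restrZ P (fun n => c n * (nu j n)%:C * (ker n)%:C) (h n)) /\
  jet (fun s => csum (fun n => restrZ P (fun n =>
         c n * (ker n)%:C * cis (2 * pi * nu j n * s)) (h n)))
      (csum (fun n => restrZ P (fun n => c n * (ker n)%:C) (h n)))
      ((2 * pi) *i * csum (fun n => restrZ P (fun n =>
         c n * (nu j n)%:C * (ker n)%:C) (h n))).
Proof.
move=> hh dec.
have pi20 : 0 < 2 * pi :> R by rewrite mulr_gt0// pi_gt0.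
have thb n : `|2 * pi * nu j (h n)| <= 2 * pi * n.+1%:R.
  by rewrite normrM (gtr0_norm pi20) ler_pM2l// normr_freq_le.
have [cv jt] := csum_jet dec (ltW pi20) thb.
have [cv' e] := csumMr ((2 * pi)^-1)%:C cv.
have E n : restrZ P (fun n => c n * (ker n)%:C) (h n) * (2 * pi * nu j (h n))%:C
    * ((2 * pi)^-1)%:C = restrZ P (fun n => c n * (nu j n)%:C * (ker n)%:C) (h n).
  rewrite /restrZ; case: ifP => _; last by rewrite !mul0r.
  rewrite -mulrA -rmorphM/= (_ : 2 * pi * nu j (h n) * (2 * pi)^-1 = nu j (h n)).
    by rewrite mulrAC.
  by rewrite mulrAC mulfV ?mul1r// gt_eqF.
split; first by rewrite -(funext E).
have -> : (2 * pi) *i * csum (fun n => restrZ P (fun n =>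
         c n * (nu j n)%:C * (ker n)%:C) (h n)) = 'i * csum (fun n =>
    restrZ P (fun n => c n * (ker n)%:C) (h n) * (2 * pi * nu j (h n))%:C).
  have -> : (2 * pi) *i = 'i * (2 * pi)%:C :> R[i].
    by apply: complexP; rewrite ?creM ?cimM/=; ring.
  rewrite -(csum_ext E) e mulrACA -rmorphM/= mulfV ?gt_eqF//.
  by rewrite mulr1.
apply: jet_ext ltr01 _ jt => s _; apply: csum_ext => n.
by rewrite /restrZ; case: ifP => _; rewrite ?mul0r.
Qed.

Lemma freq_sum_cvg j y : 0 < y ->
  ccvg_sumZ xpredT (fun n => cp j n * (nu j n)%:C * (pkern kappa j n y)%:C) /\
  ccvg_sumZ (negfreq kappa j)
    (fun n => cm j n * (nu j n)%:C * (mkern k kappa j n y)%:C).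
Proof.
move=> y0.
have hp h : half_index h -> _ := fun hh => (half_sum_jet j hh (plus_decay j hh y0)).1.
have hm h : half_index h -> _ := fun hh => (half_sum_jet j hh (minus_decay j hh y0)).1.
by split; split; [apply: hp; left|apply: hp; right|apply: hm; left|apply: hm; right].
Qed.

(** Moving horizontally multiplies each term by e ^ (2 pi i nu u) and leaves its kernel unchanged;
    the expansions of the four half-sums are added. *)
Lemma fourier_jet j y : 0 < y ->
  jet (fun u => f (u +i* y) j 0) (f (0 +i* y) j 0) ((2 * pi) *i * freq_sum j y).
Proof.
move=> y0; have [_ _ fE] := csumZ_terms_at_iy hc j y0.
have hP : half_index Posz by left. have hN : half_index Negz by right.
have [_ j1] := half_sum_jet j hP (plus_decay j hP y0).
have [_ j2] := half_sum_jet j hN (plus_decay j hN y0).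
have [_ j3] := half_sum_jet j hP (minus_decay j hP y0).
have [_ j4] := half_sum_jet j hN (minus_decay j hN y0).
have := jetD (jetD j1 j2) (jetD j3 j4); rewrite -!mulrDr fE.
apply: jet_ext ltr01 _ => s _.
have [_ /(_ (s +i* y) j y0)[_ _ ->]] := hc.
have E1 n : true -> plus_term kappa cp j (s +i* y) n =
    cp j n * (pkern kappa j n y)%:C * cis (2 * pi * nu j n * s).
  by move=> _; rewrite plus_termE.
have E2 n : negfreq kappa j n -> minus_term k kappa cm j (s +i* y) n =
    cm j n * (mkern k kappa j n y)%:C * cis (2 * pi * nu j n * s).
  by move=> nn; rewrite minus_termE.
by rewrite (csumZ_ext E1) (csumZ_ext E2).
Qed.

End Decay.

(** * The action of S *)

Section FunctionalEquation.
Variables (R : realType) (m : nat) (k : R) (chi : 'M[int]_2 -> R[i]).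
Variables (rho : 'M[int]_2 -> 'M[R[i]]_m) (kappa : 'I_m -> R).
Variables (f : R[i] -> 'cV[R[i]]_m) (cp cm : 'I_m -> int -> R[i]).
Implicit Types (j l : 'I_m) (y s : R).

(* y e ^ (i (pi / 2 + s)): along these arcs S acts by (y, s) |-> (1 / y, - s),
   and the automorphy factor is y ^ k e ^ (i k (pi / 2 + s)) exactly. *)
Definition arc (y s : R) : R[i] := (- (y * sin s)) +i* (y * cos s).

Lemma arc0 y : arc y 0 = 0 +i* y.
Proof. by rewrite /arc sin0 cos0 mulr0 mulr1 oppr0. Qed.

Lemma matSE : [/\ matS 0 0 = 0, matS 0 1 = -1, matS 1 0 = 1 & matS 1 1 = 0].
Proof. by rewrite /matS !mxE. Qed.

Lemma SL2Z_matS : SL2Z matS.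
Proof.
rewrite /SL2Z (expand_det_row _ 0) !big_ord_recl big_ord0 /cofactor !det_mx11.
by rewrite /matS !mxE.
Qed.

Lemma autj_S (tau : R[i]) : autj matS tau = tau.
Proof. by have [e1 e2 e3 e4] := matSE; rewrite /autj e3 e4 mul1r addr0. Qed.

Lemma arcM y s : 0 < y -> arc y^-1 (- s) * arc y s = -1.
Proof.
move=> y0; rewrite /arc sinN cosN; apply: complexP; rewrite ?creM ?cimM/=.
  have -> : - (y^-1 * - sin s) * - (y * sin s) - y^-1 * cos s * (y * cos s) =
     - (y^-1 * y) * (cos s ^+ 2 + sin s ^+ 2) by ring.
  by rewrite cos2Dsin2 mulr1 mulVf// gt_eqF.
by rewrite oppr0; ring.
Qed.

Lemma mobius_S y s : 0 < y -> mobius matS (arc y s) = arc y^-1 (- s).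
Proof.
move=> y0; have [e1 e2 _ _] := matSE.
rewrite /mobius autj_S e1 e2 mul0r add0r mulrN1z.
have h := arcM s y0.
have t0 : arc y s != 0.
  by apply/eqP => t0; move/eqP: h; rewrite t0 mulr0 eq_sym oppr_eq0 oner_eq0.
by rewrite -h mulfK.
Qed.

Lemma normc_arc y s : 0 < y -> normc (arc y s) = y.
Proof.
move=> y0; rewrite normc_sqrt /arc/= sqrrN !exprMn -mulrDr addrC cos2Dsin2 mulr1.
by rewrite sqrtr_sqr gtr0_norm.
Qed.

Lemma small_angle s : `|s| < 1 -> - (pi / 2) < s < pi / 2.
Proof.
move=> s1; have := @pihalf_ge1 R; move: s1; rewrite ltr_norml => /andP[s1 s2] p1.
by apply/andP; split; [rewrite (le_lt_trans _ s1)// lerN2|rewrite (lt_le_trans s2)].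
Qed.

Lemma arc_upper y s : 0 < y -> `|s| < 1 -> upper (arc y s).
Proof.
by move=> y0 s1; rewrite /upper/= mulr_gt0// cos_gt0_pihalf// small_angle.
Qed.

(** For |s| < 1 the point has positive imaginary part and its argument s + pi / 2 lies in [0, pi],
    where [acos] inverts [cos]; the principal branch has no jump along the arc. *)
Lemma cpow_arc y s a : 0 < y -> `|s| < 1 ->
  cpow (arc y s) a = (y `^ a)%:C * cis (a * (s + pi / 2)).
Proof.
move=> y0 s1; rewrite /cpow normc_arc//; congr (_ * _).
rewrite /cis; congr (cexp ((a * _) *i)).
rewrite /carg normc_arc// ifT; last exact/ltW/arc_upper.
have -> : Re (arc y s) / y = cos (s + pi / 2).
  by rewrite cosDpihalf /arc/= mulNr mulrC mulKf// gt_eqF.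
have /andP[s2 s3] := small_angle s1.
rewrite cosK// in_itv/=; apply/andP; split; first by rewrite -lerBlDr sub0r ltW.
by rewrite -lerBrDr (le_trans (ltW s3))// le_eqVlt; apply/orP; left; apply/eqP; field.
Qed.

Lemma cpow_i a : cpow 'i a = cis (a * (pi / 2)) :> R[i].
Proof.
have -> : 'i = arc 1 0 by rewrite arc0.
by rewrite cpow_arc ?normr0// powR1 mul1r add0r.
Qed.

Hypothesis hchi : multiplier_system k chi.
Hypothesis hrho : unitary_representation rho.
Hypothesis hslash : forall gam tau, SL2Z gam -> upper tau ->
  slash k chi rho f gam tau = f tau.

Lemma chiS_neq0 : chi matS != 0.
Proof.
apply/eqP => c0; have := hchi.1 _ SL2Z_matS.
by rewrite c0 normc0 => /eqP; rewrite eq_sym oner_eq0.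
Qed.

(** The automorphy factor chi(S) (i y) ^ k. *)
Definition autS (y : R) : R[i] := chi matS * (y `^ k)%:C * cpow 'i k.

(** Invariance under S at tau = [arc y s], solved for the value at - 1 / tau. Splitting tau ^ k into
    y ^ k, i ^ k and e ^ (i k s) isolates the dependence on s. *)
Lemma slash_arc y s : 0 < y -> `|s| < 1 ->
  f (arc y^-1 (- s)) = (autS y * cis (k * s)) *: (rho matS *m f (arc y s)).
Proof.
move=> y0 s1.
rewrite -(hslash SL2Z_matS (arc_upper y0 s1)) /slash mobius_S// autj_S cpow_arc//.
have ru : rho matS \in unitmx.
  by case: hrho => _ _ /(_ _ SL2Z_matS); exact: unitarymx_unit.
rewrite -scalemxAr mulKVmx// scalerA.
rewrite (_ : _ * _ = 1) ?scale1r// /autS cpow_i.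
have yk : (y `^ k)%:C * (y `^ (- k))%:C = 1 :> R[i].
  by rewrite -rmorphM/= -powRD ?subrr ?powRr0// (gt_eqF y0) implybT.
have ck : cis (k * (pi / 2)) * cis (k * s) * cis (- k * (s + pi / 2)) = 1 :> R[i].
  by rewrite -!cisD (_ : _ + _ + _ = 0) ?cis0//; ring.
transitivity (chi matS * (chi matS)^-1 * ((y `^ k)%:C * (y `^ (- k))%:C) *
  (cis (k * (pi / 2)) * cis (k * s) * cis (- k * (s + pi / 2)))); first by ring.
by rewrite yk ck !mulr1 mulfV// chiS_neq0.
Qed.

Lemma form_inv y : 0 < y ->
  f (0 +i* y^-1) = autS y *: (rho matS *m f (0 +i* y)).
Proof.
move=> y0; have := @slash_arc y 0 y0; rewrite normr0 => /(_ ltr01).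
by rewrite oppr0 !arc0 mulr0 cis0 mulr1.
Qed.

Hypothesis hkappa : forall j, 0 <= kappa j < 1.
Hypothesis hana : forall j, real_analytic (fun tau => f tau j 0).
Hypothesis hc : fourier_expansion k kappa f cp cm.

Local Notation fsum := (freq_sum k kappa cp cm).

(** Here du = - y sin s and dv = y (cos s - 1): the tangent at s = 0 is - y in the direction of u,
    and the vertical displacement disappears in the remainder. *)
Lemma arc_jet j y : 0 < y -> jet (fun s => f (arc y s) j 0) (f (0 +i* y) j 0)
  (- (y%:C * ((2 * pi) *i * fsum j y))).
Proof.
move=> y0; have [a [B [r [B0 r0 hB]]]] := real_analytic_expansion (hana j) y0.
have ja : jet (fun u => f (u +i* y) j 0) (f (0 +i* y) j 0) a.
  exists B, r; split => // s sr.
  by have := hB s 0 sr; rewrite normr0 addr0 add0r; apply.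
(* The linear coefficient of the real-analytic expansion is the derivative in u computed term by
   term. *)
have [_ <-] := jet_uniq ja (fourier_jet hkappa hc j y0).
(* The summands come from dv, du ^ 2 and the replacement of sin s by s. *)
exists (B * (y + y ^+ 2) + y * normc a), (Num.min 1 (r / y)); split.
- by rewrite !(addr_ge0, mulr_ge0) ?normc_ge0 ?sqr_ge0// ltW.
- by rewrite lt_min ltr01 divr_gt0.
move=> s; rewrite lt_min => /andP[s1]; rewrite ltr_pdivlMr// => sy.
have s2 : `|s| ^+ 2 = s ^+ 2 by rewrite real_normK ?num_real.
have du : `|- (y * sin s)| <= y * `|s|.
  by rewrite normrN normrM gtr0_norm// ler_pM2l// sin_bound.
have dv : `|y * (cos s - 1)| <= y * s ^+ 2.
  by rewrite normrM gtr0_norm// ler_pM2l// -s2 (@cosB1_bound _ 1).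
have dur : `|- (y * sin s)| < r by rewrite (le_lt_trans du)// mulrC.
have dvr : `|y * (cos s - 1)| < r.
  rewrite (le_lt_trans dv)// mulrC (le_lt_trans _ sy)// ler_pM2r// -s2.
  by rewrite expr2 ler_piMl// ltW.
have := hB _ _ dur dvr.
have -> : y + y * (cos s - 1) = y * cos s by ring.
rewrite -/(arc y s) => h.
have -> : f (arc y s) j 0 - (f (0 +i* y) j 0 + s%:C * - (y%:C * a)) =
  (f (arc y s) j 0 - (f (0 +i* y) j 0 + (- (y * sin s))%:C * a))
  - (y * (sin s - s))%:C * a.
  by rewrite rmorphN !rmorphM rmorphB/=; ring.
rewrite (le_trans (normcB_triangle _ _))// mulrDl lerD//.
  rewrite (le_trans h)// -mulrA ler_wpM2l// mulrDl lerD//.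
  by rewrite sqrrN exprMn ler_wpM2l ?sqr_ge0// -s2 -[leLHS]real_normK ?num_real//
    lerXn2r ?nnegrE// sin_bound.
rewrite normcM normc_real normrM gtr0_norm// [leRHS]mulrAC ler_wpM2r ?normc_ge0//.
by rewrite ler_pM2l// -s2 sinBx_bound.
Qed.

Lemma jet_opp (g : R -> R[i]) a0 a1 : jet g a0 a1 ->
  jet (fun s => g (- s)) a0 (- a1).
Proof.
move=> [C [r [C0 r0 hg]]]; exists C, r; split => // s sr.
have := hg (- s); rewrite normrN sqrrN => /(_ sr).
by rewrite rmorphN/= mulNr mulrN.
Qed.

(** Comparison of the linear terms in s of the two sides of [slash_arc]. The summand k i f comes
    from the factor e ^ (i k s). *)
Lemma freq_sum_inv j y : 0 < y ->
  (y^-1)%:C * ((2 * pi) *i * fsum j y^-1) =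
  autS y * \sum_l rho matS j l *
    (k *i * f (0 +i* y) l 0 - y%:C * ((2 * pi) *i * fsum l y)).
Proof.
move=> y0; have yi0 : 0 < y^-1 by rewrite invr_gt0.
have j1 := jet_opp (arc_jet j yi0).
have j2 : jet (fun s => autS y * (cis (k * s) *
    \sum_l rho matS j l * f (arc y s) l 0)) _ _ :=
  jetZ (autS y) (jetM (jet_cis k) (jet_sum (index_enum 'I_m)
    (fun l => jetZ (rho matS j l) (arc_jet l y0)))).
have E s : `|s| < 1 -> autS y * (cis (k * s) *
    \sum_l rho matS j l * f (arc y s) l 0) = f (arc y^-1 (- s)) j 0.
  by move=> s1; rewrite slash_arc// !mxE mulrA.
have [_ e] := jet_uniq j1 (jet_ext ltr01 E j2).
move: e; rewrite opprK => ->; congr (_ * _).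
rewrite mul1r addrC mulr_sumr -big_split/=; apply: eq_bigr => l _.
move: (fsum l y) (f _ l 0) (rho _ _ _) => S F r.
by ring.
Qed.

(** The value of delta_k f at tau = i y: the factor i y times the derivative 2 pi i [freq_sum] is -
    2 pi y [freq_sum]. *)
Definition delta_form j (y : R) : R[i] :=
  (k / 2)%:C * f (0 +i* y) j 0 - (2 * pi)%:C * (y%:C * fsum j y).

(** The summand k i f contributes - k f, which turns k / 2 into - k / 2; the frequency part changes
    sign as well, whence the overall minus sign. *)
Lemma delta_algebra (y : R) (c F1 S1 : R[i]) (r F S : 'I_m -> R[i]) :
  (y^-1)%:C * ((2 * pi) *i * S1) =
    c * \sum_l r l * (k *i * F l - y%:C * ((2 * pi) *i * S l)) ->
  F1 = c * \sum_l r l * F l ->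
  (k / 2)%:C * F1 - (2 * pi)%:C * ((y^-1)%:C * S1) =
  - (c * \sum_l r l * ((k / 2)%:C * F l - (2 * pi)%:C * (y%:C * S l))).
Proof.
(* The imaginary unit is abstracted to an element with square -1, which [ring] and [field] treat as
   a variable. *)
have [I [ii iE]] : exists I : R[i], I * I = -1 /\ forall x : R, x *i = I * x%:C.
  by exists 'i; split => [|x]; apply: complexP; rewrite ?creM ?cimM/=; ring.
rewrite (iE k) (iE (2 * pi)).
have -> : (k / 2)%:C = k%:C / 2 :> R[i] by rewrite rmorphM/= fmorphV rmorph_nat.
move: (y%:C) ((y^-1)%:C) (k%:C) ((2 * pi)%:C) => a a' b p e1 e2.
have -> : p * (a' * S1) = - I * (a' * (I * p * S1)).
  transitivity (- (I * I) * (p * (a' * S1))); last by ring.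
  by rewrite ii opprK mul1r.
rewrite e1 e2 (mulrCA (b / 2) c) (mulrCA (- I) c) -mulrBr -[RHS]mulrN; congr (_ * _).
rewrite !mulr_sumr -sumrB -sumrN; apply: eq_bigr => l _.
have -> : - I * (r l * (I * b * F l - a * (I * p * S l))) =
   - (I * I) * (r l * (b * F l - a * (p * S l))) by ring.
by rewrite ii; field.
Qed.

Lemma delta_form_inv j y : 0 < y ->
  delta_form j y^-1 = - (autS y * \sum_l rho matS j l * delta_form l y).
Proof.
move=> y0; apply: (delta_algebra (freq_sum_inv j y0)).
by rewrite form_inv// !mxE.
Qed.

End FunctionalEquation.

(** * Absolute convergence of L_f on the domain of L_(delta f) *)

Section Weights.
Variable R : realType.
Implicit Types (phi : R -> R[i]) (x y : R).
Local Notation Rpos := (@Rpos R).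
Local Notation mu := (@lebesgue_measure R).

(** On ]0, 1] the power is one of 1 / x, absorbed by e ^ (1 / x); on ]1, X] it is bounded. *)
Lemma powR_le_expR_inv (a X : R) : exists2 C, 0 <= C &
  forall x, 0 < x -> x <= X -> x `^ a <= C * expR x^-1.
Proof.
have [n hn] := powR_le_expr (- a).
exists ((n.+1)`!%:R + X `^ `|a|); first by rewrite addr_ge0// powR_ge0.
move=> x x0 xX; have xi0 : 0 < x^-1 by rewrite invr_gt0.
rewrite mulrDl; have [x1|x1] := leP x 1.
  rewrite (@le_trans _ _ ((n.+1)`!%:R * expR x^-1))//; last first.
    by rewrite lerDl mulr_ge0 ?powR_ge0// expR_ge0.
  rewrite (le_trans _ (expr_le_expR n (ltW xi0)))//.
  have -> : x `^ a = x^-1 `^ (- a).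
    by rewrite -powR_inv1 ?ltW// -powRrM mulN1r opprK.
  by apply: hn; rewrite invf_cp1 ?inE// ltW.
rewrite (@le_trans _ _ (X `^ `|a| * expR x^-1))//; last first.
  by rewrite lerDr mulr_ge0// expR_ge0.
apply: (@le_trans _ _ (x `^ `|a|)).
  by apply: ler_powR; [exact: ltW|exact: ler_norm].
apply: (@le_trans _ _ (X `^ `|a|)).
  by apply: ge0_ler_powR; rewrite ?nnegrE// ltW// (lt_le_trans x0).
by rewrite ler_peMr ?powR_ge0// -expR0 ler_expR ltW.
Qed.

Lemma cnorm1_le_add (g g1 g2 : R -> R[i]) :
  cmeasurable g -> cmeasurable g1 -> cmeasurable g2 ->
  (forall y, 0 < y -> normc (g y) <= normc (g1 y) + normc (g2 y)) ->
  (cnorm1 g <= cnorm1 g1 + cnorm1 g2)%E.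
Proof.
move=> mg m1 m2 h; rewrite /cnorm1 -ge0_integralD//; last 5 first.
- exact: measurable_Rpos.
- by move=> x _; rewrite lee_fin normc_ge0.
- exact: measurable_EFin_normc.
- by move=> x _; rewrite lee_fin normc_ge0.
- exact: measurable_EFin_normc.
apply: ge0_le_integral => //.
- exact: measurable_Rpos.
- by move=> x _; rewrite lee_fin normc_ge0.
- exact: measurable_EFin_normc.
- by apply: emeasurable_funD; exact: measurable_EFin_normc.
- by move=> x /Rpos_gt0 x0; rewrite -EFinD lee_fin h.
Qed.

Lemma measurable_expR_inv (c : R) : measurable_fun Rpos (fun y => expR (c * y^-1)).
Proof.
apply: measurableT_comp => //; apply: measurable_funM => //.
exact: measurable_inv_Rpos.
Qed.

Variables (k : R) (chi : 'M[int]_2 -> R[i]) (n0 : nat).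
Hypothesis hchi : normc (chi matS) = 1.
Hypothesis hn0 : (0 < n0)%N.

(** Slashing twice is multiplication by a constant, so phi and phi|S can exchange roles. *)
Lemma slashS_slashS phi x : 0 < x ->
  slashS k chi (slashS k chi phi) x = chi matS ^+ 2 * phi x.
Proof.
move=> x0; rewrite /slashS invrK.
have h : (x `^ (k - 2))%:C * (x^-1 `^ (k - 2))%:C = 1 :> R[i].
  rewrite -rmorphM/= -powR_inv1 ?ltW// -powRrM mulN1r -powRD ?subrr ?powRr0//.
  by rewrite (gt_eqF x0) implybT.
transitivity ((x `^ (k - 2))%:C * (x^-1 `^ (k - 2))%:C * (chi matS ^+ 2 * phi x)).
  by ring.
by rewrite h mul1r.
Qed.

(* Rapid decay of phi at 0 is rapid decay of phi|S at infinity. *)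
Lemma weight_fin phi : cmeasurable phi -> cmeasurable (slashS k chi phi) ->
  laplace_acvg phi 0%:C ->
  laplace_acvg (slashS k chi phi) (- (2 * pi * n0%:R))%:C ->
  (cnorm1 (fun y => ((expR (2 * y^-1))%:C * phi y)%R) < +oo)%E.
Proof.
move=> mphi mS /laplace_acvgE h1 /laplace_acvgE h2.
have [C C0 hC] := powR_le_expR_inv k 1.
(* Inversion carries [g] to e ^ (2 pi n0 x) (phi|S)(x), up to the unimodular chi(S). *)
pose g y : R[i] := (expR (2 * pi * n0%:R * y^-1) * y `^ (- k))%:C * phi y.
have mg : cmeasurable g.
  apply: cmeasurable_kerM => //; apply: measurable_funM.
    exact: measurable_expR_inv.
  by apply: measurable_funS (@measurable_powR R _).
have gfin : (cnorm1 g < +oo)%E.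
  rewrite cnorm1_inv//; apply: le_lt_trans h2.
  rewrite le_eqVlt; apply/orP; left; apply/eqP.
  apply: eq_integral => x /set_mem/Rpos_gt0 x0.
  rewrite /g /slashS invrK opprK !normcM !normc_real hchi mulr1; congr EFin.
  have E : x ^- 2 * x^-1 `^ (- k) = x `^ (k - 2).
    rewrite -(powR_inv1 (ltW x0)) -powRrM mulN1r opprK.
    rewrite -[x ^- 2]powR_invn ?ltW// -powRD ?(gt_eqF x0) ?implybT//.
    by congr (_ `^ _); rewrite addrC.
  rewrite normrM (ger0_norm (expR_ge0 _)) !(ger0_norm (powR_ge0 _ _)) -E.
  rewrite (ger0_norm (_ : 0 <= x ^- 2)) ?invr_ge0 ?sqr_ge0//.
  by ring.
(* For y <= 1 the loss y ^ k <= C e ^ (1 / y) and the weight e ^ (2 / y) fit under e ^ (2 pi n0 /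
   y), as 3 <= 2 pi n0; for y > 1 the weight is at most e ^ 2 and the Laplace transform at 0
   suffices. *)
pose D := expR 2 + C.
have D0 : 0 <= D by rewrite addr_ge0// expR_ge0.
have mD (u : R -> R[i]) : cmeasurable u -> cmeasurable (fun y => D%:C * u y).
  by move=> mu0; exact: cmeasurableM (cmeasurable_cst _) mu0.
have me : cmeasurable (fun y => (expR (2 * y^-1))%:C * phi y).
  by apply: cmeasurable_kerM => //; exact: measurable_expR_inv.
apply: le_lt_trans (cnorm1_le_add me (mD _ mphi) (mD _ mg) _) _; last first.
  rewrite !cnorm1Z// lte_add_pinfty// lte_mul_pinfty ?lee_fin ?normc_ge0//.
  move: h1; congr (_ < _)%E; apply: cnorm1_ext => x _.
  by rewrite oppr0 mul0r expR0 mul1r.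
move=> y y0; rewrite !normcM !normc_real (ger0_norm D0).
rewrite (ger0_norm (expR_ge0 _)) (ger0_norm (mulr_ge0 (expR_ge0 _) (powR_ge0 _ _))).
rewrite mulrA -mulrDl ler_wpM2r ?normc_ge0//.
have yi0 : 0 < y^-1 by rewrite invr_gt0.
have [y1|y1] := leP y 1.
  rewrite (@le_trans _ _ (D * (expR (2 * pi * n0%:R * y^-1) * y `^ (- k))))//.
    have -> : expR (2 * y^-1) = y `^ k * expR (2 * y^-1) * y `^ (- k).
      rewrite mulrAC -powRD ?subrr ?powRr0 ?mul1r// (gt_eqF y0) implybT//.
    rewrite mulrA ler_wpM2r ?powR_ge0//.
    apply: (@le_trans _ _ (C * expR y^-1 * expR (2 * y^-1))).
      by rewrite ler_wpM2r ?expR_ge0// hC.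
    rewrite -mulrA -expRD ler_pM ?expR_ge0// /D ?lerDr ?expR_ge0//.
    rewrite ler_expR -[X in X + _]mul1r -mulrDl ler_pM2r//.
    have p2 := @pi_ge2 R.
    have n1 : 1 <= n0%:R :> R by rewrite ler1n.
    rewrite (@le_trans _ _ (2 * 2 * 1))//; first by lra.
    by rewrite !ler_pM// ?mulr_ge0// ler_pM2l.
  by rewrite lerDr.
rewrite (@le_trans _ _ D)//; last by rewrite lerDl !mulr_ge0 ?expR_ge0 ?powR_ge0.
rewrite (@le_trans _ _ (expR 2))//; last by rewrite /D lerDl.
by rewrite ler_expR ler_piMr// invf_le1// ltW.
Qed.

End Weights.

(** * Comparison of the two conditions of absolute convergence *)

Section Reduction.
Variables (R : realType) (m : nat) (k : R) (kappa : 'I_m -> R).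
Variables (f : R[i] -> 'cV[R[i]]_m) (cp cm : 'I_m -> int -> R[i]).
Hypothesis hkappa : forall j, 0 <= kappa j < 1.
Hypothesis hc : fourier_expansion k kappa f cp cm.
Implicit Types (j : 'I_m) (phi : R -> R[i]).
Local Notation Rpos := (@Rpos R).
Local Notation nu := (freq kappa).

Lemma nneseries_EFin_lty (b : nat -> R) : (forall n, 0 <= b n) ->
  cvgn (series b) -> (\sum_(n <oo) (b n)%:E < +oo)%E.
Proof.
move=> b0 cb.
rewrite (_ : \sum_(n <oo) (b n)%:E = (limn (series b))%:E)%E ?ltry//.
rewrite -EFin_lim//; congr (limn _); apply/funext => n /=.
by rewrite sumEFin seriesEnat.
Qed.

(* Where |nu| y < 1 the coefficients are controlled by the decay of phi at 0;
   elsewhere a factor |nu| y only makes the terms larger. *)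
Lemma abs_summable_descend (P : pred int) (c : int -> R[i])
    (ker : int -> R -> R) j phi :
  cmeasurable phi -> (forall n, P n -> measurable_fun Rpos (ker n)) ->
  (forall n y, 0 <= ker n y) ->
  (cnorm1 (fun y => ((expR (2 * y^-1))%:C * phi y)%R) < +oo)%E ->
  (forall h, half_index h -> exists C d : R, [/\ 0 <= C, 0 < d &
     forall n y, P (h n) -> 0 < y -> `|nu j (h n)| * y < 1 ->
       normc (c (h n)) * ker (h n) y <= C * expR (- d * n%:R) * expR (2 * y^-1)]) ->
  abs_summable P (fun n => c n * (nu j n)%:C) ker (twist phi 2) ->
  abs_summable P c ker phi.
Proof.
move=> mphi mker ker0 W hb hs h hh.
have [C [d [C0 d0 hCd]]] := hb h hh.
set V := fun y => _ in W.
have mV : cmeasurable V.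
  by apply: cmeasurable_kerM => //; exact: measurable_expR_inv.
have mt : cmeasurable (twist phi 2) by exact: cmeasurable_twist.
pose b n := C * expR (- d * n%:R).
have b0 n : 0 <= b n by rewrite mulr_ge0// expR_ge0.
pose A n := ((normc (restrZ P (fun n => c n * (nu j n)%:C) (h n)))%:E *
     cnorm1 (fun y => ((ker (h n) y)%:C * twist phi 2 y)%R))%E.
have A0 n : (0 <= A n)%E by rewrite mule_ge0 ?cnorm1_ge0// lee_fin normc_ge0.
have Vf : cnorm1 V \is a fin_num by rewrite ge0_fin_numE ?cnorm1_ge0.
pose w := fine (cnorm1 V).
have w0 : 0 <= w by rewrite fine_ge0// cnorm1_ge0.
have bw0 n : (0 <= (b n * w)%:E)%E by rewrite lee_fin mulr_ge0.
(* Each term is at most its counterpart in the condition for delta_k f plus the weighted norm of phi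
   times a geometric factor. *)
apply: (@le_lt_trans _ _ (\sum_(n <oo) (A n + (b n * w)%:E))%E).
  apply: lee_nneseries => n _.
    by move=> _; rewrite mule_ge0 ?cnorm1_ge0// lee_fin normc_ge0.
  rewrite /A /restrZ; case: ifPn => Pn; last by rewrite normc0 !mul0e add0e.
  have mk : cmeasurable (fun y => (ker (h n) y)%:C * phi y).
    by apply: cmeasurable_kerM => //; exact: mker.
  have mk2 : cmeasurable (fun y => (ker (h n) y)%:C * twist phi 2 y).
    by apply: cmeasurable_kerM => //; exact: mker.
  rewrite EFinM /w fineK// -(ger0_norm (b0 n)) -normc_real -!cnorm1Z//.
  apply: cnorm1_le_add; try by apply: cmeasurableM => //; exact: cmeasurable_cst.
  move=> y y0; rewrite !normcM !normc_real (ger0_norm (ker0 _ _)) (ger0_norm (b0 n)).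
  rewrite (ger0_norm (expR_ge0 _)) (ger0_norm (powR_ge0 _ _)).
  have -> : (2 - 1 : R) = 1 by ring.
  rewrite (powRr1 (ltW y0)).
  have [big|small] := leP 1 (`|nu j (h n)| * y).
    rewrite (@le_trans _ _ (normc (c (h n)) * `|nu j (h n)| *
      (ker (h n) y * (normc (phi y) * y))))//; last first.
      by rewrite lerDl !mulr_ge0 ?expR_ge0 ?normc_ge0.
    rewrite (_ : _ * _ * (_ * (_ * y)) =
      (normc (c (h n)) * (ker (h n) y * normc (phi y))) * (`|nu j (h n)| * y)); last by ring.
    by rewrite ler_peMr// !mulr_ge0 ?normc_ge0.
  rewrite (@le_trans _ _ (b n * (expR (2 * y^-1) * normc (phi y))))//; last first.
    by rewrite lerDr !mulr_ge0 ?normc_ge0// ltW.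
  by rewrite !mulrA ler_wpM2r ?normc_ge0// hCd.
rewrite nneseriesD// lte_add_pinfty//; first exact: hs.
apply: nneseries_EFin_lty; first by move=> n; rewrite mulr_ge0.
rewrite (_ : (fun n => _) = (fun n => (C * w) * expR (- d * n%:R))).
  exact: cvg_series_expR.
by apply/funext => n; rewrite /b mulrAC.
Qed.

Lemma small_arg_inv (a y : R) : 0 < y -> a * y < 1 -> a < y^-1.
Proof. by move=> y0; rewrite -ltr_pdivlMr// mul1r. Qed.

(** On the negative half finitely many coefficients survive and |nu| y < 1 bounds the kernel. On the
    other half the coefficients are at most B e ^ (nu / 2). A zero frequency satisfies |nu| y < 1
    for every y, so the weight must not vanish at infinity. *)
Lemma plus_local_bound j h : half_index h -> exists C d : R, [/\ 0 <= C, 0 < d &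
  forall n y, true -> 0 < y -> `|nu j (h n)| * y < 1 ->
    normc (cp j (h n)) * pkern kappa j (h n) y
    <= C * expR (- d * n%:R) * expR (2 * y^-1)].
Proof.
have pi0 := @pi_gt0 R.
case=> ->; last first.
  have [N hN] := plus_coef_Negz hc j.
  have [C [d [C0 d0 hCd]]] := exp_decay_finite hN.
  exists (C * expR (2 * pi)), d; split => // [|n y _ y0 small].
    by rewrite mulr_ge0// expR_ge0.
  have yi0 : 0 < y^-1 by rewrite invr_gt0.
  apply: (@le_trans _ _ (C * expR (- d * n%:R) * expR (2 * pi))).
    rewrite ler_pM ?normc_ge0 ?expR_ge0// ler_expR.
    rewrite (_ : - _ * y = 2 * pi * (- nu j (Negz n) * y)); last by ring.
    rewrite ger_pMr ?mulr_gt0// (le_trans _ (ltW small))// ler_pM2r//.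
    by rewrite -normrN ler_norm.
  rewrite mulrAC ler_peMr ?mulr_ge0 ?expR_ge0//.
  by rewrite -expR0 ler_expR mulr_ge0// ltW.
(* At height 1 / (4 pi) the kernel is e ^ (- nu / 2). *)
have e0 : 0 < (4 * pi)^-1 :> R by rewrite invr_gt0 mulr_gt0.
have [B B0 hB] := plus_coef_bound hc j e0.
(* From n <= nu < 1 / y follows nu / 2 <= - n + 2 / y. *)
exists B, 1; split => // n y _ y0 small.
have nu0 : n%:R <= nu j (Posz n) := freq_Posz hkappa j n.
have nu1 : 0 <= nu j (Posz n) by rewrite (le_trans _ nu0).
move: small; rewrite (ger0_norm nu1) => /(small_arg_inv y0) small.
have hcp : normc (cp j (Posz n)) <= B * expR (nu j (Posz n) / 2).
  rewrite -(ler_pM2r (expR_gt0 (- (nu j (Posz n) / 2)))) -[leRHS]mulrA -expRD.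
  rewrite subrr expR0 mulr1 (le_trans _ (hB n))// /pkern.
  have E (p a : R) : p != 0 -> - (2 * p * a) * (4 * p)^-1 = - (a / 2).
    by move=> p0; field.
  by rewrite E// gt_eqF.
apply: (@le_trans _ _ (normc (cp j (Posz n)) * 1)).
  rewrite ler_wpM2l ?normc_ge0// -expR0 ler_expR mulNr oppr_le0.
  by rewrite !mulr_ge0// ltW.
rewrite mulr1 (le_trans hcp)// -mulrA ler_wpM2l// -expRD ler_expR.
by lra.
Qed.

(** Monotonicity of K reduces to s = s0, where K is at most a constant times a negative power of y;
    e ^ (1 / y) absorbs that power. *)
Lemma nker_bound (s0 X : R) : 0 < s0 -> 0 < X -> exists2 M, 0 <= M &
  forall s y, s0 <= s -> 0 < y -> y <= X ->
    y `^ (1 - k) * nker k s y <= M * expR y^-1.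
Proof.
move=> s00 X0.
have [n [C C0 hK]] := Kfun_le k.
have [D D0 hD] := powR_le_expR_inv (1 - k - n%:R) X.
exists (C * (2 * s0)^-1 ^+ n * expR (s0 * X) * D).
  by rewrite !mulr_ge0 ?expR_ge0// exprn_ge0// invr_ge0 mulr_ge0// ltW.
move=> s y s0s y0 yX; have s0' : 0 < s := lt_le_trans s00 s0s.
have w0 : 0 < 2 * s0 * y by rewrite !mulr_gt0.
have K1 : Kfun k (2 * s * y) <= C * (2 * s0 * y)^-1 ^+ n * expR (s0 * X).
  rewrite (@le_trans _ _ (Kfun k (2 * s0 * y)))//.
    by apply: Kfun_nonincreasing => //; rewrite ler_pM2r// ler_pM2l.
  rewrite (le_trans (hK _ w0))// ler_wpM2l//.
    by rewrite mulr_ge0// exprn_ge0// invr_ge0 ltW.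
  by rewrite ler_expR (_ : 2 * s0 * y / 2 = s0 * y) ?ler_pM2l//; field.
have n1 : nker k s y <= C * (2 * s0 * y)^-1 ^+ n * expR (s0 * X).
  rewrite /nker (le_trans _ K1)// ler_piMl ?Kfun_ge0//.
  by rewrite -expR0 ler_expR mulNr oppr_le0 mulr_ge0// ltW.
apply: (@le_trans _ _ (y `^ (1 - k) * (C * (2 * s0 * y)^-1 ^+ n * expR (s0 * X)))).
  by rewrite ler_wpM2l ?powR_ge0.
have -> : y `^ (1 - k) * (C * (2 * s0 * y)^-1 ^+ n * expR (s0 * X)) =
    C * (2 * s0)^-1 ^+ n * expR (s0 * X) * (y `^ (1 - k - n%:R)).
  rewrite (@powRB _ y (1 - k) n%:R) ?(gt_eqF y0) ?implybT//.
  rewrite (powR_mulrn _ (ltW y0)) invfM exprMn.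
  by rewrite -[(y ^+ n)^-1]exprVn; ring.
rewrite -[leRHS]mulrA ler_wpM2l ?hD//.
by rewrite !mulr_ge0 ?expR_ge0// exprn_ge0// invr_ge0 mulr_ge0// ltW.
Qed.

Lemma minus_local_bound j h : half_index h -> exists C d : R, [/\ 0 <= C, 0 < d &
  forall n y, negfreq kappa j (h n) -> 0 < y -> `|nu j (h n)| * y < 1 ->
    normc (cm j (h n)) * mkern k kappa j (h n) y
    <= C * expR (- d * n%:R) * expR (2 * y^-1)].
Proof.
have pi0 := @pi_gt0 R.
case=> ->; first by exists 0, 1; split => // n y; rewrite negfreq_Posz.
have /andP[_ k1] := hkappa j.
(* The least |nu| among the negative frequencies, attained at n = -1. With |nu| y < 1 it confines y
   to y <= 1 / nu0. *)
pose nu0 := 1 - kappa j.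
have nu00 : 0 < nu0 by rewrite subr_gt0.
(* With s = 2 pi a, the factor e ^ (- s e) of [nker] and the lower bound e ^ (- 2 s e) for K combine
   to e ^ (- 3 s e), which is e ^ (- a / 2) at this height. *)
pose e := (12 * pi)^-1 : R.
have e0 : 0 < e by rewrite invr_gt0 mulr_gt0.
have [B B0 hB] := minus_coef_bound hkappa hc j e0.
have [c c0 hcK] := Kfun_ge k.
have s00 : 0 < 2 * pi * nu0 by rewrite !mulr_gt0.
have X0 : 0 < nu0^-1 by rewrite invr_gt0.
have [M M0 hM] := nker_bound s00 X0.
have ec0 : 0 < e `^ (1 - k) * c by rewrite mulr_gt0// powR_gt0.
(* The coefficient costs e ^ (a / 2) and the kernel e ^ (1 / y); from n < a < 1 / y follows a / 2 +
   1 / y <= - n / 2 + 2 / y. *)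
exists (B / (e `^ (1 - k) * c) * M), 2^-1; split => //.
  by rewrite !mulr_ge0// invr_ge0 ltW.
move=> n y _ y0.
have nn := negfreq_Negz hkappa j n.
have s0 := negfreq_arg_gt0 nn.
rewrite (ltr0_norm nn) => /(small_arg_inv y0) small.
set a := - nu j (Negz n) in small.
have a0 : n%:R < a := freq_Negz hkappa j n.
have a0' : 0 < a := le_lt_trans (ler0n _ n) a0.
have anu : nu0 <= a.
  by rewrite /a freq_NegzE opprD opprK lerD2r ler1n.
have sE : - (2 * pi * nu j (Negz n)) = 2 * pi * a by rewrite /a; ring.
have := hB n; rewrite /mkern sE /mker => hBn.
set s := 2 * pi * a in hBn *.
have s_0 : 0 < s by rewrite !mulr_gt0.
pose Q := normc (cm j (Negz n)) * (2 * s) `^ (1 - k).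
have Q0 : 0 <= Q by rewrite mulr_ge0 ?normc_ge0// powR_ge0.
have Qb : Q <= B / (e `^ (1 - k) * c) * expR (a / 2).
  rewrite mulrAC ler_pdivlMr// -(ler_pM2r (expR_gt0 (- (a / 2)))).
  rewrite -[leRHS]mulrA -expRD subrr expR0 mulr1 (le_trans _ hBn)//.
  rewrite [leRHS](_ : _ = Q * (e `^ (1 - k) * nker k s e)); last by rewrite /Q; ring.
  rewrite -[leLHS]mulrA ler_wpM2l// -mulrA ler_wpM2l ?powR_ge0// /nker.
  have -> : expR (- (a / 2)) = expR (- s * e) * expR (- (2 * s * e)).
    have E (p b : R) : p != 0 -> - (b / 2) =
        - (2 * p * b) * (12 * p)^-1 + - (2 * (2 * p * b) * (12 * p)^-1).
      by move=> p0; field.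
    by rewrite -expRD; congr expR; rewrite [LHS](E pi)// gt_eqF.
  by rewrite mulrCA ler_wpM2l ?expR_ge0// hcK// !mulr_gt0.
rewrite [leLHS](_ : _ = Q * (y `^ (1 - k) * nker k s y)); last by rewrite /Q; ring.
have yX : y <= nu0^-1.
  rewrite -[y]invrK lef_pV2 ?posrE ?invr_gt0//.
  by rewrite (le_trans anu)// ltW.
have ss : 2 * pi * nu0 <= s by rewrite ler_pM2l// mulr_gt0.
rewrite (le_trans (ler_pM Q0 _ Qb (hM _ _ ss y0 yX)))//.
  by rewrite mulr_ge0 ?powR_ge0// nker_ge0.
rewrite mulrACA -[leRHS]mulrA ler_wpM2l//.
  by rewrite !mulr_ge0// invr_ge0 ltW.
rewrite -!expRD ler_expR; move: a0 small; lra.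
Qed.

Lemma abs_summable_of_delta j phi : cmeasurable phi ->
  (cnorm1 (fun y => ((expR (2 * y^-1))%:C * phi y)%R) < +oo)%E ->
  abs_summable xpredT (fun n => cp j n * (nu j n)%:C) (pkern kappa j) (twist phi 2) ->
  abs_summable (negfreq kappa j) (fun n => cm j n * (nu j n)%:C)
    (mkern k kappa j) (twist phi 2) ->
  abs_summable xpredT (cp j) (pkern kappa j) phi /\
  abs_summable (negfreq kappa j) (cm j) (mkern k kappa j) phi.
Proof.
move=> mphi W s1 s2; split.
  apply: abs_summable_descend W _ s1 => //.
  - by move=> n _; exact: measurable_expRM.
  - by move=> n y; exact: expR_ge0.
  - by move=> h hh; exact: plus_local_bound.
apply: abs_summable_descend W _ s2 => //.
- by move=> n nn; apply: measurable_mker; exact: negfreq_arg_gt0.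
- by move=> n y; exact: mker_ge0.
- by move=> h hh; exact: minus_local_bound.
Qed.

End Reduction.

(** * The functional equations *)

Section FunctionalEquationIntegral.
Variables (R : realType) (m : nat) (k : R) (chi : 'M[int]_2 -> R[i]).
Variables (rho : 'M[int]_2 -> 'M[R[i]]_m).
Implicit Types (phi : R -> R[i]) (F : 'I_m -> R -> R[i]).

(** After inversion the Jacobian y ^ -2 and the factor y ^ k of [autS] combine to y ^ (k - 2), the
    power in phi|S, which also takes up chi(S); i ^ k and rho(S) stay outside. The constant [e] is 1
    for f and -1 for delta_k f. *)
Lemma cint_slashS F (e : R[i]) phi :
  (forall j y, 0 < y -> F j y^-1 =
     e * (autS k chi y * \sum_l rho matS j l * F l y)) ->
  (forall j, cintegrable (fun y => F j y * phi y)) ->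
  (forall j, cintegrable (fun y => F j y * slashS k chi phi y)) ->
  forall j, cint (fun y => F j y * phi y) =
    e * (cpow 'i k * \sum_l rho matS j l * cint (fun y => F l y * slashS k chi phi y)).
Proof.
move=> hF i1 i2 j; rewrite (cint_inv (i1 j).1).
pose G l y := (e * (cpow 'i k * rho matS j l)) * (F l y * slashS k chi phi y).
have [_ sG] := cintegrable_sum (index_enum 'I_m)
  (fun l => cintegrableZ (e * (cpow 'i k * rho matS j l)) (i2 l)).
rewrite (cint_ext (h := fun y => \sum_l G l y)); last first.
  move=> y y0; rewrite hF// /G /slashS /autS.
  have E : (y ^- 2)%:C * (y `^ k)%:C = (y `^ (k - 2))%:C :> R[i].
    rewrite -rmorphM/= -[y ^- 2]powR_invn ?(ltW y0)// -powRD ?(gt_eqF y0) ?implybT//.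
    by rewrite addrC.
  rewrite -E.
  rewrite [RHS](eq_bigr (fun l => (rho matS j l * F l y) * (e * cpow 'i k *
    ((y ^- 2)%:C * (y `^ k)%:C * chi matS * phi y^-1)))); last by move=> l _; ring.
  by rewrite -mulr_suml; ring.
rewrite sG !mulr_sumr; apply: eq_bigr => l _.
by rewrite cintZ// !mulrA.
Qed.

End FunctionalEquationIntegral.

Section MainTheorem.
Variables (R : realType) (m : nat) (k : R) (chi : 'M[int]_2 -> R[i]).
Variables (rho : 'M[int]_2 -> 'M[R[i]]_m) (kappa : 'I_m -> R).
Variables (f : R[i] -> 'cV[R[i]]_m) (cp cm : 'I_m -> int -> R[i]) (n0 : nat).
Hypothesis hchi : multiplier_system k chi.
Hypothesis hkappa : forall j, 0 <= kappa j < 1.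
Hypothesis hc : fourier_expansion k kappa f cp cm.
Hypothesis hn0 : (0 < n0)%N.
Implicit Types (phi : R -> R[i]) (j : 'I_m).

Definition abs_convergent phi :=
  forall j, abs_summable xpredT (cp j) (pkern kappa j) phi /\
    abs_summable (negfreq kappa j) (cm j) (mkern k kappa j) phi.

Lemma Lseries_cint phi : cmeasurable phi -> abs_convergent phi -> forall j,
  cintegrable (fun y => f (0 +i* y) j 0 * phi y) /\
  Lseries k kappa cp cm phi j 0 = cint (fun y => f (0 +i* y) j 0 * phi y).
Proof.
move=> mphi hs j; have [s1 s2] := hs j.
have [||ig e] := kernel_sum_cint mphi s1 s2.
- by move=> y y0; have [] := csumZ_terms_at_iy hc j y0.
- by move=> y y0; have [] := csumZ_terms_at_iy hc j y0.
have E y : 0 < y -> kernel_sum k kappa (cp j) (cm j) j y * phi y =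
    f (0 +i* y) j 0 * phi y.
  by move=> y0; have [_ _ ->] := csumZ_terms_at_iy hc j y0.
split; first exact: cintegrable_ext E ig.
by rewrite -(cint_ext E) -e mxE.
Qed.

Lemma test_space_measurable phi : test_space k kappa n0 cp cm phi ->
  cmeasurable phi.
Proof. by case=> /piecewise_smooth_cmeasurable. Qed.

Lemma test_space_fin phi : test_space k kappa n0 cp cm phi -> abs_convergent phi.
Proof.
move=> tp j; have mphi := test_space_measurable tp.
by case: tp => _ _ _ /(_ j); apply: abs_summable_of_esum.
Qed.

Lemma test_space_delta_measurable phi : test_space_delta k kappa n0 cp cm phi ->
  cmeasurable phi.
Proof. by case=> /piecewise_smooth_cmeasurable. Qed.

Lemma test_space_delta_fin phi : test_space_delta k kappa n0 cp cm phi ->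
  forall j, abs_summable xpredT (fun n => cp j n * (freq kappa j n)%:C)
    (pkern kappa j) (twist phi 2) /\
  abs_summable (negfreq kappa j) (fun n => cm j n * (freq kappa j n)%:C)
    (mkern k kappa j) (twist phi 2).
Proof.
move=> tp j; have mphi := test_space_delta_measurable tp.
case: tp => _ _ _ /(_ j); apply: abs_summable_of_esum.
  exact: cmeasurable_twist.
by move=> y y0; exact: twist_twist.
Qed.

Lemma Lseries_delta_cint phi : test_space_delta k kappa n0 cp cm phi ->
  abs_convergent phi -> forall j,
  cintegrable (fun y => delta_form k kappa f cp cm j y * phi y) /\
  Lseries_delta k kappa cp cm phi j 0 =
  cint (fun y => delta_form k kappa f cp cm j y * phi y).
Proof.
move=> tp hs j; have mphi := test_space_delta_measurable tp.
have [i1 e1] := Lseries_cint mphi hs j.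
have [s1 s2] := test_space_delta_fin tp j.
have [||i2 e2] := kernel_sum_cint (cmeasurable_twist 2 mphi) s1 s2.
- by move=> y y0; have [] := freq_sum_cvg hkappa hc j y0.
- by move=> y y0; have [] := freq_sum_cvg hkappa hc j y0.
have E y : 0 < y -> (k / 2)%:C * (f (0 +i* y) j 0 * phi y) +
  - (2 * pi)%:C * (freq_sum k kappa cp cm j y * twist phi 2 y) =
  delta_form k kappa f cp cm j y * phi y.
  move=> y0; rewrite /delta_form /twist.
  have -> : (2 - 1 : R) = 1 by ring.
  rewrite (powRr1 (ltW y0)).
  move: (f _ j 0) (freq_sum _ _ _ _ _ _) (phi y) y%:C => a b c d.
  by move: (2 * pi)%:C => p; ring.
split.
  apply: cintegrable_ext E _.
  exact: cintegrableD (cintegrableZ _ i1) (cintegrableZ _ i2).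
rewrite -(cint_ext E) cintD; [|exact: cintegrableZ|exact: cintegrableZ].
have entry (L A B : 'cV[R[i]]_m) (a b : R[i]) :
    (a *: L - b *: A - b *: B) j 0 = a * L j 0 + - b * (A j 0 + B j 0).
  by rewrite !mxE; ring.
rewrite cintZ// cintZ// -e1 -[cint _]e2 [LHS]entry; congr (_ + _ * _).
apply: (f_equal2 +%R); first by rewrite mxE.
rewrite mxE; apply: csumZ_ext => n _; apply: (f_equal2 *%R); first by [].
by apply: nonhol_ext => y y0; rewrite twist_twist.
Qed.

Lemma test_space_delta_plus_fin phi :
  test_space_delta k kappa n0 cp cm phi ->
  cmeasurable (slashS k chi phi) ->
  laplace_acvg (slashS k chi phi) (- (2 * pi * n0%:R))%:C ->
  abs_convergent phi.
Proof.
move=> tp mS aS j; have mphi := test_space_delta_measurable tp.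
have [s1 s2] := test_space_delta_fin tp j.
apply: (abs_summable_of_delta hkappa hc mphi) s1 s2.
apply: (weight_fin _ hn0 mphi mS _ aS); first exact: hchi.1 SL2Z_matS.
case: tp => _ /(_ 0%:C) h _ _; apply: h => /=.
by rewrite oppr_le0 !mulr_ge0// pi_ge0.
Qed.

End MainTheorem.
Unset Implicit Arguments.

Theorem theorem3p2 (R : realType) (m : nat) (k : R) (chi : 'M[int]_2 -> R[i])
    (rho : 'M[int]_2 -> 'M[R[i]]_m) (kappa : 'I_m -> R)
    (f : R[i] -> 'cV[R[i]]_m) (cp cm : 'I_m -> int -> R[i]) (n0 : nat)
    (hk : half_integer k)
    (hchi : multiplier_system k chi)
    (hrho : unitary_representation rho)
    (hkappa : forall j, 0 <= kappa j < 1)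
    (hf : harmonic_maass_form k chi rho kappa f)
    (hc : fourier_expansion k kappa f cp cm)
    (hn0 : (0 < n0)%N)
    (hgrowth : exp_growth f n0) :
  (forall phi : R -> R[i],
     test_space k kappa n0 cp cm phi ->
     test_space k kappa n0 cp cm (slashS k chi phi) ->
     Lseries k kappa cp cm phi
     = cpow 'i k *: (rho matS *m Lseries k kappa cp cm (slashS k chi phi)))
  /\
  (forall phi : R -> R[i],
     test_space_delta k kappa n0 cp cm phi ->
     test_space_delta k kappa n0 cp cm (slashS k chi phi) ->
     Lseries_delta k kappa cp cm phi
     = - cpow 'i k *: (rho matS *m
         Lseries_delta k kappa cp cm (slashS k chi phi))).
Proof.
case: hf => hana hslash _ _; split => phi t1 t2.
  have L1 := Lseries_cint hc (test_space_measurable t1) (test_space_fin t1).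
  have L2 := Lseries_cint hc (test_space_measurable t2) (test_space_fin t2).
  apply/colP => j; rewrite (L1 j).2.
  rewrite (@cint_slashS R m k chi rho (fun j y => f (0 +i* y) j 0) 1) ?mul1r.
  - rewrite !mxE; congr (_ * _); apply: eq_bigr => l _.
    by rewrite (L2 l).2.
  - by move=> l y y0; rewrite (form_inv hchi hrho hslash y0) !mxE mul1r.
  - by move=> l; exact: (L1 l).1.
  - by move=> l; exact: (L2 l).1.
have m1 := test_space_delta_measurable t1.
have m2 := test_space_delta_measurable t2.
have le_n0 : - (2 * pi * n0%:R) <= Re (- (2 * pi * n0%:R) : R)%:C by [].
have f1 : abs_convergent k kappa cp cm phi.
  apply: (test_space_delta_plus_fin hchi hkappa hc hn0 t1 m2).
  by case: t2 => _ h _ _; exact: h.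
have f2 : abs_convergent k kappa cp cm (slashS k chi phi).
  (* Convergence for phi|S needs decay of phi|S|S at infinity, which is that of phi up to a
     constant. *)
  have E x : 0 < x -> chi matS ^+ 2 * phi x = slashS k chi (slashS k chi phi) x.
    by move=> x0; rewrite slashS_slashS.
  apply: (test_space_delta_plus_fin hchi hkappa hc hn0 t2).
    exact: cmeasurable_ext E (cmeasurableM (cmeasurable_cst _) m1).
  have : laplace_acvg phi (- (2 * pi * n0%:R))%:C.
    by case: t1 => _ h _ _; exact: h.
  move=> /laplace_acvgE h; apply/laplace_acvgE; move: h.
  set g := fun x => _ * phi x => h.
  have mg : cmeasurable g.
    by apply: cmeasurable_kerM => //; exact: measurable_expRM.
  rewrite -(@cnorm1_ext _ (fun x => chi matS ^+ 2 * g x)).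
    by rewrite cnorm1Z// lte_mul_pinfty// lee_fin normc_ge0.
  by move=> x x0; rewrite -E// /g mulrCA.
have L1 := Lseries_delta_cint hkappa hc t1 f1.
have L2 := Lseries_delta_cint hkappa hc t2 f2.
apply/colP => j; rewrite (L1 j).2.
rewrite (@cint_slashS R m k chi rho (delta_form k kappa f cp cm) (-1)).
- rewrite !mxE mulN1r mulNr; congr (- (_ * _)); apply: eq_bigr => l _.
  by rewrite (L2 l).2.
- move=> l y y0.
  by rewrite (delta_form_inv hchi hrho hslash hkappa hana hc l y0) mulN1r.
- by move=> l; exact: (L1 l).1.
- by move=> l; exact: (L2 l).1.
Qed.
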